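(* Let $a_1>a_2>0$ with $a_1+a_2=1$, $B_2>0$, $\bar\gamma>0$, $R_1,R_2>0$ and $\gamma_j^{\mathrm{th}}=2^{R_j}-1$ for $j=1,2$. Let $h_2=h_{l2}h_sh_{g2}$ be the end-to-end channel coefficient of receiver Rx2 (model in the context), and let $$\gamma_{21}=\frac{a_1B_2\bar\gamma h_2^2}{a_2B_2\bar\gamma h_2^2+1},\qquad \gamma_{22}=a_2B_2\bar\gamma h_2^2 .$$ Then the outage probability $P_2^o=1-\mathbb P(\gamma_{21}\ge\gamma_1^{\mathrm{th}},\ \gamma_{22}\ge\gamma_2^{\mathrm{th}})$ of Rx2 is $$P_2^o=\begin{cases}F_{h_2}\left(\sqrt{\max\left\{\dfrac{\gamma_1^{\mathrm{th}}}{a_1B_2\bar\gamma-a_2B_2\bar\gamma\gamma_1^{\mathrm{th}}},\ \dfrac{\gamma_2^{\mathrm{th}}}{a_2B_2\bar\gamma}\right\}}\right), & \dfrac{a_1}{a_2}>\gamma_1^{\mathrm{th}},\\[2ex] 1, & \dfrac{a_1}{a_2}\le\gamma_1^{\mathrm{th}},\end{cases}$$ where $F_{h_2}$ is the cumulative distribution function of $h_2$, given for $x>0$ by $$F_{h_2}(x)=\frac{\omega}{\Gamma(\alpha)\Gamma(\beta)}\sum_{k=0}^{\infty}\binom{2k}{k}\left(\frac{v}{2}\right)^{2k} G_{2k+2,\,2k+4}^{2k+3,\,1}\left(\frac{\alpha\beta\, x}{A_0 h_{l2}}\,\Bigg|\,\begin{array}{c}1,\ \{c+1\}_1^{2k+1}\\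 \alpha,\ \beta,\ \{c\}_1^{2k+1},\ 0\end{array}\right),$$ with $c=\frac{(1+q^2)\omega}{2q}$, $v=\frac{(1-q^2)\omega}{2q}$, and $\omega,q,A_0$ the pointing-error parameters of Rx2.
   Context: System. A transmitter serves two receivers Rx1, Rx2 through an optical reconfigurable intelligent surface using power-domain non-orthogonal multiple access: $a_1,a_2$ are the power allocation coefficients of the two messages $x_1,x_2$, $B_2$ is the beam-splitting factor toward Rx2, $\bar\gamma$ is the transmit signal-to-noise ratio, and $R_1,R_2$ are the target rates. Rx2 first decodes $x_1$ (with signal-to-interference-plus-noise ratio $\gamma_{21}$), cancels it, and then decodes its own message $x_2$ (with ratio $\gamma_{22}$); it avoids outage exactly when $\gamma_{21}\ge\gamma_1^{\mathrm{th}}$ and $\gamma_{22}\ge\gamma_2^{\mathrm{th}}$. Channel model for Rx2. $h_2=h_{l2}h_sh_{g2}$, with $h_s$, $h_{g2}$ independent and the following factors. (i) Atmospheric loss: $h_{l2}>0$ is a deterministic constant. (ii) Atmospheric turbulence: $h_s>0$ has the Gamma-Gamma density $$f_{h_s}(x)=\frac{2(\alpha\beta)^{\frac{\alpha+\beta}{2}}}{\Gamma(\alpha)\Gamma(\beta)}x^{\frac{\alpha+\beta}{2}-1}K_{\alpha-\beta}\left(2\sqrt{\alpha\beta x}\right),\quad x>0,$$ where $K_\nu$ is the modified Bessel function of the second kind, and $\alpha,\beta>0$ are given in terms of the Rytov variance $\sigma_R^2>0$ by $\alpha=\left[\exp\left(\frac{0.49\sigma_R^2}{(1+1.11\sigma_R^{12/5})^{7/6}}\right)-1\right]^{-1}$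 and $\beta=\left[\exp\left(\frac{0.51\sigma_R^2}{(1+0.69\sigma_R^{12/5})^{5/6}}\right)-1\right]^{-1}$. (iii) Pointing errors: $h_{g2}\in[0,A_0]$ has density $$f_{h_{g2}}(x)=\frac{\omega}{A_0}\left(\frac{x}{A_0}\right)^{\frac{(1+q^2)\omega}{2q}-1} I_0\left(-\frac{(1-q^2)\omega}{2q}\ln\frac{x}{A_0}\right),\quad 0< x\le A_0,$$ where $I_0$ is the modified Bessel function of the first kind of order zero and $A_0,\omega,q>0$ are parameters of Rx2. Notation. $\{p\}_1^{N}$ in a parameter list means that $p$ is repeated $N$ times. $G_{p,q}^{m,n}$ is the Meijer G-function $$G_{p,q}^{m,n}\left(z\,\Big|\,\begin{array}{c}a_1,\dots,a_p\\ b_1,\dots,b_q\end{array}\right)=\frac{1}{2\pi i}\int_{\mathcal L}\frac{\prod_{j=1}^m\Gamma(b_j-s)\prod_{j=1}^n\Gamma(1-a_j+s)}{\prod_{j=m+1}^q\Gamma(1-b_j+s)\prod_{j=n+1}^p\Gamma(a_j-s)}z^s\,ds,$$ where $\mathcal L$ is a line running from $\psi-i\infty$ to $\psi+i\infty$ that has the poles of all $\Gamma(b_j-s)$, $j\le m$, to its right and the poles of all $\Gamma(1-a_j+s)$, $j\le n$, to its left (empty products equal 1; the $a_j$, $b_j$, $p$, $q$ in this definition are unrelated to the power coefficients and the channel parameter $q$). The convention $0^0=1$ is used when $v=0$. *)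

(* Defs.v *)
From mathcomp Require Import all_boot all_order all_algebra.
From mathcomp Require Import all_classical all_reals all_analysis.
From mathcomp Require Import complex.

Set Implicit Arguments.
Unset Strict Implicit.
Unset Printing Implicit Defensive.

Import Order.TTheory GRing.Theory Num.Theory.
Import numFieldNormedType.Exports.

Local Open Scope classical_set_scope.
Local Open Scope complex_scope.
Local Open Scope ring_scope.

Section ComplexFunctions.
Context {R : realType}.
Implicit Types (z s : R[i]) (t x : R).

Definition expC z : R[i] :=
  (expR (complex.Re z))%:C * (cos (complex.Im z) +i* sin (complex.Im z)).

(* t ^ z for a real base t > 0, with the real logarithm *)
Definition cpow t z : R[i] := expC (z * (ln t)%:C).

Definition Cintegral (D : set R) (f : R -> R[i]) : R[i] :=
  (\int[lebesgue_measure]_(t in D) complex.Re (f t)) +i*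
  (\int[lebesgue_measure]_(t in D) complex.Im (f t)).

(* Integral along the line from psi - i oo to psi + i oo, with ds = i dt. *)
Definition vline_integral (psi : R) (f : R[i] -> R[i]) : R[i] :=
  Cintegral setT (fun t => f (psi +i* t) * 'i%C).

Definition Euler_integral z : R[i] :=
  Cintegral `]0, +oo[ (fun t => cpow t (z - 1) * (expR (- t))%:C).

Definition cGamma_shift z : nat :=
  if 0 < complex.Re z then 0%N else (Num.truncn (- complex.Re z)).+1.

(* The Gamma function: Euler's integral for Re z > 0, continued by the
   functional equation Gamma(z) = Gamma(z + N) / (z (z + 1) ... (z + N - 1)),
   where N = cGamma_shift z is such that Re (z + N) > 0.
   At a pole the value is 0, because 0^-1 = 0, so that (cGamma z)^-1 is the
   entire function 1 / Gamma everywhere. *)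
Definition cGamma z : R[i] :=
  Euler_integral (z + (cGamma_shift z)%:R) /
  \prod_(0 <= l < cGamma_shift z) (z + l%:R).

(* Gamma(x) for real x > 0 *)
Definition rGamma x : R :=
  \int[lebesgue_measure]_(t in `]0, +oo[) (t `^ (x - 1) * expR (- t)).

(* The vertical line Re s = psi has the poles b_j + l (l >= 0) of
   Gamma(b_j - s), j <= m, to its right and the poles a_j - 1 - l of
   Gamma(1 - a_j + s), j <= n, to its left.  Parameters are numbered from 0:
   the j-th parameter is a`_j.-1. *)
Definition separating_line (m n : nat) (a b : seq R[i]) (psi : R) : Prop :=
  (forall j l : nat, (j < m)%N -> psi < complex.Re (b`_j + l%:R)) /\
  (forall j l : nat, (j < n)%N -> complex.Re (a`_j - 1 - l%:R) < psi).

Definition meijerG_integrand (m n p q : nat) (a b : seq R[i]) (x : R)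
    (s : R[i]) : R[i] :=
  (\prod_(0 <= j < m) cGamma (b`_j - s)) *
  (\prod_(0 <= j < n) cGamma (1 - a`_j + s)) /
  ((\prod_(m <= j < q) cGamma (1 - b`_j + s)) *
   (\prod_(n <= j < p) cGamma (a`_j - s))) * cpow x s.

(* G^{m,n}_{p,q}(x | a; b) for x > 0, with size a = p and size b = q.
   Any separating
   line gives the same value where the integral converges, so that one is
   picked by choice. *)
Definition meijerG (m n p q : nat) (a b : seq R[i]) (x : R) : R[i] :=
  ((2 * pi)%:C * 'i%C)^-1 *
  vline_integral (get [set psi | separating_line m n a b psi])
    (meijerG_integrand m n p q a b x).

(* I_0(x) = sum_k (x/2)^(2k) / (k!)^2 *)
Definition besselI0 x : R :=
  limn (series (fun k : nat => (x / 2) ^+ (2 * k) / (k`!)%:R ^+ 2)).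

(* K_nu(x), x > 0, as int_0^oo exp(- x cosh t) cosh(nu t) dt *)
Definition besselK (nu x : R) : R :=
  let ch (y : R) := (expR y + expR (- y)) / 2 in
  \int[lebesgue_measure]_(t in `]0, +oo[) (expR (- (x * ch t)) * ch (nu * t)).

End ComplexFunctions.

Section Channel.
Context {R : realType}.

(* sigma is the square root of the Rytov variance. *)
Definition turbulence_alpha (sigma : R) : R :=
  (expR ((49 / 100) * sigma ^+ 2 /
         (1 + (111 / 100) * sigma `^ (12 / 5)) `^ (7 / 6)) - 1)^-1.

Definition turbulence_beta (sigma : R) : R :=
  (expR ((51 / 100) * sigma ^+ 2 /
         (1 + (69 / 100) * sigma `^ (12 / 5)) `^ (5 / 6)) - 1)^-1.

Definition gamma_gamma_density (alpha beta x : R) : R :=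
  if 0 < x then
    2 * (alpha * beta) `^ ((alpha + beta) / 2) / (rGamma alpha * rGamma beta) *
    x `^ ((alpha + beta) / 2 - 1) *
    besselK (alpha - beta) (2 * Num.sqrt (alpha * beta * x))
  else 0.

Definition pointing_error_density (A0 omega q x : R) : R :=
  if 0 < x <= A0 then
    omega / A0 * (x / A0) `^ ((1 + q ^+ 2) * omega / (2 * q) - 1) *
    besselI0 (- ((1 - q ^+ 2) * omega / (2 * q) * ln (x / A0)))
  else 0.

End Channel.

Section RandomVariables.
Context {d : measure_display} {T : measurableType d} {R : realType}.
Variable P : probability T R.

Definition has_density (X : {RV P >-> R}) (f : R -> R) : Prop :=
  forall A : set R, measurable A ->
    distribution P X A = (\int[lebesgue_measure]_(x in A) (f x)%:E)%E.

Definition independent_RV2 (X Y : {RV P >-> R}) : Prop :=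
  forall A B : set R, measurable A -> measurable B ->
    P ((X @^-1` A) `&` (Y @^-1` B)) = (P (X @^-1` A) * P (Y @^-1` B))%E.

End RandomVariables.
Arguments has_density {d T R} P X f.
Arguments independent_RV2 {d T R} P X Y.

Section CDF.
Context {R : realType}.
Variables (alpha beta hl A0 omega q : R).

(* z is the argument alpha beta x / (A0 hl) of the G-functions. *)
Definition cdf_h2_term (c v z : R) (k : nat) : R[i]^o :=
  ('C(2 * k, k)%:R * (v / 2) ^+ (2 * k))%:C *
  meijerG (2 * k + 3) 1 (2 * k + 2) (2 * k + 4)
    (1 :: nseq (2 * k + 1) (c + 1)%:C)
    ([:: alpha%:C; beta%:C] ++ nseq (2 * k + 1) c%:C ++ [:: 0]) z.

(* Partial sums of the series for F_{h2}(x). *)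
Definition cdf_h2_partial_sum (x : R) (n : nat) : R[i]^o :=
  let c := (1 + q ^+ 2) * omega / (2 * q) in
  let v := (1 - q ^+ 2) * omega / (2 * q) in
  (omega / (rGamma alpha * rGamma beta))%:C *
  series (cdf_h2_term c v (alpha * beta * x / (A0 * hl))) n.

End CDF.

Section SINR.
Context {R : realType}.

Definition gamma21 (a1 a2 B2 gbar h : R) : R :=
  a1 * B2 * gbar * h ^+ 2 / (a2 * B2 * gbar * h ^+ 2 + 1).

Definition gamma22 (a2 B2 gbar h : R) : R := a2 * B2 * gbar * h ^+ 2.

End SINR.

(* Main.v *)
Require Import Defs.
From HB Require Import structures.
From mathcomp Require Import all_boot all_order all_algebra.
From mathcomp Require Import all_classical all_reals all_analysis.
From mathcomp Require Import complex.
From mathcomp Require Import measurable_realfun ring lra.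

(** Put s = psi + i t on the separating line.  Since Gamma(1 + z) = z Gamma(z),
    the integrand of the k-th G-function reduces to
    Gamma(alpha - s) Gamma(beta - s) (c - s)^-(2k+1) s^-1 z^s.  Each factor is a
    Mellin transform: Gamma(alpha - s) and Gamma(beta - s) of the densities
    a^(alpha-1) e^-a and b^(beta-1) e^-b, (c - s)^-(2k+1) of
    u^-1 (u/A0)^c (- ln (u/A0))^(2k) / (2k)! on ]0, A0], and 1/s of the indicator
    of z > 1 (Perron's formula, obtained by Abel summation and dominated
    convergence).  So the G-function is the integral of the product of the three
    densities over the region a b u / A0 < z.

    Up to the factor 1 / (Gamma(alpha) Gamma(beta)), the integral over (a, b) is
    the distribution function of the Gamma-Gamma law, because
    2 y^(nu/2) K_nu(2 sqrt y) is the integral over a > 0 of a^(nu-1) e^(-a-y/a).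
    Summing over k turns the density in u into that of the pointing error, as
    C(2k,k) / (2k)! = 1 / (k!)^2 gives back the power series of I_0, and
    the independence of h_s and h_g2 makes the sum the distribution function of
    the product. *)

Import Order.TTheory GRing.Theory Num.Theory.
Import numFieldNormedType.Exports.
Import Normc.

Local Open Scope classical_set_scope.
Local Open Scope complex_scope.
Local Open Scope ring_scope.

Set Implicit Arguments.
Unset Strict Implicit.

(** * Complex-valued integrals *)

(** The factor [1/s] alone is not integrable along the line, and no decay of the Gamma function is
    at hand. Both obstacles are met by the order in which the factors are treated. Perron's formula
    is applied to [s^-1 (c - s)^-(2k+1)], which is O(1/t^2); this yields a pair: an integrable
    kernel in [t] and an inversion formula in [y = ln z]. Multiplication by a Gamma factor preserves
    such a pair by Fubini, since on the line this factor is a Fourier transform of an integrable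
    function and characters have modulus 1. No Stirling estimate enters. In the variable [ln z] the
    multiplicative convolutions become additive.

    Cancelling [Gamma(c - s)] and [Gamma(s)] requires that Gamma has no zero in the right
    half-plane. This is shown from Euler's integral: positivity far to the right, then the
    functional equation.

    The line of integration is picked by choice, so the inversion is proved for every abscissa
    between 0 and the minimum of [alpha], [beta], [c]. Real integrals are [fine] values of extended
    ones, so integrability has to be carried along with the value formulas. *)

Section ComplexMeasurable.
Context {R : realType} {d : measure_display} {T : measurableType d}.
Implicit Types (D : set T) (f g : T -> R[i]).

Definition cmeas D f :=
  measurable_fun D (fun x => complex.Re (f x)) /\
  measurable_fun D (fun x => complex.Im (f x)).

Definition cintble (m : {measure set T -> \bar R}) D f :=
  m.-integrable D (EFin \o (fun x => complex.Re (f x))) /\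
  m.-integrable D (EFin \o (fun x => complex.Im (f x))).

Lemma cReM (z w : R[i]) : complex.Re (z * w) =
  complex.Re z * complex.Re w - complex.Im z * complex.Im w.
Proof. by case: z w => a b []. Qed.

Lemma cImM (z w : R[i]) : complex.Im (z * w) =
  complex.Re z * complex.Im w + complex.Im z * complex.Re w.
Proof. by case: z w => a b []. Qed.

Lemma cReD (z w : R[i]) : complex.Re (z + w) = complex.Re z + complex.Re w.
Proof. by case: z w => a b []. Qed.

Lemma cImD (z w : R[i]) : complex.Im (z + w) = complex.Im z + complex.Im w.
Proof. by case: z w => a b []. Qed.

Lemma cReN (z : R[i]) : complex.Re (- z) = - complex.Re z.
Proof. by case: z. Qed.

Lemma cImN (z : R[i]) : complex.Im (- z) = - complex.Im z.
Proof. by case: z. Qed.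

Lemma complex_eq (z w : R[i]) : complex.Re z = complex.Re w ->
  complex.Im z = complex.Im w -> z = w.
Proof. by case: z w => a b [c e] /= -> ->. Qed.

Lemma ler_Re_normc (z : R[i]) : `|complex.Re z| <= normc z.
Proof.
by case: z => a b /=; rewrite -sqrtr_sqr ler_wsqrtr// lerDl sqr_ge0.
Qed.

Lemma ler_Im_normc (z : R[i]) : `|complex.Im z| <= normc z.
Proof.
by case: z => a b /=; rewrite -sqrtr_sqr ler_wsqrtr// lerDr sqr_ge0.
Qed.

Lemma normc_ge0 (z : R[i]) : 0 <= normc z.
Proof. by case: z => a b; exact: sqrtr_ge0. Qed.

Lemma normcR (x : R) : normc x%:C = `|x|.
Proof. by rewrite /= expr0n /= addr0 sqrtr_sqr. Qed.

Lemma cmeasM D f g : cmeas D f -> cmeas D g -> cmeas D (fun x => f x * g x).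
Proof.
move=> [f1 f2] [g1 g2]; split.
  under eq_fun do rewrite cReM.
  by apply: measurable_funB; apply: measurable_funM.
under eq_fun do rewrite cImM.
by apply: measurable_funD; apply: measurable_funM.
Qed.

Lemma cmeas_real D (h : T -> R) : measurable_fun D h -> cmeas D (fun x => (h x)%:C).
Proof. by move=> mh; split => //=; exact: measurable_cst. Qed.

Lemma cmeas_cst D (z : R[i]) : cmeas D (fun=> z).
Proof. by split; exact: measurable_cst. Qed.

Lemma cmeasX D f n : cmeas D f -> cmeas D (fun x => f x ^+ n).
Proof.
move=> mf; elim: n => [|n ih]; first exact: cmeas_cst.
by under [X in cmeas _ X]eq_fun do rewrite exprS; exact: cmeasM.
Qed.

Lemma measurable_invr (D : set R) : measurable_fun D (@GRing.inv R).
Proof.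
apply: measurable_funTS.
have -> : [set: R] = ~` [set 0] `|` [set 0] by rewrite setUC setUv.
apply/measurable_funU; [exact: measurableC|exact: measurable_set1|split].
  apply: subspace_continuous_measurable_fun; first exact: measurableC.
  apply: continuous_in_subspaceT => x; rewrite inE /= => x0.
  by apply: inv_continuous; apply/eqP.
exact: measurable_fun_set1.
Qed.

Lemma cmeasV D f : cmeas D f -> cmeas D (fun x => (f x)^-1).
Proof.
move=> [f1 f2].
have mV : measurable_fun D
    (fun x => (complex.Re (f x) ^+ 2 + complex.Im (f x) ^+ 2)^-1).
  apply: (measurableT_comp (f := @GRing.inv R)); first exact: measurable_invr.
  by apply: measurable_funD; exact: measurable_funX.
split.
  rewrite (_ : (fun x => _) = (fun x => complex.Re (f x) *
      (complex.Re (f x) ^+ 2 + complex.Im (f x) ^+ 2)^-1)).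
    exact: measurable_funM.
  by apply/funext => x; case: (f x).
rewrite (_ : (fun x => _) = (fun x => - (complex.Im (f x) *
      (complex.Re (f x) ^+ 2 + complex.Im (f x) ^+ 2)^-1))).
  by apply: measurable_funN; exact: measurable_funM.
by apply/funext => x; case: (f x).
Qed.

Lemma cintble_cmeas (m : {measure set T -> \bar R}) D f : cintble m D f -> cmeas D f.
Proof. by move=> [/measurable_int/measurable_EFinP ? /measurable_int/measurable_EFinP]. Qed.

Lemma cintble_le (m : {measure set T -> \bar R}) D f (g : T -> R) : measurable D -> cmeas D f ->
  m.-integrable D (EFin \o g) -> (forall x, D x -> normc (f x) <= g x) ->
  cintble m D f.
Proof.
move=> mD [f1 f2] ig fg; split.
  apply: le_integrable ig => //; first exact/measurable_EFinP.
  move=> x Dx /=; rewrite lee_fin (le_trans (ler_Re_normc _))//.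
  by rewrite (le_trans (fg x Dx))// ler_norm.
apply: le_integrable ig => //; first exact/measurable_EFinP.
move=> x Dx /=; rewrite lee_fin (le_trans (ler_Im_normc _))//.
by rewrite (le_trans (fg x Dx))// ler_norm.
Qed.

Lemma measurable_normc D f : cmeas D f -> measurable_fun D (fun x => normc (f x)).
Proof.
move=> [f1 f2].
rewrite (_ : (fun x => _) = (fun x => (complex.Re (f x) ^+ 2 + complex.Im (f x) ^+ 2) `^ 2^-1)).
  apply: (measurableT_comp (f := fun y : R => y `^ 2^-1)); first exact: measurable_powR.
  by apply: measurable_funD; exact: measurable_funX.
apply/funext => x; rewrite powR12_sqrt; first by case: (f x).
by rewrite addr_ge0// sqr_ge0.
Qed.

Lemma cintble_normc (m : {measure set T -> \bar R}) D f : measurable D -> cintble m D f ->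
  m.-integrable D (EFin \o (fun x => normc (f x))).
Proof.
move=> mD [f1 f2]; have mf : cmeas D f by exact: (@cintble_cmeas m).
apply: le_integrable (integrableD mD (integrable_abse f1) (integrable_abse f2)) => //.
  by apply/measurable_EFinP; exact: measurable_normc.
move=> x Dx /=; rewrite lee_fin ger0_norm ?normc_ge0// ger0_norm; last first.
  by rewrite addr_ge0.
have := le_normcD (complex.Re (f x))%:C ('i%C * (complex.Im (f x))%:C).
rewrite normcM !normcR -complexE => /le_trans; apply.
by rewrite /= expr0n expr1n add0r sqrtr1 mul1r.
Qed.

End ComplexMeasurable.

(** * Linearity and Fubini's theorem for complex-valued integrals *)

Section ComplexIntegral.
Context {R : realType}.
Notation mu := (@lebesgue_measure R).
Implicit Types (D : set (measurableTypeR R)) (f g : R -> R[i]).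

Lemma eq_Cintegral D f g : (forall x, D x -> f x = g x) ->
  Cintegral D f = Cintegral D g.
Proof.
by move=> fg; congr (_ +i* _); apply: eq_Rintegral => x; rewrite inE => /fg ->.
Qed.

Lemma eq_cintble D f g : measurable D -> (forall x, D x -> f x = g x) ->
  cintble mu D f -> cintble mu D g.
Proof.
by move=> mD fg [f1 f2]; split; [apply: eq_integrable f1|apply: eq_integrable f2] => //;
  move=> x; rewrite inE => Dx /=; rewrite fg.
Qed.

Lemma cintbleZl D (c : R[i]) f : measurable D -> cintble mu D f ->
  cintble mu D (fun x => c * f x).
Proof.
move=> mD If; apply: (cintble_le (m := mu) (g := fun x => normc c * normc (f x))) => //.
- by apply: cmeasM; [exact: cmeas_cst|exact: cintble_cmeas If].
- by have /(integrableZl mD (normc c)) := cintble_normc mD If.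
- by move=> x _; rewrite normcM.
Qed.

Lemma CintegralZl D (c : R[i]) f : measurable D -> cintble mu D f ->
  Cintegral D (fun x => c * f x) = c * Cintegral D f.
Proof.
move=> mD [f1 f2]; rewrite /Cintegral.
have i1 r h : mu.-integrable D (EFin \o h) ->
    mu.-integrable D (EFin \o (fun x => r * h x)) by exact: integrableZl.
apply: complex_eq => /=.
  under eq_Rintegral do rewrite cReM.
  by rewrite RintegralB ?i1//= cReM !RintegralZl.
under eq_Rintegral do rewrite cImM.
by rewrite RintegralD ?i1//= cImM !RintegralZl.
Qed.

Lemma CintegralD D f g : measurable D -> cintble mu D f -> cintble mu D g ->
  Cintegral D (fun x => f x + g x) = Cintegral D f + Cintegral D g.
Proof.
move=> mD [f1 f2] [g1 g2]; rewrite /Cintegral; apply: complex_eq => /=.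
  by under eq_Rintegral do rewrite cReD; rewrite RintegralD// cReD.
by under eq_Rintegral do rewrite cImD; rewrite RintegralD// cImD.
Qed.

Lemma Cintegral_real D (h : R -> R) :
  Cintegral D (fun x => (h x)%:C) = (\int[mu]_(x in D) h x)%:C.
Proof. by apply: complex_eq => //=; rewrite /Rintegral integral0_eq. Qed.

Definition cindic D f := fun x => (\1_D x : R)%:C * f x.

Lemma Re_cindic D f x : complex.Re (cindic D f x) =
  ((fun x => complex.Re (f x)) \_ D) x.
Proof.
by rewrite /cindic cReM /= mul0r subr0 patchE indicE; case: ifP; rewrite ?mul1r ?mul0r.
Qed.

Lemma Im_cindic D f x : complex.Im (cindic D f x) =
  ((fun x => complex.Im (f x)) \_ D) x.
Proof.
by rewrite /cindic cImM /= mul0r addr0 patchE indicE; case: ifP; rewrite ?mul1r ?mul0r.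
Qed.

Lemma Cintegral_mkcond D f : Cintegral D f = Cintegral setT (cindic D f).
Proof.
by apply: complex_eq => /=; rewrite Rintegral_mkcond; apply: eq_Rintegral => x _;
  rewrite ?Re_cindic ?Im_cindic.
Qed.

Lemma cintble_mkcond D f : measurable D -> cintble mu D f ->
  cintble mu setT (cindic D f).
Proof.
move=> mD [i1 i2]; have f1 := (integrable_mkcond (mu := mu) _ mD).1 i1.
have f2 := (integrable_mkcond (mu := mu) _ mD).1 i2; split.
  by apply: eq_integrable f1 => // x _ /=; rewrite Re_cindic restrict_EFin.
by apply: eq_integrable f2 => // x _ /=; rewrite Im_cindic restrict_EFin.
Qed.

(** The inner integral is the [fine] of an extended one, which may be infinite on a null set; off
    that set [fine] changes nothing, so the extended Fubini theorem carries over through two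
    almost-everywhere identifications. *)
Lemma RFubini (f : R * R -> R) : (mu \x mu)%E.-integrable setT (EFin \o f) ->
  \int[mu]_x \int[mu]_y f (x, y) = \int[mu]_y \int[mu]_x f (x, y).
Proof.
move=> iF; rewrite /Rintegral; congr fine.
have H1 := ae_integrable1 iF.
have H2 := ae_integrable2 iF.
have I1 := integrable_fubini_F iF.
have I2 : measurable_fun setT (fun y => \int[mu]_x (f (x, y))%:E)%E.
  exact: (measurable_fubini_G iF).
transitivity (\int[mu]_x \int[mu]_y (f (x, y))%:E)%E.
  apply: ae_eq_integral => //.
    - apply/measurable_EFinP/(measurableT_comp (f := @fine R)).
      exact: fine_measurable.
    exact: measurable_int I1.
  - exact: measurable_int I1.
  - by apply: filterS H1 => x H _; rewrite fineK// integrable_fin_num.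
rewrite (Fubini iF).
apply: ae_eq_integral => //.
- apply/measurable_EFinP.
  apply: (measurableT_comp (f := @fine R) (g := fun y => \int[mu]_x (f (x, y))%:E)%E) => //.
- by apply: filterS H2 => x H _; rewrite fineK// integrable_fin_num.
Qed.

Lemma Cintegral_Fubini (f : R * R -> R[i]) : cintble (mu \x mu)%E setT f ->
  Cintegral setT (fun x => Cintegral setT (fun y => f (x, y))) =
  Cintegral setT (fun y => Cintegral setT (fun x => f (x, y))).
Proof.
move=> [f1 f2].
have e1 := RFubini (f := fun p => complex.Re (f p)) f1.
have e2 := RFubini (f := fun p => complex.Im (f p)) f2.
by apply: complex_eq; [exact: e1|exact: e2].
Qed.

Lemma cintble_Cintegral (f : R * R -> R[i]) : cintble (mu \x mu)%E setT f ->
  cintble mu setT (fun x => Cintegral setT (fun y => f (x, y))).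
Proof.
move=> [f1 f2]; split.
  have I1 := integrable_fubini_F f1.
  apply: (le_integrable _ _ _ I1) => //.
    apply/measurable_EFinP/(measurableT_comp (f := @fine R)).
      exact: fine_measurable.
    exact: measurable_int I1.
  (* [fine] sends infinite values to 0, so it never increases the absolute value. *)
  move=> x _; rewrite /fubini_F /= /Rintegral.
  by case: integral => [r||] //=; rewrite ?normr0 ?leey.
have I1 := integrable_fubini_F f2.
apply: (le_integrable _ _ _ I1) => //.
  apply/measurable_EFinP/(measurableT_comp (f := @fine R)).
    exact: fine_measurable.
  exact: measurable_int I1.
move=> x _; rewrite /fubini_F /= /Rintegral.
by case: integral => [r||] //=; rewrite ?normr0 ?leey.
Qed.

Lemma integrable_prod (g h : R -> R) : mu.-integrable setT (EFin \o g) ->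
  mu.-integrable setT (EFin \o h) ->
  (mu \x mu)%E.-integrable setT (EFin \o (fun p => g p.1 * h p.2)).
Proof.
move=> ig ih; apply/integrable12ltyP.
  apply/measurable_EFinP/measurable_funM.
    by apply: measurableT_comp => //; apply/measurable_EFinP; exact: measurable_int ig.
  by apply: measurableT_comp => //; apply/measurable_EFinP; exact: measurable_int ih.
under eq_integral => x _.
  under eq_integral => y _ do rewrite /= normrM EFinM.
  rewrite ge0_integralZl//; last first.
    apply/measurable_EFinP/(measurableT_comp (f := @Num.norm R R)) => //.
  by apply/measurable_EFinP; exact: measurable_int ih.
  over.
rewrite ge0_integralZr//; last 2 first.
- apply/measurable_EFinP/(measurableT_comp (f := @Num.norm R R)) => //.
  by apply/measurable_EFinP; exact: measurable_int ig.
- exact: integral_ge0.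
move/integrableP : ig => [_ ig]; move/integrableP : ih => [_ ih].
by rewrite lte_mul_pinfty// ?integral_ge0// ge0_fin_numE ?integral_ge0.
Qed.

End ComplexIntegral.

(** * Primitives and the complex exponential *)
Section FTC.
Context {R : realType}.
Notation mu := (@lebesgue_measure R).
Implicit Types (D : set (measurableTypeR R)) (A : nat -> set (measurableTypeR R)).

Lemma cvg_Rintegral_nondecreasing D A (f : R -> R) :
  {homo A : n m / (n <= m)%N >-> (n <= m)%O} -> (forall n, measurable (A n)) ->
  \bigcup_n A n = D -> mu.-integrable D (EFin \o f) ->
  (fun n => \int[mu]_(x in A n) f x) @ \oo --> \int[mu]_(x in D) f x.
Proof.
move=> ndA mA AD fi.
have mD : measurable D by rewrite -AD; exact: bigcup_measurable.
have AsD n : A n `<=` D by move=> x Anx; rewrite -AD; exists n.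
have fiA n : mu.-integrable (A n) (EFin \o f) by exact: integrableS fi.
have mf : measurable_fun D (EFin \o f) := measurable_int _ fi.
have : (fun n => \int[mu]_(x in A n) (f x)%:E)%E @ \oo --> (\int[mu]_(x in D) (f x)%:E)%E.
  rewrite integral_mkcond; under eq_fun do rewrite integral_mkcond.
  have := @dominated_convergence _ _ _ mu setT measurableT
    (fun n => (EFin \o f) \_ (A n)) ((EFin \o f) \_ D) (abse \o ((EFin \o f) \_ D)).
  case => //.
  - move=> n; apply/(measurable_restrictT _ (mA n)).
    exact: measurable_int (fiA n).
  - exact/(measurable_restrictT _ mD).
  - apply: aeW => x _.
    have [Dx|Dx] := pselect (D x); last first.
      rewrite patchE memNset//; under eq_fun => n.
        rewrite patchE memNset; last by move=> /AsD.
        over.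
      exact: cvg_cst.
    rewrite [X in _ --> X]patchE mem_set//.
    have [n _ Anx] : (\bigcup_n A n) x by rewrite AD.
    apply: cvg_near_cst; exists n => // m /= nm.
    by rewrite patchE mem_set//; have /subsetPset := ndA _ _ nm; exact.
  - by apply: integrable_abse; exact: (integrable_mkcond (mu := mu) _ mD).1.
  - apply: aeW => x n _ /=; rewrite !patchE; case: ifPn => xA.
      by rewrite mem_set//; apply: (AsD n); rewrite inE in xA.
    by rewrite (_ : point = 0%E)// abse0 abse_ge0.
move=> H; apply: (@fine_cvg _ _ _ _ (fun n => \int[mu]_(x in A n) (f x)%:E)%E).
rewrite /Rintegral fineK//; exact: integrable_fin_num.
Qed.

Lemma FTC2_segment (F f : R -> R) (a b : R) : a < b ->
  (forall x, a <= x <= b -> is_derive x 1 F (f x)) ->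
  (forall x, a <= x <= b -> {for x, continuous f}) ->
  (\int[mu]_(x in `[a, b]) (f x)%:E = (F b - F a)%:E)%E.
Proof.
move=> ab dF cf.
have cF x : a <= x <= b -> {for x, continuous F}.
  move=> /dF dFx; apply/differentiable_continuous/derivable1_diffP.
  exact: ex_derive.
rewrite (continuous_FTC2 (F := F))//.
- apply: continuous_in_subspaceT => x; rewrite inE /= in_itv /= => /cf.
  exact.
- split.
  + by move=> x; rewrite in_itv /= => /andP[/ltW ax /ltW xb]; apply: ex_derive; apply: dF; rewrite ax xb.
  + by apply: cvg_at_right_filter; apply: cF; rewrite lexx ltW.
  + by apply: cvg_at_left_filter; apply: cF; rewrite lexx ltW.
- move=> x; rewrite in_itv /= => /andP[/ltW ax /ltW xb].
  have dFx : is_derive x 1 F (f x) by apply: dF; rewrite ax xb.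
  by rewrite derive1E; exact: derive_val.
Qed.

Section exhaustion.
Variables (D : set (measurableTypeR R)) (F f : R -> R) (a b : nat -> R) (l : R).
Hypothesis ab : forall n, a n < b n.
Hypothesis nda : {homo a : n m / (n <= m)%N >-> m <= n}.
Hypothesis ndb : {homo b : n m / (n <= m)%N >-> n <= m}.
Hypothesis DE : \bigcup_n `[a n, b n]%classic = D.
Hypothesis dF : forall x, D x -> is_derive x 1 F (f x).
Hypothesis cf : forall x, D x -> {for x, continuous f}.
Hypothesis Fl : (fun n => F (b n) - F (a n)) @ \oo --> l.

Let A n : set (measurableTypeR R) := `[a n, b n]%classic.

Let mA n : measurable (A n). Proof. exact: measurable_itv. Qed.

Let ndA : {homo A : n m / (n <= m)%N >-> (n <= m)%O}.
Proof.
move=> n m nm; apply/subsetPset => x; rewrite /A /= !in_itv /= => /andP[ax xb].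
by rewrite (le_trans (nda nm) ax) (le_trans xb (ndb nm)).
Qed.

Let AE n : (\int[mu]_(x in A n) (f x)%:E = (F (b n) - F (a n))%:E)%E.
Proof.
by apply: FTC2_segment => // x xab; [apply: dF|apply: cf]; rewrite -DE; exists n => //=;
  rewrite in_itv.
Qed.

(** Compact intervals exhaust [D], so half-lines and intervals open at 0 are treated alike, and the
    boundary values of the primitive enter only through the limit [l]. *)
Lemma FTC2_exhaustion : mu.-integrable D (EFin \o f) -> \int[mu]_(x in D) f x = l.
Proof.
move=> fi; have := cvg_Rintegral_nondecreasing ndA mA DE fi.
rewrite (_ : (fun n => _) = (fun n => F (b n) - F (a n))); last first.
  by apply/funext => n; rewrite /Rintegral AE.
by move=> H; apply: cvg_unique H _.
Qed.

(** For a nonnegative [f] the integrals over the compact intervals increase to the integral over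
    [D]; their limit [l] is finite, which is the integrability that [FTC2_exhaustion] asks for. *)
Lemma ge0_FTC2_exhaustion : (forall x, D x -> 0 <= f x) ->
  mu.-integrable D (EFin \o f).
Proof.
move=> f0.
have mD : measurable D by rewrite -DE; exact: bigcup_measurable.
have AsD n : A n `<=` D by move=> x Anx; rewrite -DE; exists n.
have mfA n : measurable_fun (A n) (EFin \o f).
  apply/measurable_EFinP; apply: subspace_continuous_measurable_fun; first exact: mA.
  by apply: continuous_in_subspaceT => x; rewrite inE => /AsD /cf; exact.
have mf : measurable_fun D (EFin \o f).
  by rewrite -DE; apply/measurable_fun_bigcup.
apply/integrableP; split => //.
have := @ge0_nondecreasing_set_cvg_integral _ _ _ A (EFin \o f) mu ndA mA mfA.
rewrite DE => H.
have {}H := H (fun n x (Anx : A n x) => f0 x (AsD n x Anx)).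
have : (fun n => (F (b n) - F (a n))%:E) @ \oo --> l%:E.
  by apply: cvg_EFin => //; exact: nearW.
rewrite (_ : (fun n => _) = (fun n => \int[mu]_(x in A n) (f x)%:E)%E); last first.
  by apply/funext => n; rewrite AE.
move=> /cvg_lim Hl; move: H => /cvg_lim; rewrite Hl//= => Hl'.
under eq_integral => x /set_mem Dx do rewrite /= ger0_norm ?f0//.
by rewrite -Hl'// ltry.
Qed.

End exhaustion.
End FTC.

(** * Complex functions of a real variable *)

Section ComplexDerivative.
Context {R : realType}.
Implicit Types (f g : R -> R[i]) (z w : R[i]).

(** The variable is real, so real calculus on the two components is enough. *)
Definition is_cderive (x : R) f z :=
  is_derive x 1 (fun x => complex.Re (f x)) (complex.Re z) /\
  is_derive x 1 (fun x => complex.Im (f x)) (complex.Im z).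

Definition ccont (x : R) f :=
  (complex.Re (f y) @[y --> x] --> complex.Re (f x)) /\
  (complex.Im (f y) @[y --> x] --> complex.Im (f x)).

Lemma is_cderive_ccont x f z : is_cderive x f z -> ccont x f.
Proof.
by move=> [d1 d2]; split; apply/differentiable_continuous/derivable1_diffP;
  exact: ex_derive.
Qed.

Lemma is_cderive_real (x : R) (h : R -> R) (r : R) : is_derive x 1 h r ->
  is_cderive x (fun x => (h x)%:C) r%:C.
Proof. by move=> dh; split => //=; exact: is_derive_cst. Qed.

Lemma is_cderive_eq x f z w : is_cderive x f z -> z = w -> is_cderive x f w.
Proof. by move=> ? <-. Qed.

Lemma is_cderiveM x f g z w : is_cderive x f z -> is_cderive x g w ->
  is_cderive x (fun x => f x * g x) (z * g x + f x * w).
Proof.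
move=> [f1 f2] [g1 g2]; split.
  under eq_fun do rewrite cReM.
  apply: is_derive_eq; rewrite cReD !cReM.
  by rewrite /GRing.scale /=; ring.
under eq_fun do rewrite cImM.
apply: is_derive_eq; rewrite cImD !cImM.
by rewrite /GRing.scale /=; ring.
Qed.

Lemma is_cderive_cst x z : is_cderive x (fun=> z) 0.
Proof. by split; exact: is_derive_cst. Qed.

Lemma Re_expC z : complex.Re (expC z) = expR (complex.Re z) * cos (complex.Im z).
Proof. by rewrite /expC cReM /= mul0r subr0. Qed.

Lemma Im_expC z : complex.Im (expC z) = expR (complex.Re z) * sin (complex.Im z).
Proof. by rewrite /expC cImM /= mul0r addr0. Qed.

Lemma normc_expC z : normc (expC z) = expR (complex.Re z).
Proof.
rewrite /expC normcM normcR ger0_norm ?expR_ge0//=.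
by rewrite cos2Dsin2 sqrtr1 mulr1.
Qed.

Lemma expCD z w : expC (z + w) = expC z * expC w.
Proof.
apply: complex_eq.
  by rewrite [RHS]cReM !Re_expC !Im_expC !(cReD, cImD) expRD cosD; ring.
by rewrite [RHS]cImM !Re_expC !Im_expC !(cReD, cImD) expRD sinD; ring.
Qed.

Lemma expC_real (x : R) : expC x%:C = (expR x)%:C.
Proof. by apply: complex_eq; rewrite ?Re_expC ?Im_expC /= ?cos0 ?sin0 ?mulr1 ?mulr0. Qed.

Lemma is_cderive_expC (x : R) z (h : R -> R) (r : R) : is_derive x 1 h r ->
  is_cderive x (fun x => expC (z * (h x)%:C)) (z * r%:C * expC (z * (h x)%:C)).
Proof.
move=> dh; split.
  under eq_fun do rewrite Re_expC cReM cImM /= !mulr0 subr0 add0r.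
  apply: is_derive_eq.
  rewrite [RHS]cReM Re_expC Im_expC !cReM !cImM /= /GRing.scale /= !mulr0 !subr0 !add0r.
  ring.
under eq_fun do rewrite Im_expC cReM cImM /= !mulr0 subr0 add0r.
apply: is_derive_eq.
rewrite [RHS]cImM Re_expC Im_expC !cReM !cImM /= /GRing.scale /= !mulr0 !subr0 !add0r.
ring.
Qed.

Lemma ccontM x f g : ccont x f -> ccont x g -> ccont x (fun x => f x * g x).
Proof.
move=> [f1 f2] [g1 g2]; split.
  under eq_fun do rewrite cReM.
  by rewrite cReM; apply: cvgB; apply: cvgM.
under eq_fun do rewrite cImM.
by rewrite cImM; apply: cvgD; apply: cvgM.
Qed.

Lemma ccontD x f g : ccont x f -> ccont x g -> ccont x (fun x => f x + g x).
Proof.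
move=> [f1 f2] [g1 g2]; split.
  by under eq_fun do rewrite cReD; rewrite cReD; exact: cvgD.
by under eq_fun do rewrite cImD; rewrite cImD; exact: cvgD.
Qed.

Lemma cmeas_expC {d} {T : measurableType d} (D : set T) (f : T -> R[i]) :
  cmeas D f -> cmeas D (fun x => expC (f x)).
Proof.
move=> [f1 f2]; split.
  under eq_fun do rewrite Re_expC.
  apply: measurable_funM; first exact: (measurableT_comp (f := expR)).
  apply: (measurableT_comp (f := cos)) => //.
  by apply: continuous_measurable_fun; exact: continuous_cos.
under eq_fun do rewrite Im_expC.
apply: measurable_funM; first exact: (measurableT_comp (f := expR)).
apply: (measurableT_comp (f := sin)) => //.
by apply: continuous_measurable_fun; exact: continuous_sin.
Qed.

Notation mu := (@lebesgue_measure R).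

(** The limit is stated through [normc], so that one estimate of the boundary terms serves both
    components. *)
Lemma Cintegral_FTC2 (D : set (measurableTypeR R)) f F (a b : nat -> R) (l : R[i]) :
  (forall n, a n < b n) ->
  {homo a : n m / (n <= m)%N >-> m <= n} ->
  {homo b : n m / (n <= m)%N >-> n <= m} ->
  \bigcup_n `[a n, b n]%classic = D ->
  (forall x, D x -> is_cderive x F (f x)) ->
  (forall x, D x -> ccont x f) ->
  cintble mu D f ->
  (fun n => normc (F (b n) - F (a n) - l)) @ \oo --> 0 ->
  Cintegral D f = l.
Proof.
move=> ab nda ndb DE dF cf [f1 f2] Fl.
have cvg0 (h : R[i] -> R) : (forall z, `|h z| <= normc z) ->
   (fun n => h (F (b n) - F (a n) - l)) @ \oo --> 0.
  move=> hz; apply/cvgr0Pnorm_lt => e e0.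
  move/cvgr0Pnorm_lt : Fl => /(_ _ e0); apply: filterS => n.
  by apply: le_lt_trans; rewrite (le_trans (hz _))// ler_norm.
apply: complex_eq => /=.
  apply: (FTC2_exhaustion ab nda ndb DE (fun x Dx => (dF x Dx).1) (fun x Dx => (cf x Dx).1)) => //.
  apply/subr_cvg0; have := cvg0 (@complex.Re R) (@ler_Re_normc R).
  by under eq_fun do rewrite !cReD !cReN.
apply: (FTC2_exhaustion ab nda ndb DE (fun x Dx => (dF x Dx).2) (fun x Dx => (cf x Dx).2)) => //.
apply/subr_cvg0; have := cvg0 (@complex.Im R) (@ler_Im_normc R).
by under eq_fun do rewrite !cImD !cImN.
Qed.

End ComplexDerivative.

(** * Convolutions with characters *)

Section ComplexIntegralComplements.
Context {R : realType}.
Notation mu := (@lebesgue_measure R).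
Implicit Types (D : set (measurableTypeR R)) (f g : R -> R[i]).

Lemma cintble_mkcondr D f : measurable D -> cintble mu setT (cindic D f) ->
  cintble mu D f.
Proof.
move=> mD [f1 f2]; split; apply/(integrable_mkcond (mu := mu) _ mD).
  by apply: eq_integrable f1 => // x _ /=; rewrite Re_cindic restrict_EFin.
by apply: eq_integrable f2 => // x _ /=; rewrite Im_cindic restrict_EFin.
Qed.

Lemma cintbleD D f g : measurable D -> cintble mu D f -> cintble mu D g ->
  cintble mu D (fun x => f x + g x).
Proof.
move=> mD [f1 f2] [g1 g2]; split.
  by apply: eq_integrable (integrableD mD f1 g1) => // x _ /=; rewrite cReD.
by apply: eq_integrable (integrableD mD f2 g2) => // x _ /=; rewrite cImD.
Qed.

Let subset_oy_cy : (`]0, +oo[%classic : set R) `<=` `[0, +oo[%classic.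
Proof. by move=> x /=; rewrite !in_itv /= !andbT; exact: ltW. Qed.

Lemma Cintegral_itv_obnd_cbnd f : cintble mu `[0, +oo[ f ->
  Cintegral `]0, +oo[ f = Cintegral `[0, +oo[ f.
Proof.
move=> [f1 f2].
by apply: complex_eq; apply: Rintegral_itv_obnd_cbnd;
  [apply: integrableS f1|apply: integrableS f2] => //; exact: subset_oy_cy.
Qed.

(** Both half-lines contain 0 because the exponential integrals are computed on closed half-lines;
    their common point is a null set. *)
Lemma Cintegral_split f : cintble mu `]-oo, 0] f -> cintble mu `[0, +oo[ f ->
  cintble mu setT f /\
  Cintegral setT f = Cintegral `]-oo, 0] f + Cintegral `[0, +oo[ f.
Proof.
move=> f1 f2.
have f3 : cintble mu `]0, +oo[ f.
  by case: f2 => a b; split; [apply: integrableS a|apply: integrableS b] => //;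
    exact: subset_oy_cy.
have fE x : f x = cindic `]-oo, 0] f x + cindic `]0, +oo[ f x.
  rewrite /cindic !indicE.
  have [x0|x0] := leP x 0.
    rewrite mem_set /= ?in_itv//= memNset /= ?in_itv/=; last by rewrite andbT ltNge x0.
    by rewrite mul1r mul0r addr0.
  rewrite memNset /= ?in_itv/=; last by rewrite leNgt x0.
  by rewrite mem_set /= ?in_itv /= ?x0// mul1r mul0r add0r.
have i1 := cintble_mkcond (measurable_itv _) f1.
have i3 := cintble_mkcond (measurable_itv _) f3.
split.
  by apply: eq_cintble (cintbleD measurableT i1 i3) => // x _; rewrite -fE.
rewrite -Cintegral_itv_obnd_cbnd// [in RHS]Cintegral_mkcond [X in _ + X]Cintegral_mkcond.
by rewrite -CintegralD//; apply: eq_Cintegral => x _; rewrite -fE.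
Qed.

Lemma cvg_Rintegral_dominated D (f_ : nat -> R -> R) (f G : R -> R) : measurable D ->
  (forall n, measurable_fun D (f_ n)) -> measurable_fun D f ->
  {ae mu, forall x, D x -> f_ ^~ x @ \oo --> f x} ->
  mu.-integrable D (EFin \o G) ->
  (forall n x, D x -> `|f_ n x| <= G x) ->
  (fun n => \int[mu]_(x in D) f_ n x) @ \oo --> \int[mu]_(x in D) f x.
Proof.
move=> mD mf_ mf cf iG fG.
have [|||||fi _ H] := @dominated_convergence _ _ _ mu D mD (fun n => EFin \o f_ n)
    (EFin \o f) (EFin \o G) => //.
- by move=> n; exact/measurable_EFinP.
- exact/measurable_EFinP.
- by apply: filterS cf => x h /h ?; apply: cvg_EFin => //; exact: nearW.
- by apply: aeW => x n Dx /=; rewrite lee_fin fG.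
apply: (@fine_cvg _ _ _ _ (fun n => \int[mu]_(x in D) (f_ n x)%:E)%E).
by rewrite /Rintegral fineK//; exact: integrable_fin_num.
Qed.

End ComplexIntegralComplements.

Section Convolution.
Context {R : realType}.
Notation mu := (@lebesgue_measure R).
Implicit Types (D : set (measurableTypeR R)).

Definition expi (x : R) : R[i] := expC (0 +i* x).

Lemma normc_expi x : normc (expi x) = 1.
Proof. by rewrite normc_expC expR0. Qed.

Lemma expiD x y : expi (x + y) = expi x * expi y.
Proof. by rewrite -expCD; congr expC; apply: complex_eq; rewrite /= ?addr0. Qed.

Lemma expi0 : expi 0 = 1.
Proof. by rewrite /expi expC_real expR0. Qed.

Lemma expC_expi (z : R[i]) : expC z = (expR (complex.Re z))%:C * expi (complex.Im z).
Proof.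
rewrite -expC_real -expCD; congr expC.
by case: z => a b; apply: complex_eq; rewrite /= ?addr0 ?add0r.
Qed.

Lemma cmeas_expi {d} {T : measurableType d} (D : set T) (f : T -> R) :
  measurable_fun D f -> cmeas D (fun x => expi (f x)).
Proof.
by move=> mf; apply: cmeas_expC; split => //=; exact: measurable_cst.
Qed.

Lemma cintble_expi D (f : R -> R[i]) (h : R -> R) : measurable D ->
  cintble mu D f -> measurable_fun D h -> cintble mu D (fun x => f x * expi (h x)).
Proof.
move=> mD fi mh; apply: (cintble_le (m := mu) (g := fun x => normc (f x))) => //.
- by apply: cmeasM; [exact: cintble_cmeas fi|exact: cmeas_expi].
- exact: cintble_normc.
- by move=> x _; rewrite normcM normc_expi mulr1.
Qed.

Section step.
Variables (k : R -> R[i]) (g X : R -> R).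
Hypothesis ki : cintble mu setT k.
Hypothesis gi : mu.-integrable setT (EFin \o g).
Hypothesis mX : measurable_fun setT X.

Let mg : measurable_fun setT g.
Proof. by apply/measurable_EFinP; exact: measurable_int gi. Qed.

Let cintble_prod (h : measurableTypeR R * measurableTypeR R -> R) :
  measurable_fun setT h ->
  cintble (mu \x mu)%E setT
    (fun p : measurableTypeR R * measurableTypeR R => k p.1 * (g p.2)%:C * expi (h p)).
Proof.
move=> mh.
apply: (cintble_le (m := (mu \x mu)%E)
  (g := fun p : measurableTypeR R * measurableTypeR R => normc (k p.1) * `|g p.2|)) => //.
- apply: cmeasM; last exact: cmeas_expi.
  apply: cmeasM; last by apply: cmeas_real; exact: measurableT_comp.
  have [k1 k2] := cintble_cmeas ki.
  by split; [exact: (measurableT_comp k1)|exact: (measurableT_comp k2)].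
- apply: (integrable_prod (g := fun t => normc (k t)) (h := fun z => `|g z|)).
    exact: cintble_normc.
  by have /integrable_norm := gi.
- by move=> p _; rewrite normcM normc_expi mulr1 normcM normcR.
Qed.

Let cintble_prod2 (h : measurableTypeR R * measurableTypeR R -> R) :
  measurable_fun setT h ->
  cintble (mu \x mu)%E setT
    (fun p : measurableTypeR R * measurableTypeR R => (g p.1)%:C * k p.2 * expi (h p)).
Proof.
move=> mh.
apply: (cintble_le (m := (mu \x mu)%E)
  (g := fun p : measurableTypeR R * measurableTypeR R => `|g p.1| * normc (k p.2))) => //.
- apply: cmeasM; last exact: cmeas_expi.
  apply: cmeasM; first by apply: cmeas_real; exact: measurableT_comp.
  have [k1 k2] := cintble_cmeas ki.
  by split; [exact: (measurableT_comp k1)|exact: (measurableT_comp k2)].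
- apply: (integrable_prod (g := fun z => `|g z|) (h := fun t => normc (k t))).
    by have /integrable_norm := gi.
  exact: cintble_normc.
- by move=> p _; rewrite normcM normc_expi mulr1 normcM normcR.
Qed.

Let gc : cintble mu setT (fun z => (g z)%:C).
Proof. by split => //=; exact: integrable0. Qed.

Let gh t := Cintegral setT (fun z => (g z)%:C * expi (- (t * X z))).
Let K w := Cintegral setT (fun t => k t * expi (t * w)).

(** The function is a partial integral of [k t * g z * expi (- (t * X z))], which [|k t| |g z|]
    dominates on the plane; [gh] is never estimated on its own. *)
Lemma cintble_convolution : cintble mu setT (fun t => k t * gh t).
Proof.
apply: (@eq_cintble R setT (fun t => Cintegral setT (fun z =>
    k t * (g z)%:C * expi (- (t * X z))))) => //.
  move=> t _; rewrite -CintegralZl//.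
    by apply: eq_Cintegral => z _; rewrite mulrA.
  by apply: cintble_expi => //; apply/measurable_funN/measurable_funM.
apply: (@cintble_Cintegral R (fun p => k p.1 * (g p.2)%:C * expi (- (p.1 * X p.2)))).
apply/cintble_prod/measurable_funN/measurable_funM => //.
exact: measurableT_comp.
Qed.

Lemma cintble_convolved y : cintble mu setT (fun z => (g z)%:C * K (y - X z)).
Proof.
apply: (@eq_cintble R setT (fun z => Cintegral setT (fun t =>
    (g z)%:C * k t * expi (t * (y - X z))))) => //.
  move=> z _; rewrite -CintegralZl//.
    by apply: eq_Cintegral => t _; rewrite mulrA.
  by apply: cintble_expi => //; exact: measurable_funM.
apply: (@cintble_Cintegral R (fun p => (g p.1)%:C * k p.2 * expi (p.2 * (y - X p.1)))).
apply/cintble_prod2/measurable_funM => //.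
by apply: measurable_funB => //; exact: measurableT_comp.
Qed.

(** Fubini, with the same dominating product. [K] and [gh] are the Fourier transforms of [k] and of
    the image of [g] under [X]; keeping [X] in the phase avoids a change of variables. *)
Lemma Cintegral_convolution y :
  Cintegral setT (fun z => (g z)%:C * K (y - X z)) =
  Cintegral setT (fun t => k t * gh t * expi (t * y)).
Proof.
transitivity (Cintegral setT (fun z => Cintegral setT (fun t =>
    k t * (g z)%:C * expi (t * (y - X z))))).
  apply: eq_Cintegral => z _; rewrite -CintegralZl//.
    by apply: eq_Cintegral => t _; rewrite mulrA [_%:C * _]mulrC.
  by apply: cintble_expi => //; exact: measurable_funM.
rewrite -(Cintegral_Fubini (f := fun p => k p.1 * (g p.2)%:C * expi (p.1 * (y - X p.2)))); last first.
  apply: cintble_prod; apply: measurable_funM => //.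
  by apply: measurable_funB => //; exact: measurableT_comp.
apply: eq_Cintegral => t _ /=.
rewrite mulrAC -CintegralZl//.
  by apply: eq_Cintegral => z _; rewrite mulrBr expiD; ring.
by apply: cintble_expi => //; apply/measurable_funN/measurable_funM.
Qed.

End step.

Section step_in.
Variables (D : set (measurableTypeR R)) (k : R -> R[i]) (g X : R -> R).
Hypothesis mD : measurable D.
Hypothesis ki : cintble mu setT k.
Hypothesis gi : mu.-integrable D (EFin \o g).
Hypothesis mX : measurable_fun D X.

Let giD : mu.-integrable setT (EFin \o (g \_ D)).
Proof. by rewrite -restrict_EFin; exact: (integrable_mkcond (mu := mu) _ mD).1. Qed.

Let mXD : measurable_fun setT (X \_ D).
Proof. exact: (measurable_restrictT X mD).1. Qed.

(** Off [D] the factor [g \_ D] is 0, so both sides vanish whatever value [X \_ D] takes there. *)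
Let cindicE (f : R -> R[i]) z :
  cindic D (fun z => (g z)%:C * f (X z)) z = ((g \_ D) z)%:C * f ((X \_ D) z).
Proof.
rewrite /cindic indicE !patchE; case: ifPn => zD; first by rewrite mul1r.
by rewrite !mul0r.
Qed.

Let gh t := Cintegral D (fun z => (g z)%:C * expi (- (t * X z))).

Let ghE t : gh t = Cintegral setT (fun z => ((g \_ D) z)%:C * expi (- (t * (X \_ D) z))).
Proof.
rewrite /gh Cintegral_mkcond; apply: eq_Cintegral => z _.
exact: (cindicE (fun x => expi (- (t * x)))).
Qed.

Lemma cintble_convolution_in : cintble mu setT (fun t => k t * gh t).
Proof. by under eq_fun do rewrite ghE; exact: cintble_convolution. Qed.

Lemma Cintegral_convolution_in y :
  Cintegral D (fun z => (g z)%:C * Cintegral setT (fun t => k t * expi (t * (y - X z)))) =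
  Cintegral setT (fun t => k t * gh t * expi (t * y)).
Proof.
rewrite [RHS](_ : _ = Cintegral setT (fun t => k t * Cintegral setT (fun z =>
    ((g \_ D) z)%:C * expi (- (t * (X \_ D) z))) * expi (t * y))); last first.
  by apply: eq_Cintegral => t _; rewrite ghE.
rewrite -(Cintegral_convolution ki giD mXD) Cintegral_mkcond.
apply: eq_Cintegral => z _.
exact: (cindicE (fun x => Cintegral setT (fun t => k t * expi (t * (y - x))))).
Qed.

Lemma cintble_convolved_in y : cintble mu D
  (fun z => (g z)%:C * Cintegral setT (fun t => k t * expi (t * (y - X z)))).
Proof.
apply: cintble_mkcondr => //; have := cintble_convolved ki giD mXD y.
apply: eq_cintble => // z _; apply/esym.
exact: (cindicE (fun x => Cintegral setT (fun t => k t * expi (t * (y - x))))).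
Qed.

End step_in.

End Convolution.

(** * Exponential integrals on half-lines *)

Section Exponentials.
Context {R : realType}.
Notation mu := (@lebesgue_measure R).

(** By [1 + u <= e^u] the terms are at most [1 / (p (n + 1))]. *)
Lemma cvg_expRN_n (p : R) : 0 < p -> (fun n => expR (- (p * n.+1%:R))) @ \oo --> 0.
Proof.
move=> p0; apply: (@squeeze_cvgr _ _ _ _ (cst 0) (fun n => p^-1 * n.+1%:R^-1)).
- apply: nearW => n; rewrite /= expR_ge0 /= expRN -invfM lef_pV2 ?posrE ?expR_gt0 ?mulr_gt0//.
  by rewrite (le_trans _ (expR_ge1Dx _))// lerDr.
- exact: cvg_cst.
- rewrite -[X in _ --> X](mulr0 p^-1); apply: cvgM; first exact: cvg_cst.
  exact: cvg_harmonic.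
Qed.

Lemma exhaust_cy : \bigcup_n `[(0:R), n.+1%:R]%classic = `[(0:R), +oo[%classic.
Proof. by rewrite itv0y_bigcup0S. Qed.

Lemma exhaust_Nyc : \bigcup_n `[- n.+1%:R, (0:R)]%classic = `]-oo, (0:R)]%classic.
Proof.
apply/seteqP; split => x /=.
  by move=> [n _ /=]; rewrite !in_itv /= => /andP[].
rewrite in_itv /= => x0.
have : `[0, +oo[%classic (- x) by rewrite /= in_itv /= andbT oppr_ge0.
rewrite -exhaust_cy => -[n _ /=].
rewrite in_itv /= => /andP[_ xn]; exists n => //=.
by rewrite in_itv /= x0 andbT lerNl.
Qed.

Lemma integrable_expRN (p : R) : 0 < p ->
  mu.-integrable `[0, +oo[ (EFin \o (fun x => expR (- (p * x)))).
Proof.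
move=> p0.
apply: (@ge0_FTC2_exhaustion R _ (fun x => - (p^-1 * expR (- (p * x)))) _
  (fun=> 0) (fun n => n.+1%:R) p^-1) => //.
- by move=> n m nm; rewrite ler_nat.
- exact: exhaust_cy.
- move=> x _; apply: is_derive_eq; rewrite /GRing.scale /=; field; exact: lt0r_neq0.
- move=> x _; apply/differentiable_continuous/derivable1_diffP.
  exact: ex_derive.
- rewrite mulr0 oppr0 expR0 mulr1 opprK -[X in _ --> X]add0r.
  apply: cvgD; last exact: cvg_cst.
  rewrite -oppr0; apply: cvgN; rewrite -(mulr0 p^-1).
  by apply: cvgM; [exact: cvg_cst|exact: cvg_expRN_n].
Qed.

Lemma integrable_expR_Ny (p : R) : 0 < p ->
  mu.-integrable `]-oo, 0] (EFin \o (fun x => expR (p * x))).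
Proof.
move=> p0.
apply: (@ge0_FTC2_exhaustion R _ (fun x => p^-1 * expR (p * x)) _
  (fun n => - n.+1%:R) (fun=> 0) p^-1) => //.
- by move=> n m nm; rewrite lerN2 ler_nat.
- exact: exhaust_Nyc.
- move=> x _; apply: is_derive_eq; rewrite /GRing.scale /=; field; exact: lt0r_neq0.
- move=> x _; apply/differentiable_continuous/derivable1_diffP.
  exact: ex_derive.
- rewrite mulr0 expR0 mulr1 -[X in _ --> X]subr0.
  apply: cvgB; first exact: cvg_cst.
  rewrite -(mulr0 p^-1); apply: cvgM; first exact: cvg_cst.
  by under eq_fun do rewrite mulrN; exact: cvg_expRN_n.
Qed.

Lemma expC_cstr (p t x : R) : (expR (p * x))%:C * expi (t * x) = expC ((p +i* t) * x%:C).
Proof.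
by rewrite expC_expi cReM cImM /=; congr ((expR _)%:C * expi _); ring.
Qed.

Lemma cintble_exp (D : set (measurableTypeR R)) (p t : R) : measurable D ->
  mu.-integrable D (EFin \o (fun x => expR (p * x))) ->
  cintble mu D (fun x => expC ((p +i* t) * x%:C)).
Proof.
move=> mD fi; apply: (@eq_cintble R D (fun x => (expR (p * x))%:C * expi (t * x))) => //.
  by move=> x _; exact: expC_cstr.
apply: cintble_expi => //.
by split => //=; exact: integrable0.
Qed.

Let is_cderive_exp (z : R[i]) (x : R) : z != 0 ->
  is_cderive x (fun x => z^-1 * expC (z * x%:C)) (expC (z * x%:C)).
Proof.
move=> z0; apply: is_cderive_eq.
  apply: is_cderiveM; first exact: is_cderive_cst.
  apply: (is_cderive_expC z (h := fun x => x)).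
by rewrite mul0r add0r mulr1 mulKf.
Qed.

Let normc_exp_tail (z w : R[i]) (x : R) : complex.Re w = - x ->
  normc (z^-1 * expC w) = (normc z)^-1 * expR (- x).
Proof. by move=> wx; rewrite normcM normcV normc_expC wx. Qed.

Lemma Cintegral_exp_cy (p t : R) : 0 < p ->
  Cintegral `[0, +oo[ (fun x => expC (- (p +i* t) * x%:C)) = (p +i* t)^-1.
Proof.
move=> p0; have z0 : - (p +i* t) != 0.
  by rewrite oppr_eq0 eq_complex /= negb_and (gt_eqF p0).
apply: (@Cintegral_FTC2 R _ _ _ (fun=> 0) (fun n => n.+1%:R)) => //.
- by move=> n m nm; rewrite ler_nat.
- exact: exhaust_cy.
- by move=> x _; exact: is_cderive_exp.
- move=> x _; apply: is_cderive_ccont.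
  exact: (is_cderive_expC _ (h := fun x => x)).
- apply: (@cintble_exp _ (- p) (- t)) => //.
  by under [X in _ \o X]eq_fun do rewrite mulNr; exact: integrable_expRN.
- rewrite [X in X @ _ --> _](_ : _ = (fun n => (normc (- (p +i* t)))^-1 * expR (- (p * n.+1%:R)))).
    rewrite -(mulr0 (normc (- (p +i* t)))^-1).
    by apply: cvgM; [exact: cvg_cst|exact: cvg_expRN_n].
  apply/funext => n; rewrite [_ * 0%:C]mulr0 expC_real expR0 mulr1 !invrN opprK addrK -invrN.
  by apply: normc_exp_tail; rewrite cReM /=; ring.
Qed.

Lemma Cintegral_exp_Nyc (p t : R) : 0 < p ->
  Cintegral `]-oo, 0] (fun x => expC ((p +i* t) * x%:C)) = (p +i* t)^-1.
Proof.
move=> p0; have z0 : p +i* t != 0.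
  by rewrite eq_complex /= negb_and (gt_eqF p0).
apply: (@Cintegral_FTC2 R _ _ _ (fun n => - n.+1%:R) (fun=> 0)) => //.
- by move=> n m nm; rewrite lerN2 ler_nat.
- exact: exhaust_Nyc.
- by move=> x _; exact: is_cderive_exp.
- move=> x _; apply: is_cderive_ccont.
  exact: (is_cderive_expC _ (h := fun x => x)).
- by apply: cintble_exp => //; exact: integrable_expR_Ny.
- rewrite [X in X @ _ --> _](_ : _ = (fun n => (normc (p +i* t))^-1 * expR (- (p * n.+1%:R)))).
    rewrite -(mulr0 (normc (p +i* t))^-1).
    by apply: cvgM; [exact: cvg_cst|exact: cvg_expRN_n].
  apply/funext => n; rewrite mulr0 expC_real expR0 mulr1 addrC addKr normcN.
  by apply: normc_exp_tail; rewrite cReM /=; ring.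
Qed.

End Exponentials.

(** * Perron's formula *)

Section AbelKernel.
Context {R : realType}.
Notation mu := (@lebesgue_measure R).

(** The Fourier transform of the two-sided exponential is the Poisson kernel: the half-lines
    contribute [1 / (e + i w)] and [1 / (e - i w)]. *)
Lemma cintble_abel (e : R) : 0 < e ->
  cintble mu setT (fun t => (expR (- (e * `|t|)))%:C) /\
  forall w, Cintegral setT (fun t => (expR (- (e * `|t|)))%:C * expi (t * w)) =
    (2 * e / (e ^+ 2 + w ^+ 2))%:C.
Proof.
move=> e0.
have H (w : R) : let f t := (expR (- (e * `|t|)))%:C * expi (t * w) in
    cintble mu setT f /\ Cintegral setT f = (2 * e / (e ^+ 2 + w ^+ 2))%:C.
  move=> f.
  have fN t : `]-oo, 0]%classic t -> expC ((e +i* w) * t%:C) = f t.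
    rewrite /= in_itv /= => t0; rewrite -expC_cstr /f ler0_norm// mulrN opprK.
    by rewrite [w * t]mulrC.
  have fP t : `[0, +oo[%classic t -> expC (- (e +i* (- w)) * t%:C) = f t.
    rewrite /= in_itv /= andbT => t0; rewrite /f ger0_norm// -mulNr.
    by rewrite [t * w]mulrC expC_cstr; congr expC; apply: complex_eq; rewrite /= ?opprK.
  have iN : cintble mu `]-oo, 0] f.
    apply: eq_cintble fN _ => //.
    by apply: cintble_exp => //; exact: integrable_expR_Ny.
  have iP : cintble mu `[0, +oo[ f.
    apply: eq_cintble fP _ => //.
    have := @cintble_exp R `[0, +oo[ (- e) w (measurable_itv _).
    rewrite (_ : (- e +i* w) = - (e +i* (- w))); last first.
      by apply: complex_eq; rewrite /= ?opprK.
    apply; under [X in _ \o X]eq_fun do rewrite mulNr.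
    exact: integrable_expRN.
  have [i ->] := Cintegral_split iN iP; split => //.
  rewrite -(eq_Cintegral fN) -(eq_Cintegral fP) Cintegral_exp_Nyc// Cintegral_exp_cy//.
  by apply: complex_eq; rewrite /= sqrrN; ring.
split; last by move=> w; exact: (H w).2.
have [i _] := H 0; apply: eq_cintble i => // x _ /=.
by rewrite mulr0 expi0 mulr1.
Qed.

(** The Poisson integral of [e^(-p r)] on [r >= 0], which is the inversion integral of
    [1 / (p + i t)] damped by [e^(-e |t|)]. As [e] tends to 0 it approaches [2 pi e^(-p w)] for
    [w > 0] and 0 for [w < 0]. *)
Definition abel_kernel (e p w : R) : R :=
  \int[mu]_(r in `[0, +oo[) (expR (- (p * r)) * (2 * e / (e ^+ 2 + (w - r) ^+ 2))).

Section Perron.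
Variables (e p : R).
Hypotheses (e0 : 0 < e) (p0 : 0 < p).

Let expRN_expi (t : R) : Cintegral `[0, +oo[
  (fun z => (expR (- (p * z)))%:C * expi (- (t * z))) = (p +i* t)^-1.
Proof.
rewrite -Cintegral_exp_cy//; apply: eq_Cintegral => x _.
rewrite -!mulNr expC_cstr; congr expC; apply: complex_eq => //.
Qed.

Lemma cintble_abel_Perron :
  cintble mu setT (fun t => (expR (- (e * `|t|)))%:C * (p +i* t)^-1).
Proof.
under eq_fun do rewrite -expRN_expi.
apply: (cintble_convolution_in (X := id)) => //.
- by have [] := cintble_abel e0.
- exact: integrable_expRN.
Qed.

Lemma abel_kernelE w : (abel_kernel e p w)%:C =
  Cintegral setT (fun t => (expR (- (e * `|t|)))%:C * (p +i* t)^-1 * expi (t * w)).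
Proof.
have [i iE] := cintble_abel e0.
rewrite [RHS](_ : _ = Cintegral setT (fun t => (expR (- (e * `|t|)))%:C *
  Cintegral `[0, +oo[ (fun z => (expR (- (p * z)))%:C * expi (- (t * z))) * expi (t * w))).
  rewrite -(Cintegral_convolution_in (X := id))//; last exact: integrable_expRN.
  rewrite /abel_kernel -Cintegral_real; apply: eq_Cintegral => r _.
  by rewrite iE rmorphM.
by apply: eq_Cintegral => t _; rewrite expRN_expi.
Qed.

End Perron.

Lemma integral_oneDsqrT : mu.-integrable setT (EFin \o (fun u => 2 / (1 + u ^+ 2))) /\
  \int[mu]_u (2 / (1 + u ^+ 2)) = 2 * pi.
Proof.
have H : (\int[mu]_u (2 / (1 + u ^+ 2))%:E = (2 * pi)%:E)%E.
  rewrite (ge0_symfun_integralT (f := fun u => 2 / (1 + u ^+ 2))).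
  - rewrite -set_itvcy.
    have -> : (\int[mu]_(x in `[0%R, +oo[) (2 / (1 + x ^+ 2))%:E =
        2%:E * \int[mu]_(x in `[0%R, +oo[) ((oneDsqr x)^-1)%:E)%E.
      rewrite -ge0_integralZl_EFin//.
      - have m1 : measurable_fun (`[0%R, +oo[%classic : set (measurableTypeR R))
            (fun x : R => (oneDsqr x)^-1).
          apply: measurable_funTS; apply: continuous_measurable_fun.
          exact: continuous_oneDsqrV.
        exact/measurable_EFinP.
    by rewrite integral0y_oneDsqr -!EFinM; congr EFin; field.
  - by move=> x; rewrite divr_ge0// addr_ge0// sqr_ge0.
  - by move=> x; apply: cvgM; [exact: cvg_cst|exact: continuous_oneDsqrV].
  - by move=> x /=; rewrite sqrrN.
split; last by rewrite /Rintegral H.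
apply/integrableP; split.
  have m2 : measurable_fun setT (fun u : R => 2 / (1 + u ^+ 2)).
    apply: continuous_measurable_fun => x.
    by apply: cvgM; [exact: cvg_cst|exact: continuous_oneDsqrV].
  exact/measurable_EFinP.
under eq_integral => x _ do rewrite /= ger0_norm ?divr_ge0 ?addr_ge0 ?sqr_ge0//.
by rewrite H ltry.
Qed.

(** The integrand after [r = w + e u]: the Poisson kernel has become the fixed weight
    [2 / (1 + u^2)], and for [p > 0] the remaining factor lies between 0 and 1. One bound thus
    serves for all [e]. *)
Let H (p w e u : R) : R :=
  if 0 <= w + e * u then expR (- (p * (w + e * u))) * (2 / (1 + u ^+ 2)) else 0.

Lemma abel_kernel_subst (e p w : R) : 0 < e -> 0 < p ->
  abel_kernel e p w = \int[mu]_u H p w e u.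
Proof.
move=> e0 p0; rewrite /abel_kernel /Rintegral; congr fine.
pose F u := w + e * u; pose a := - (w / e).
have Fa : F a = 0 by rewrite /F /a mulrN mulrCA mulfV ?gt_eqF// mulr1 subrr.
have dF (u : R) : is_derive u 1 F e.
  by rewrite /F; apply: is_derive_eq; rewrite /GRing.scale /=; ring.
have F'E : F^`()%classic = cst e.
  by apply/funext => u; rewrite derive1E; exact: derive_val.
have c1 : continuous (fun r : R => expR (- (p * r))).
  by move=> x; apply/differentiable_continuous/derivable1_diffP; exact: ex_derive.
have c2 : continuous (fun r : R => e ^+ 2 + (w - r) ^+ 2).
  by move=> x; apply/differentiable_continuous/derivable1_diffP; exact: ex_derive.
rewrite -Fa (increasing_ge0_integration_by_substitutiony (F := F)).
- rewrite [LHS]integral_mkcond; apply: eq_integral => u _.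
  rewrite patchE /H F'E.
  have -> : (u \in `[a, +oo[%classic) = (0 <= w + e * u).
    rewrite mem_setE in_itv /= andbT -Fa /F lerD2l ler_pM2l//.
  case: ifPn => // _; congr EFin; rewrite !fctE /F.
  have -> : w - (w + e * u) = - (e * u) by ring.
  rewrite sqrrN exprMn; field.
  by apply/andP; split; rewrite gt_eqF// ltr_pwDl ?exprn_gt0 ?sqr_ge0.
- by move=> x y _ _ xy; rewrite /F ltrD2l ltr_pM2l.
- by rewrite F'E => x _; exact: cvg_cst.
- by rewrite F'E; exact: is_cvg_cst.
- by rewrite F'E; exact: is_cvg_cst.
- split; first by move=> u _; exact: ex_derive.
  by apply: cvg_at_right_filter; apply/differentiable_continuous/derivable1_diffP; exact: ex_derive.
- apply/cvgryPge => A; near=> x.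
  have Ax : (A - w) / e <= x by near: x; exact: nbhs_pinfty_ge (num_real _).
  by rewrite /F -lerBlDl mulrC -ler_pdivrMr.
- apply: continuous_in_subspaceT => x _.
  apply: cvgM; first exact: c1.
  apply: cvgM; first exact: cvg_cst.
  apply: cvgV; last exact: c2.
  by rewrite gt_eqF// ltr_pwDl ?exprn_gt0// sqr_ge0.
- move=> x _; rewrite mulr_ge0 ?expR_ge0// divr_ge0 ?mulr_ge0 ?ltW//.
  by rewrite ltr_pwDl ?exprn_gt0// sqr_ge0.
Unshelve. all: by end_near. Qed.

Lemma abel_kernel_ge0 (e p w : R) : 0 < e -> 0 <= abel_kernel e p w.
Proof.
move=> e0; apply: Rintegral_ge0 => r _; rewrite mulr_ge0 ?expR_ge0// divr_ge0 ?mulr_ge0 ?ltW//.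
by rewrite ltr_pwDl ?exprn_gt0// sqr_ge0.
Qed.

Let H_bound (p w e u : R) : 0 < p -> `|H p w e u| <= 2 / (1 + u ^+ 2).
Proof.
move=> p0; rewrite /H; case: ifPn => [h|_]; last first.
  by rewrite normr0 divr_ge0// addr_ge0// sqr_ge0.
have u0 : 0 <= 2 / (1 + u ^+ 2) by rewrite divr_ge0// addr_ge0// sqr_ge0.
rewrite (ger0_norm (mulr_ge0 (expR_ge0 _) u0)) ler_piMl//.
by rewrite expR_le1 oppr_le0 mulr_ge0// ltW.
Qed.

Let mH (p w e : R) : measurable_fun setT (H p w e).
Proof.
apply: measurable_fun_ifT => //.
- by apply: measurable_fun_ler => //; apply: measurable_funD => //; exact: measurable_funM.
- apply: measurable_funM; last first.
    apply: continuous_measurable_fun => x.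
    by apply: cvgM; [exact: cvg_cst|exact: continuous_oneDsqrV].
  apply: (measurableT_comp (f := expR)) => //; apply: measurable_funN.
  apply: measurable_funM => //; apply: measurable_funD => //; exact: measurable_funM.
Qed.

Lemma abel_kernel_le (e p w : R) : 0 < e -> 0 < p -> abel_kernel e p w <= 2 * pi.
Proof.
move=> e0 p0; rewrite abel_kernel_subst//.
have [i <-] := integral_oneDsqrT.
apply: le_Rintegral => //.
  apply: le_integrable i => //; first by apply/measurable_EFinP; exact: mH.
  by move=> u _ /=; rewrite lee_fin (le_trans (H_bound _ _ _ p0))// ler_norm.
by move=> u _; rewrite (le_trans (ler_norm _))// H_bound.
Qed.

(** For each [u] the sign of [w + e u] is eventually that of [w]. At [w = 0] half of the mass would
    remain and the limit would be [pi], hence the exclusion of this point. *)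
Lemma cvg_abel_kernel (p w : R) : 0 < p -> w != 0 ->
  (fun n => abel_kernel n.+1%:R^-1 p w) @ \oo -->
  (if 0 < w then 2 * pi * expR (- (p * w)) else 0).
Proof.
move=> p0 w0.
under eq_fun do rewrite abel_kernel_subst ?invr_gt0//.
have [i iE] := integral_oneDsqrT.
have cv u : (fun n => w + n.+1%:R^-1 * u) @ \oo --> w.
  rewrite -[X in _ --> X]addr0; apply: cvgD; first exact: cvg_cst.
  rewrite -(mul0r u); apply: cvgM; last exact: cvg_cst.
  exact: cvg_harmonic.
pose L u := if 0 < w then expR (- (p * w)) * (2 / (1 + u ^+ 2)) else 0 : R.
have -> : (if 0 < w then 2 * pi * expR (- (p * w)) else 0) = \int[mu]_u L u.
  rewrite /L; case: ifP => _; first by rewrite RintegralZl// iE mulrC.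
  by rewrite /Rintegral integral0_eq.
apply: (cvg_Rintegral_dominated (G := fun u => 2 / (1 + u ^+ 2))) => //.
- by move=> n; exact: mH.
- rewrite /L; case: (0 < w) => //; apply: measurable_funM => //.
  by apply/measurable_EFinP; exact: measurable_int i.
- apply: aeW => u _; rewrite /H /L.
  have [wp|wn] := ltP 0 w.
    have : (fun n => expR (- (p * (w + n.+1%:R^-1 * u))) * (2 / (1 + u ^+ 2))) @ \oo -->
        expR (- (p * w)) * (2 / (1 + u ^+ 2)).
      apply: cvgM; last exact: cvg_cst.
      apply: (cvg_comp _ expR); last exact: continuous_expR.
      by apply: cvgN; apply: cvgM; [exact: cvg_cst|exact: cv].
    apply: cvg_trans; apply: near_eq_cvg.
    near=> n; rewrite ifT//; apply: ltW; near: n.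
    exact: (cvgr_gt w (cv u)).
  have {}wn : w < 0 by rewrite lt_neqAle w0.
  apply: cvg_near_cst.
  near=> n; rewrite ifF//; apply/negbTE; rewrite -ltNge; near: n.
  exact: (cvgr_lt w (cv u)).
- by move=> n u _; exact: H_bound.
Unshelve. all: by end_near. Qed.

End AbelKernel.

Lemma cRe_realM {R : realType} (r : R) (z : R[i]) : complex.Re (r%:C * z) = r * complex.Re z.
Proof. by rewrite cReM /= mul0r subr0. Qed.

Lemma cIm_realM {R : realType} (r : R) (z : R[i]) : complex.Im (r%:C * z) = r * complex.Im z.
Proof. by rewrite cImM /= mul0r addr0. Qed.

Section PerronFormula.
Context {R : realType}.
Notation mu := (@lebesgue_measure R).
Variables (D : set (measurableTypeR R)) (g X : R -> R) (p y : R).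
Hypothesis mD : measurable D.
Hypothesis gi : mu.-integrable D (EFin \o g).
Hypothesis mX : measurable_fun D X.
Hypothesis p0 : 0 < p.
Hypothesis Xy : {ae mu, forall z, D z -> X z != y}.

Let gh t := Cintegral D (fun z => (g z)%:C * expi (- (t * X z))).

Hypothesis ghi : cintble mu setT (fun t => (p +i* t)^-1 * gh t).

Let ep (n : nat) : R := n.+1%:R^-1.

Let ep0 n : 0 < ep n. Proof. by rewrite /ep invr_gt0. Qed.

Let abelE n : (\int[mu]_(z in D) (g z * abel_kernel (ep n) p (y - X z)))%:C =
  Cintegral setT (fun t => (expR (- (ep n * `|t|)))%:C * ((p +i* t)^-1 * gh t * expi (t * y))).
Proof.
have := Cintegral_convolution_in mD (cintble_abel_Perron (ep0 n) p0) gi mX y.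
rewrite -Cintegral_real => H; rewrite [LHS](_ : _ = Cintegral D (fun z => (g z)%:C * Cintegral setT (fun t =>
   (expR (- (ep n * `|t|)))%:C * (p +i* t)^-1 * expi (t * (y - X z))))).
  by rewrite H; apply: eq_Cintegral => t _; rewrite !mulrA.
by apply: eq_Cintegral => z _; rewrite -abel_kernelE// rmorphM.
Qed.

Let fi : cintble mu setT (fun t => (p +i* t)^-1 * gh t * expi (t * y)).
Proof. by apply: cintble_expi => //; exact: measurable_funM. Qed.

Let mabel n : measurable_fun D (fun z => g z * abel_kernel (ep n) p (y - X z)).
Proof.
have [/measurable_int/measurable_EFinP + _] :=
  cintble_convolved_in mD (cintble_abel_Perron (ep0 n) p0) gi mX y.
apply: eq_measurable_fun => z _.
by rewrite -abel_kernelE// cReM /= mulr0 subr0.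
Qed.

Let cvg_damped (h : R -> R) : mu.-integrable setT (EFin \o h) ->
  (fun n => \int[mu]_t (expR (- (ep n * `|t|)) * h t)) @ \oo --> \int[mu]_t h t.
Proof.
move=> hi.
have mh : measurable_fun setT h by apply/measurable_EFinP; exact: measurable_int hi.
apply: (cvg_Rintegral_dominated (G := fun t => `|h t|)) => //.
- move=> n; apply: measurable_funM => //; apply: (measurableT_comp (f := expR)) => //.
  by apply/measurable_funN/measurable_funM => //; exact: (measurableT_comp (f := @Num.norm R R)).
- apply: aeW => t _; rewrite -[X in _ --> X](mul1r (h t)).
  apply: cvgM; last exact: cvg_cst.
  rewrite -expR0; apply: (cvg_comp _ expR); last exact: continuous_expR.
  rewrite -oppr0 -(mul0r `|t|); apply: cvgN; apply: cvgM; last exact: cvg_cst.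
  exact: cvg_harmonic.
- by have /integrable_norm := hi.
- move=> n t _; rewrite normrM ger0_norm ?expR_ge0// ler_piMl//.
  by rewrite expR_le1 oppr_le0 mulr_ge0// ltW.
Qed.

(** Both sides are limits in the damped identity [abelE]. On the left the kernels are bounded by
    [2 pi] and converge off the null set [X z = y]; on the right [ghi] gives absolute integrability,
    so the damping can be removed. *)
Lemma Perron_formula :
  (2 * pi * \int[mu]_(z in D) (if X z < y then g z * expR (- (p * (y - X z))) else 0))%:C =
  Cintegral setT (fun t => (p +i* t)^-1 * gh t * expi (t * y)).
Proof.
have mg : measurable_fun D g by apply/measurable_EFinP; exact: measurable_int gi.
pose L z := if X z < y then 2 * pi * (g z * expR (- (p * (y - X z)))) else 0.
have mL : measurable_fun D L.
  apply: measurable_fun_if => //.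
  - exact: measurable_fun_ltr.
  - apply: measurable_funS (@subIsetl _ _ _) _ => //.
    apply: measurable_funM => //; apply: measurable_funM => //.
    apply: (measurableT_comp (f := expR)) => //.
    by apply/measurable_funN/measurable_funM => //; exact: measurable_funB.
have Hl : (fun n => \int[mu]_(z in D) (g z * abel_kernel (ep n) p (y - X z))) @ \oo -->
    \int[mu]_(z in D) L z.
  apply: (cvg_Rintegral_dominated (G := fun z => 2 * pi * `|g z|)) => //.
  - apply: filterS Xy => z zy Dz; rewrite /L.
    have yX : y - X z != 0 by rewrite subr_eq0 eq_sym zy.
    have := cvg_abel_kernel p0 yX; rewrite subr_gt0 => H.
    have -> : (if X z < y then 2 * pi * (g z * expR (- (p * (y - X z)))) else 0) =
       g z * (if X z < y then 2 * pi * expR (- (p * (y - X z))) else 0).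
      by case: ifP => _; rewrite ?mulr0//; ring.
    by apply: cvgM; [exact: cvg_cst|exact: H].
  - have gn : mu.-integrable D (EFin \o (fun z => `|g z|)) by have /integrable_norm := gi.
    by have /(_ (2 * pi)) := integrableZl (mu := mu) mD _ gn.
  - move=> n z Dz; rewrite normrM mulrC ler_wpM2r//.
    by rewrite ger0_norm ?abel_kernel_ge0// abel_kernel_le.
have -> : 2 * pi * \int[mu]_(z in D) (if X z < y then g z * expR (- (p * (y - X z))) else 0)
    = \int[mu]_(z in D) L z.
  rewrite -RintegralZl//; first by apply: eq_Rintegral => z _; rewrite /L; case: ifP; rewrite ?mulr0.
  apply: le_integrable gi => //.
    apply/measurable_EFinP; apply: measurable_fun_if => //.
    - exact: measurable_fun_ltr.
    - apply: measurable_funS (@subIsetl _ _ _) _ => //.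
      apply: measurable_funM => //.
      apply: (measurableT_comp (f := expR)) => //.
      by apply/measurable_funN/measurable_funM => //; exact: measurable_funB.
  move=> z Dz /=; rewrite lee_fin; case: ifP => zy; last by rewrite normr0.
  rewrite normrM ler_piMr// ger0_norm ?expR_ge0//.
  by rewrite expR_le1 oppr_le0 mulr_ge0 ?ltW// subr_gt0.
have [f1 f2] := fi.
have Re_n n : \int[mu]_(z in D) (g z * abel_kernel (ep n) p (y - X z)) =
    \int[mu]_t (expR (- (ep n * `|t|)) * complex.Re ((p +i* t)^-1 * gh t * expi (t * y))).
  rewrite -[LHS]/(complex.Re (_%:C)) abelE.
  by apply: eq_Rintegral => t _; exact: cRe_realM.
(* The left side of [abelE] is real, so the damped imaginary parts vanish for every [n], and so does
   their limit. *)
have Im_n n : 0 =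
    \int[mu]_t (expR (- (ep n * `|t|)) * complex.Im ((p +i* t)^-1 * gh t * expi (t * y))).
  rewrite -[LHS]/(complex.Im (\int[mu]_(z in D) (g z * abel_kernel (ep n) p (y - X z)))%:C).
  rewrite abelE.
  by apply: eq_Rintegral => t _; exact: cIm_realM.
apply: complex_eq.
  have E : (fun n => \int[mu]_(z in D) (g z * abel_kernel (ep n) p (y - X z))) =
    (fun n => \int[mu]_t (expR (- (ep n * `|t|)) *
                complex.Re ((p +i* t)^-1 * gh t * expi (t * y)))).
    by apply/funext => n; exact: Re_n.
  rewrite E in Hl; rewrite [LHS]/=.
  exact: (cvg_unique _ Hl (cvg_damped f1)).
have E : (fun=> 0) = (fun n => \int[mu]_t (expR (- (ep n * `|t|)) *
                complex.Im ((p +i* t)^-1 * gh t * expi (t * y)))).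
  by apply/funext => n; exact: Im_n.
have H0 : ((fun=> 0) : nat -> R) @ \oo --> (0 : R) by exact: cvg_cst.
rewrite E in H0; rewrite [LHS]/=.
exact: (cvg_unique _ H0 (cvg_damped f2)).
Qed.

End PerronFormula.

(** * Gamma functions and powers of the logarithm *)

Section Exhaustion.
Context {R : realType}.
Notation mu := (@lebesgue_measure R).

Lemma expR_ge_term (x : R) n : 0 <= x -> x ^+ n / n`!%:R <= expR x.
Proof.
move=> x0; case: n => [|n].
  by rewrite expr0 fact0 divr1 -expR0 ler_expR.
by rewrite (le_trans _ (expR_ge1Dxn n x0))// lerDr.
Qed.

Lemma ge1_expR_natS (x : R) : exists n : nat, x <= n.+1%:R.
Proof.
exists (Num.truncn `|x|); rewrite (le_trans (ler_norm x))//.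
by have /andP[_ /ltW] := truncn_itv (normr_ge0 x).
Qed.

(** Geometric endpoints make [ln (u / A)] equal to [-(n + 1)], so that boundary terms become
    exponentials in [n]. *)
Lemma exhaust_oc (A : R) : 0 < A ->
  \bigcup_n `[A * expR (- n.+1%:R), A]%classic = `]0, A]%classic.
Proof.
move=> A0; apply/seteqP; split => x /=.
  move=> [n _ /=]; rewrite !in_itv /= => /andP[+ ->]; rewrite andbT.
  by apply: lt_le_trans; rewrite mulr_gt0// expR_gt0.
rewrite in_itv /= => /andP[x0 xA].
have [n nx] := ge1_expR_natS (- ln (x / A)); exists n => //=; rewrite in_itv /= xA andbT.
rewrite -ler_pdivlMl// -[leRHS]lnK ?posrE ?mulr_gt0 ?invr_gt0//.
by rewrite ler_expR lerNl mulrC.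
Qed.

Lemma exhaust_oy :
  \bigcup_n `[expR (- n.+1%:R) : R, expR n.+1%:R]%classic = `]0, +oo[%classic.
Proof.
apply/seteqP; split => x /=.
  move=> [n _ /=]; rewrite !in_itv /= => /andP[+ _]; rewrite andbT.
  by apply: lt_le_trans; rewrite expR_gt0.
rewrite in_itv /= andbT => x0.
have [n nx] := ge1_expR_natS `|ln x|; exists n => //=; rewrite in_itv /=.
rewrite -[x]lnK ?posrE// !ler_expR.
by move: nx; rewrite ler_norml.
Qed.

Lemma cvg_const_expRN (K p : R) : 0 < p ->
  (fun n => K * expR (- (p * n.+1%:R))) @ \oo --> 0.
Proof.
move=> p0; rewrite -(mulr0 K); apply: cvgM; first exact: cvg_cst.
exact: cvg_expRN_n.
Qed.

End Exhaustion.

(** * Powers of the logarithm and their Mellin transforms *)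

Section LogPower.
Context {R : realType}.
Notation mu := (@lebesgue_measure R).
Variable A : R.
Hypothesis A0 : 0 < A.
Implicit Types (p t u : R) (n : nat).

(** In the variable [w = - ln (u / A)], with [du / u = - dw], this is [w^n e^(-p w) / n!] on the
    half-line, whose integral is [p^-(n+1)]. *)
Definition log_power n p u : R :=
  (- ln (u / A)) ^+ n / n`!%:R / u * expR (p * ln (u / A)).

Let D : set (measurableTypeR R) := `]0, A]%classic.

Let ln_le0 u : D u -> ln (u / A) <= 0.
Proof.
by rewrite /D /= in_itv /= => /andP[u0 uA]; rewrite ln_le0// ler_pdivrMr// mul1r.
Qed.

Lemma log_power_ge0 n p u : D u -> 0 <= log_power n p u.
Proof.
move=> Du; have := ln_le0 Du; move: Du; rewrite /D /= in_itv /= => /andP[u0 uA] lu.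
by rewrite mulr_ge0 ?expR_ge0// divr_ge0 ?(ltW u0)// divr_ge0// exprn_ge0// oppr_ge0.
Qed.

Let is_derive_lnA u : 0 < u -> is_derive u 1 (fun u => ln (u / A)) u^-1.
Proof.
move=> u0; have uA : 0 < u / A by rewrite divr_gt0.
have d1 := is_derive1_ln uA.
have := @is_derive1_comp _ (@ln R) (fun u => u / A) u _ (A^-1) d1.
rewrite (_ : (u / A)^-1 * A^-1 = u^-1); last by field; rewrite !gt_eqF.
apply; apply: is_derive_eq; rewrite /GRing.scale /=; ring.
Qed.

Let lnAE m : ln (A * expR (- m) / A) = - m.
Proof. by rewrite mulrAC mulfV ?gt_eqF// mul1r expRK. Qed.

Let lnAA : ln (A / A) = 0. Proof. by rewrite mulfV ?gt_eqF// ln1. Qed.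

Let Am_lt n : A * expR (- n.+1%:R) < A.
Proof. by rewrite -[ltRHS]mulr1 ltr_pM2l// expR_lt1 oppr_lt0. Qed.

Let ndAm : {homo (fun n => A * expR (- n.+1%:R)) : n m / (n <= m)%N >-> m <= n}.
Proof. by move=> n m nm; rewrite ler_pM2l// ler_expR lerN2 ler_nat. Qed.

Let D_gt0 u : D u -> 0 < u.
Proof. by rewrite /D /= in_itv /= => /andP[]. Qed.

Let continuous_lnA u : 0 < u -> {for u, continuous (fun u => ln (u / A))}.
Proof.
move=> u0; have dl := is_derive_lnA u0.
by apply/differentiable_continuous/derivable1_diffP; exact: ex_derive.
Qed.

Let continuous_coef n u : 0 < u ->
  {for u, continuous (fun u => (- ln (u / A)) ^+ n / n`!%:R / u)}.
Proof.
move=> u0; apply: cvgM; last by apply: inv_continuous; exact: lt0r_neq0.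
apply: cvgM; last exact: cvg_cst.
apply: (cvg_comp _ (fun y => y ^+ n)); last exact: exprn_continuous.
by apply: cvgN; exact: continuous_lnA.
Qed.

Lemma continuous_log_power n p u : 0 < u -> {for u, continuous (log_power n p)}.
Proof.
move=> u0; apply: cvgM; first exact: continuous_coef.
apply: (cvg_comp _ expR); last exact: continuous_expR.
by apply: cvgM; [exact: cvg_cst|exact: continuous_lnA].
Qed.

Let integrable_log_power0 p : 0 < p -> mu.-integrable D (EFin \o log_power 0 p).
Proof.
move=> p0.
have E u : D u -> log_power 0 p u = u^-1 * expR (p * ln (u / A)).
  by move=> _; rewrite /log_power expr0 fact0 divr1 mul1r.
apply: (@ge0_FTC2_exhaustion R D (fun u => p^-1 * expR (p * ln (u / A))) (log_power 0 p)
  (fun n => A * expR (- n.+1%:R)) (fun=> A) p^-1 Am_lt ndAm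
  (fun _ _ _ => lexx A) (exhaust_oc A0)).
- move=> u Du; have dl := is_derive_lnA (D_gt0 Du); rewrite E//.
  apply: is_derive_eq; rewrite /GRing.scale /=; field.
  by rewrite !gt_eqF// D_gt0.
- by move=> u /D_gt0; exact: continuous_log_power.
- rewrite lnAA mulr0 expR0 mulr1 -[X in _ --> X]subr0.
  apply: cvgB; first exact: cvg_cst.
  under eq_fun do rewrite lnAE mulrN.
  exact: cvg_const_expRN.
- by move=> u; exact: log_power_ge0.
Qed.

(** Half of the exponent absorbs the power: [(p y / 2)^n / n! <= e^(p y / 2)]. *)
Lemma log_power_tail n p (y : R) : 0 < p -> 0 <= y ->
  y ^+ n / n`!%:R * expR (- (p * y)) <= (2 / p) ^+ n * expR (- (p / 2 * y)).
Proof.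
move=> p0 y0.
have -> : y ^+ n / n`!%:R = (2 / p) ^+ n * ((p / 2 * y) ^+ n / n`!%:R).
  rewrite mulrA -exprMn; congr (_ ^+ _ / _); field; exact: lt0r_neq0.
rewrite -[leLHS]mulrA ler_pM2l ?exprn_gt0 ?divr_gt0//.
have -> : - (p * y) = - (p / 2 * y) - p / 2 * y by field.
rewrite expRD mulrA ler_piMl ?expR_ge0// expRN ler_pdivrMr ?expR_gt0// mul1r.
by apply: expR_ge_term; rewrite mulr_ge0// divr_ge0// ltW.
Qed.

Lemma measurable_log_power n p : measurable_fun D (log_power n p).
Proof.
apply: measurable_funM.
  apply: measurable_funM; last exact: measurable_invr.
  apply: measurable_funM => //; apply: measurable_funX; apply: measurable_funN.
  apply: measurable_funTS; apply: (measurableT_comp (f := @ln R)) => //.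
  exact: measurable_funM.
apply: measurable_funTS; apply: (measurableT_comp (f := expR)) => //.
apply: measurable_funM => //; apply: (measurableT_comp (f := @ln R)) => //.
exact: measurable_funM.
Qed.

Lemma integrable_log_power n p : 0 < p -> mu.-integrable D (EFin \o log_power n p).
Proof.
move=> p0.
have p20 : 0 < p / 2 by rewrite divr_gt0.
have := integrableZl (mu := mu) (measurable_itv _) ((2 / p) ^+ n) (integrable_log_power0 p20).
apply: le_integrable; [exact: measurable_itv| |].
  by apply/measurable_EFinP; exact: measurable_log_power.
move=> u Du /=; rewrite lee_fin !ger0_norm ?log_power_ge0//; last first.
  by rewrite mulr_ge0 ?log_power_ge0// exprn_ge0// divr_ge0// ltW.
have u0 := D_gt0 Du.
rewrite /log_power expr0 fact0 divr1 mul1r mulrAC mulrCA -[leLHS]mulrC ler_pM2l ?invr_gt0//.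
have := @log_power_tail n p (- ln (u / A)) p0.
by rewrite oppr_ge0 ln_le0// !mulrN !opprK => ->.
Qed.

Let fC n (w : R[i]) u : R[i] :=
  ((- ln (u / A)) ^+ n / n`!%:R / u)%:C * expC (w * (ln (u / A))%:C).

Let fCE n p t u : (log_power n p u)%:C * expi (- (t * ln (u / A))) = fC n (p +i* - t) u.
Proof. by rewrite /log_power /fC rmorphM -[LHS]mulrA -mulNr expC_cstr. Qed.

Let cintble_fC n p t : 0 < p -> cintble mu D (fC n (p +i* - t)).
Proof.
move=> p0; apply: (@eq_cintble R D (fun u => (log_power n p u)%:C * expi (- (t * ln (u / A))))) => //.
  exact: measurable_itv.
apply: cintble_expi; first exact: measurable_itv.
  split => /=; [exact: integrable_log_power|exact: integrable0].
apply: measurable_funN; apply: measurable_funTS; apply: measurable_funM => //.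
apply: (measurableT_comp (f := @ln R)) => //; exact: measurable_funM.
Qed.

Let dE (w : R[i]) u : 0 < u ->
  is_cderive u (fun u => expC (w * (ln (u / A))%:C)) (w * (u^-1)%:C * expC (w * (ln (u / A))%:C)).
Proof. by move=> u0; have dl := is_derive_lnA u0; exact: is_cderive_expC. Qed.

Let is_derive_coef n u : 0 < u ->
  is_derive u 1 (fun u => (- ln (u / A)) ^+ n.+1 / (n.+1)`!%:R)
    (- ((- ln (u / A)) ^+ n / n`!%:R / u)).
Proof.
move=> u0; have dl := is_derive_lnA u0.
have dN : is_derive u 1 (fun u => - ln (u / A)) (- u^-1) := is_deriveN dl.
have dX := @is_deriveX _ _ (fun u => - ln (u / A)) n.+1 u 1 _ dN.
have -> : (fun u => (- ln (u / A)) ^+ n.+1 / (n.+1)`!%:R) =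
    (n.+1)`!%:R^-1 *: ((fun u => - ln (u / A)) ^+ n.+1 : R -> R).
  by apply/funext => x; rewrite mulrC /GRing.scale /= exprfctE.
apply: is_derive_eq; rewrite /GRing.scale /= factS natrM; field.
by rewrite gt_eqF// nat1r !pnatr_eq0 -lt0n fact_gt0.
Qed.

Let ccont_fC n w u : 0 < u -> ccont u (fC n w).
Proof.
move=> u0; apply: ccontM; last exact: is_cderive_ccont (dE w u0).
by split; [exact: continuous_coef|exact: cvg_cst].
Qed.

Lemma Cintegral_log_power n p t : 0 < p ->
  Cintegral D (fun u => (log_power n p u)%:C * expi (- (t * ln (u / A)))) =
  ((p +i* - t)^-1) ^+ n.+1.
Proof.
move=> p0; set w := p +i* - t.
have w0 : w != 0 by rewrite eq_complex /= negb_and (gt_eqF p0).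
rewrite (@eq_Cintegral R D _ (fC n w)); last by move=> u _; exact: fCE.
elim: n => [|n ih].
  rewrite expr1.
  apply: (@Cintegral_FTC2 R D _ (fun u => w^-1 * expC (w * (ln (u / A))%:C))
      (fun n => A * expR (- n.+1%:R)) (fun=> A) _ Am_lt ndAm
      (fun _ _ _ => lexx A) (exhaust_oc A0)).
  - move=> u Du; apply: is_cderive_eq.
      by apply: is_cderiveM; [exact: is_cderive_cst|exact: dE (D_gt0 Du)].
    by rewrite mul0r add0r -mulrA mulKf// /fC expr0 fact0 divr1 mul1r.
  - by move=> u /D_gt0; exact: ccont_fC.
  - exact: cintble_fC.
  - rewrite [X in X @ _ --> _](_ : _ = (fun n => (normc w)^-1 * expR (- (p * n.+1%:R)))).
      exact: cvg_const_expRN.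
    apply/funext => m; rewrite lnAA lnAE mulr0 expC_real expR0 mulr1 addrC addKr normcN.
    by rewrite normcM normcV normc_expC cReM /= mulrN mulr0 subr0.
(* The combination is the derivative of [(- ln (u / A))^(n+1) / (n+1)! e^(w ln (u / A))], whose
   boundary values at 0 and [A] vanish; it lowers [n + 1] to [n] at the cost of a factor [1 / w]. *)
have H : Cintegral D (fun u => w * fC n.+1 w u + (-1) * fC n w u) = 0.
  apply: (@Cintegral_FTC2 R D _ (fun u => ((- ln (u / A)) ^+ n.+1 / (n.+1)`!%:R)%:C * expC (w * (ln (u / A))%:C))
      (fun n => A * expR (- n.+1%:R)) (fun=> A) _ Am_lt ndAm
      (fun _ _ _ => lexx A) (exhaust_oc A0)).
  - move=> u Du; have u0 := D_gt0 Du; have dl := is_derive_lnA u0.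
    apply: is_cderive_eq.
      apply: is_cderiveM; last exact: dE.
      exact: is_cderive_real (is_derive_coef n u0).
    rewrite /fC rmorphN [X in w * (X * _)]rmorphM; ring.
  - move=> u /D_gt0 u0; apply: ccontD; apply: ccontM; try exact: ccont_fC.
      exact: is_cderive_ccont (is_cderive_cst _ _).
    exact: is_cderive_ccont (is_cderive_cst _ _).
  - apply: cintbleD; first exact: measurable_itv.
      by apply: cintbleZl; [exact: measurable_itv|exact: cintble_fC].
    by apply: cintbleZl; [exact: measurable_itv|exact: cintble_fC].
  - apply: (@squeeze_cvgr _ _ _ _ (cst 0) (fun m => (2 / p) ^+ n.+1 * expR (- (p / 2 * m.+1%:R)))).
    + apply: nearW => m; apply/andP; split; first exact: normc_ge0.
      have -> : (- ln (A / A)) ^+ n.+1 / (n.+1)`!%:R = 0 by rewrite lnAA oppr0 expr0n mul0r.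
      rewrite [0%:C * _]mul0r sub0r subr0 normcN normcM normcR lnAE opprK.
      rewrite ger0_norm ?divr_ge0 ?exprn_ge0// normc_expC cReM /= mulrN mulr0 subr0.
      exact: log_power_tail.
    + exact: cvg_cst.
    + by apply: cvg_const_expRN; rewrite divr_gt0.
move: H; rewrite CintegralD ?CintegralZl; first last.
  all: try exact: measurable_itv.
  all: try by [exact: cintble_fC|apply: cintbleZl; [exact: measurable_itv|exact: cintble_fC]].
rewrite ih mulN1r => /eqP; rewrite subr_eq0 => /eqP h.
by rewrite exprS -h mulKf.
Qed.

End LogPower.

(** * Euler's integral and its functional equation *)

Section Gamma.
Context {R : realType}.
Notation mu := (@lebesgue_measure R).
Implicit Types (x t y : R) (z : R[i]).

Let D : set (measurableTypeR R) := `]0, +oo[%classic.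

Let D_gt0 t : D t -> 0 < t.
Proof. by rewrite /D /= in_itv /= andbT. Qed.

Definition gamma_density x t : R := t `^ (x - 1) * expR (- t).

Lemma gamma_densityE x t : 0 < t -> gamma_density x t = expR ((x - 1) * ln t - t).
Proof. by move=> t0; rewrite /gamma_density /powR gt_eqF// -expRD. Qed.

Lemma gamma_density_ge0 x t : 0 <= gamma_density x t.
Proof. by rewrite mulr_ge0 ?powR_ge0 ?expR_ge0. Qed.

Lemma measurable_gamma_density x : measurable_fun setT (gamma_density x).
Proof.
apply: measurable_funM; first exact: measurable_powR.
by apply: (measurableT_comp (f := expR)) => //; exact: measurable_funN.
Qed.

(** The maximum of [(1 + t)^(x+1) e^(-t)], attained at [t = x]; the bound comes from [ln r <= r - 1]
    at [r = (1 + t) / (x + 1)]. Replacing [e^(-t)] by [gammaC x / (1 + t)^(x+1)] turns the Gamma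
    density into a beta-prime density, whose primitive [(t / (1 + t))^x / x] is explicit. *)
Let gammaC (x : R) := expR ((x + 1) * ln (x + 1) - x).

Let gamma_bound x t : 0 < x -> 0 < t ->
  (x + 1) * ln (1 + t) - t <= (x + 1) * ln (x + 1) - x.
Proof.
move=> x0 t0; have x1 : 0 < x + 1 by rewrite addr_gt0.
have t1 : 0 < 1 + t by rewrite addr_gt0.
have : ln ((1 + t) / (x + 1)) <= (1 + t) / (x + 1) - 1.
  have := @le_ln1Dx _ ((1 + t) / (x + 1) - 1).
  rewrite addrCA subrr addr0; apply.
  by rewrite ltrBrDl subrr divr_gt0.
rewrite ln_div ?posrE// -(ler_pM2l x1) mulrBr mulrBr [X in _ <= X - _]mulrC divfK ?gt_eqF//.
lra.
Qed.

Let an_lt n : expR (- n.+1%:R) < expR n.+1%:R :> R.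
Proof. by rewrite ltr_expR (lt_trans _ (ltr0Sn _ _))// oppr_lt0. Qed.

Let nda : {homo (fun n => expR (- n.+1%:R) : R) : n m / (n <= m)%N >-> m <= n}.
Proof. by move=> n m nm; rewrite ler_expR lerN2 ler_nat. Qed.

Let ndb : {homo (fun n => expR n.+1%:R : R) : n m / (n <= m)%N >-> n <= m}.
Proof. by move=> n m nm; rewrite ler_expR ler_nat. Qed.

Let is_derive_beta x t : 0 < x -> 0 < t ->
  is_derive t 1 (fun t => x^-1 * expR (x * (ln t - ln (1 + t))))
    (expR ((x - 1) * ln t - (x + 1) * ln (1 + t))).
Proof.
move=> x0 t0; have t1 : 0 < 1 + t by rewrite addr_gt0.
have d1 := is_derive1_ln t0.
have d2 : is_derive t 1 (fun t => ln (1 + t)) (1 + t)^-1.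
  have := @is_derive1_comp _ (@ln R) (fun t => 1 + t) t _ 1 (is_derive1_ln t1).
  rewrite mulr1; apply; apply: is_derive_eq; ring.
have -> : (x - 1) * ln t - (x + 1) * ln (1 + t) =
  x * (ln t - ln (1 + t)) - ln t - ln (1 + t) by ring.
rewrite !expRB !lnK ?posrE//.
apply: is_derive_eq; rewrite /GRing.scale /=; field.
by rewrite !gt_eqF// addrC.
Qed.

Let integrable_beta x : 0 < x ->
  mu.-integrable D (EFin \o (fun t => expR ((x - 1) * ln t - (x + 1) * ln (1 + t)))).
Proof.
move=> x0.
apply: (@ge0_FTC2_exhaustion R D (fun t => x^-1 * expR (x * (ln t - ln (1 + t))))
  (fun t => expR ((x - 1) * ln t - (x + 1) * ln (1 + t)))
  (fun n => expR (- n.+1%:R)) (fun n => expR n.+1%:R) (x^-1 - 0) an_lt nda ndb exhaust_oy).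
- by move=> t /D_gt0 t0; exact: is_derive_beta.
- move=> t /D_gt0 t0; have t1 : 0 < 1 + t by rewrite addr_gt0.
  apply: (cvg_comp _ expR); last exact: continuous_expR.
  apply: cvgB; apply: cvgM; try exact: cvg_cst; first exact: continuous_ln.
  apply: (cvg_comp _ (@ln R)); last exact: continuous_ln.
  by apply: cvgD; [exact: cvg_cst|exact: cvg_id].
- have e0 n : 0 < expR n :> R by exact: expR_gt0.
  apply: cvgB.
    rewrite -[X in _ --> X](mulr1 x^-1); apply: cvgM; first exact: cvg_cst.
    apply: (@squeeze_cvgr _ _ _ _ (fun n => 1 - x * expR (- n.+1%:R)) (cst 1)).
    (* At [t = e^(n+1)] the difference [ln t - ln (1 + t)] is [- ln (1 + e^(-n-1))], which lies
       between [- e^(-n-1)] and 0. *)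
    + apply: nearW => n; rewrite expRK.
      have l1 : ln (1 + expR (- n.+1%:R)) = ln (1 + expR n.+1%:R) - n.+1%:R :> R.
        rewrite -[X in _ - X]expRK -ln_div ?posrE ?addr_gt0//; congr ln.
        by rewrite mulrDl divff ?gt_eqF// mul1r expRN addrC.
      have l2 : ln (1 + expR (- n.+1%:R)) <= expR (- n.+1%:R) :> R.
        by rewrite le_ln1Dx// (lt_trans _ (e0 _))// oppr_lt0.
      have l3 : 0 <= ln (1 + expR (- n.+1%:R)) :> R.
        by rewrite ln_ge0// lerDl ltW.
      apply/andP; split.
        rewrite (le_trans _ (expR_ge1Dx _))// lerD2l -mulrN ler_wpM2l ?(ltW x0)//.
        by move: l1 l2; lra.
      rewrite /= expR_le1 mulr_ge0_le0 ?(ltW x0)//.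
      by move: l1 l3; lra.
    + rewrite -[X in _ --> X]subr0; apply: cvgB; first exact: cvg_cst.
      by have := @cvg_const_expRN R x 1 ltr01; under eq_fun do rewrite mul1r.
    + exact: cvg_cst.
  apply: (@squeeze_cvgr _ _ _ _ (cst 0) (fun n => x^-1 * expR (- (x * n.+1%:R)))).
  + apply: nearW => n; apply/andP; split; first by rewrite mulr_ge0 ?expR_ge0// invr_ge0 ltW.
    rewrite ler_pM2l ?invr_gt0// ler_expR expRK -mulrN ler_pM2l// lerBlDr lerDl.
    by rewrite ln_ge0// lerDl ltW.
  + exact: cvg_cst.
  + exact: cvg_const_expRN.
- by move=> t _; exact: expR_ge0.
Qed.

Lemma integrable_gamma_density x : 0 < x -> mu.-integrable D (EFin \o gamma_density x).
Proof.
move=> x0.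
have := integrableZl (mu := mu) (measurable_itv _) (gammaC x) (integrable_beta x0).
apply: le_integrable; first exact: measurable_itv.
  by apply/measurable_EFinP/measurable_funTS; exact: measurable_gamma_density.
move=> t /D_gt0 t0 /=; rewrite lee_fin !ger0_norm ?gamma_density_ge0 ?mulr_ge0 ?expR_ge0//.
rewrite gamma_densityE// /gammaC -expRD ler_expR.
by have := gamma_bound x0 t0; lra.
Qed.

Definition Gamma_integrand (z : R[i]) t : R[i] := cpow t (z - 1) * (expR (- t))%:C.

Lemma Gamma_integrandE z t : 0 < t -> Gamma_integrand z t =
  (gamma_density (complex.Re z) t)%:C * expi (complex.Im z * ln t).
Proof.
move=> t0; rewrite /Gamma_integrand /cpow gamma_densityE//.
have -> : (z - 1) * (ln t)%:C = ((complex.Re z - 1) * ln t) +i* (complex.Im z * ln t).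
  by apply: complex_eq; rewrite ?cReM ?cImM !cReD !cImD /=; ring.
rewrite expC_expi /= [in RHS]expRD rmorphM; ring.
Qed.

Lemma cintble_Gamma z : 0 < complex.Re z -> cintble mu D (Gamma_integrand z).
Proof.
move=> z0; apply: (@eq_cintble R D (fun t => (gamma_density (complex.Re z) t)%:C *
    expi (complex.Im z * ln t))).
- exact: measurable_itv.
- by move=> t /D_gt0 t0; rewrite Gamma_integrandE.
apply: cintble_expi; first exact: measurable_itv.
  split => /=; [exact: integrable_gamma_density|exact: integrable0].
by apply: measurable_funTS; apply: measurable_funM.
Qed.

(** Integration by parts: the integrand in [H] below is the derivative of [t^z e^(-t)]. *)
Lemma Euler_integralS z : 0 < complex.Re z ->
  Euler_integral (z + 1) = z * Euler_integral z.
Proof.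
move=> z0.
have z10 : 0 < complex.Re (z + 1) by rewrite cReD addr_gt0.
have cG w t : 0 < t -> ccont t (Gamma_integrand w).
  move=> t0; apply: ccontM.
    have dl := is_derive1_ln t0; exact: is_cderive_ccont (is_cderive_expC _ dl).
  split; last exact: cvg_cst.
  apply: (cvg_comp _ expR); last exact: continuous_expR.
  by apply: cvgN; exact: cvg_id.
have H : Cintegral D (fun t => z * Gamma_integrand z t + (-1) * Gamma_integrand (z + 1) t) = 0.
  apply: (@Cintegral_FTC2 R D _ (fun t => expC (z * (ln t)%:C) * (expR (- t))%:C)
    (fun n => expR (- n.+1%:R)) (fun n => expR n.+1%:R) 0 an_lt nda ndb exhaust_oy).
  - move=> t /D_gt0 t0; have dl := is_derive1_ln t0.
    have de : is_derive t 1 (fun t => expR (- t)) (- expR (- t)).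
      by apply: is_derive_eq; rewrite /GRing.scale /=; ring.
    apply: is_cderive_eq.
      by apply: is_cderiveM; [exact: is_cderive_expC|exact: is_cderive_real de].
    rewrite /Gamma_integrand /cpow addrK mulrBl expCD mul1r -rmorphN expC_real.
    by rewrite [expR (- ln t)]expRN lnK ?posrE// rmorphN; ring.
  - move=> t /D_gt0 t0; apply: ccontD; apply: ccontM; try exact: cG.
      exact: is_cderive_ccont (is_cderive_cst _ _).
    exact: is_cderive_ccont (is_cderive_cst _ _).
  - apply: cintbleD; first exact: measurable_itv.
      by apply: cintbleZl; [exact: measurable_itv|exact: cintble_Gamma].
    by apply: cintbleZl; [exact: measurable_itv|exact: cintble_Gamma].
  - set x := complex.Re z.
    apply: (@squeeze_cvgr _ _ _ _ (cst 0) (fun n => gammaC x * expR (- (1 * n.+1%:R)) +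
        1 * expR (- (x * n.+1%:R)))).
    + apply: nearW => n; apply/andP; split; first exact: normc_ge0.
      have ReE r : complex.Re (z * r%:C) = x * r by rewrite cReM /= mulr0 subr0.
      rewrite subr0 (le_trans (le_normcD _ _))// normcN.
      rewrite ![normc (_ * _%:C)]normcM !normc_expC !normcR !ger0_norm ?expR_ge0// !ReE !expRK.
      have e0 : 0 < expR n.+1%:R :> R by exact: expR_gt0.
      apply: lerD; last first.
        by rewrite mul1r -mulrN ler_piMr ?expR_ge0// expR_le1 oppr_le0 expR_ge0.
      (* [gamma_bound] has the exponent [x + 1], one more than the boundary term, and
         [ln (1 + e^(n+1)) >= n + 1] turns the spare power into the decay [e^(-(n+1))]. *)
      rewrite /gammaC mul1r -!expRD ler_expR.
      have := gamma_bound z0 e0; rewrite -/x.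
      have : n.+1%:R <= ln (1 + expR n.+1%:R) :> R.
        by rewrite -[leLHS]expRK ler_ln ?posrE ?addr_gt0// lerDr.
      by move: z0; rewrite -/x; nra.
    + exact: cvg_cst.
    + rewrite -[X in _ --> X]addr0; apply: cvgD; exact: cvg_const_expRN.
move: H; rewrite CintegralD ?CintegralZl; first last.
  all: try exact: measurable_itv.
  all: try by [exact: cintble_Gamma|apply: cintbleZl; [exact: measurable_itv|exact: cintble_Gamma]].
by rewrite mulN1r => /eqP; rewrite subr_eq0 => /eqP ->.
Qed.

Lemma cGamma_Re_gt0 z : 0 < complex.Re z -> cGamma z = Euler_integral z.
Proof.
by move=> z0; rewrite /cGamma /cGamma_shift z0 big_geq// divr1 addr0.
Qed.

Lemma cGammaS z : 0 < complex.Re z -> cGamma (z + 1) = z * cGamma z.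
Proof.
by move=> z0; rewrite !cGamma_Re_gt0 ?Euler_integralS// cReD addr_gt0.
Qed.

End Gamma.

(** * Absence of zeros of Gamma in the right half-plane *)

Section GammaNonvanishing.
Context {R : realType}.
Notation mu := (@lebesgue_measure R).
Implicit Types (x t y : R) (z : R[i]).

Let D : set (measurableTypeR R) := `]0, +oo[%classic.

Let D_gt0 t : D t -> 0 < t.
Proof. by rewrite /D /= in_itv /= andbT. Qed.

Lemma Cintegral_gamma_density z : 0 < complex.Re z -> Euler_integral z =
  Cintegral D (fun t => (gamma_density (complex.Re z) t)%:C * expi (complex.Im z * ln t)).
Proof. by move=> z0; apply: eq_Cintegral => t /D_gt0; exact: Gamma_integrandE. Qed.

Lemma Euler_integral_real x : Euler_integral x%:C = (rGamma x)%:C.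
Proof.
rewrite /rGamma -Cintegral_real; apply: eq_Cintegral => t /D_gt0 t0.
rewrite -[LHS]/(Gamma_integrand x%:C t) Gamma_integrandE//= mul0r.
by rewrite (_ : expi 0 = 1) ?mulr1// expi0.
Qed.

Lemma rGammaS x : 0 < x -> rGamma (x + 1) = x * rGamma x.
Proof.
move=> x0; have := @Euler_integralS R x%:C x0.
have -> : x%:C + 1 = (x + 1)%:C by apply: complex_eq; rewrite /= ?addr0.
rewrite !Euler_integral_real => h.
by apply: complexI; rewrite h; apply: complex_eq; rewrite /=; ring.
Qed.

Lemma rGamma_gt0 x : 0 < x -> 0 < rGamma x.
Proof.
(* On [[1, 2]], of length 1, [0 <= ln t <= 1], so the density is at least [e^(-|x - 1|) e^(-2)]. *)
move=> x0; pose m := expR (- `|x - 1| - 2).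
have m0 : 0 < m by exact: expR_gt0.
have s12 : `[1, 2]%classic `<=` D.
  by move=> t; rewrite /D /= !in_itv /= andbT => /andP[/(lt_le_trans ltr01)].
have i := integrable_gamma_density x0.
have : (m%:E <= \int[mu]_(t in D) (gamma_density x t)%:E)%E.
  have -> : m%:E = (\int[mu]_(t in `[1%R, 2%R]) m%:E)%E.
    rewrite integral_cst//= lebesgue_measure_itv /= lte_fin ltr1n -EFinB.
    by rewrite -EFinM; congr EFin; lra.
  apply: (@le_trans _ _ (\int[mu]_(t in `[1%R, 2%R]) (gamma_density x t)%:E)%E); last first.
    apply: ge0_subset_integral => //.
    - exact: measurable_itv.
    - exact: measurable_int i.
    - by move=> t _; rewrite lee_fin gamma_density_ge0.
  apply: ge0_le_integral => //.
  - by move=> t _; rewrite lee_fin ltW.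
  - by apply/measurable_EFinP/measurable_funTS; exact: measurable_gamma_density.
  move=> t /=; rewrite in_itv /= => /andP[t1 t2].
  have t0 : 0 < t by exact: lt_le_trans t1.
  rewrite lee_fin gamma_densityE// ler_expR.
  have l0 : 0 <= ln t by rewrite ln_ge0.
  have l1 : ln t <= 1.
    have := @le_ln1Dx _ (t - 1); rewrite addrCA subrr addr0.
    have : -1 < t - 1 by lra.
    by move=> h /(_ h); lra.
  have := ler_norm (- (x - 1)); rewrite normrN; have := normr_ge0 (x - 1); nra.
rewrite -[rGamma x]/(fine _) -fine0 => h.
apply: lt_le_trans m0 _; rewrite -lee_fin fineK//; exact: integrable_fin_num.
Qed.

Lemma ler_norm_sin y : `|sin y| <= `|y|.
Proof.
wlog y0 : y / 0 < y => [H|].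
  have [->|] := eqVneq y 0; first by rewrite sin0.
  rewrite neq_lt => /orP[yn|]; last exact: H.
  by rewrite -normrN -sinN -[leRHS]normrN; apply: H; rewrite oppr_gt0.
have [c _] := @MVT _ sin cos 0 y y0 (fun x _ => is_derive_sin x)
  (continuous_subspaceT (@continuous_sin R)).
rewrite sin0 !subr0 => ->; rewrite normrM ler_piMl//; exact: cos_max.
Qed.

Lemma ler_cos_sqr y : 1 - y ^+ 2 / 2 <= cos y.
Proof.
have -> : cos y = 1 - 2 * sin (y / 2) ^+ 2.
  have {1}-> : y = (y / 2) *+ 2 by rewrite mulr2n -splitr.
  by rewrite cos_mulr2n cos2sin2; ring.
have := ler_norm_sin (y / 2); rewrite -ler_sqr ?nnegrE// !real_normK ?num_real//.
rewrite expr_div_n; lra.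
Qed.

(** With [t = e^(2u)] the two sides are [4 u^2] and [4 (e^u - e^(-u))^2], and
    [|e^u - e^(-u)| >= |u|]. *)
Lemma sqr_ln_le t : 0 < t -> ln t ^+ 2 <= 4 * (t - 2 + t^-1).
Proof.
move=> t0; set u := ln t / 2.
have -> : ln t = 2 * u by rewrite /u; field.
have -> : t = expR u * expR u by rewrite -expRD /u -splitr lnK.
rewrite invfM -!expRN.
have eN : expR u * expR (- u) = 1 by rewrite -expRD subrr expR0.
suff : u ^+ 2 <= (expR u - expR (- u)) ^+ 2.
  have -> : (expR u - expR (- u)) ^+ 2 =
    expR u * expR u - 2 * (expR u * expR (- u)) + expR (- u) * expR (- u) by ring.
  by rewrite eN => h; rewrite exprMn -natrX ler_pM2l//; lra.
have h1 := expR_ge1Dx u; have h2 := expR_ge1Dx (- u).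
have [u0|u0] := leP 0 u.
  have h3 : expR (- u) <= 1 by rewrite expR_le1 oppr_le0.
  rewrite ler_sqr ?nnegrE//; lra.
have h3 : expR u <= 1 by rewrite expR_le1 ltW.
rewrite -sqrrN -[leRHS]sqrrN ler_sqr ?nnegrE; lra.
Qed.

Lemma gamma_densityM x t : 0 < t -> gamma_density (x + 1) t = t * gamma_density x t.
Proof.
move=> t0; rewrite !gamma_densityE// -[X in _ = X * _]lnK ?posrE// -expRD.
by congr expR; ring.
Qed.

(* After rotation by [expi (- (y * ln a))] the real part of the integrand is
   [gamma_density a t * cos (y * ln (t / a))], and the bounds cos x >= 1 - x^2/2
   and ln^2 r <= 4 (r - 2 + 1/r) make its integral positive. *)
Lemma Euler_integral_neq0_large z :
  1 + 2 * complex.Im z ^+ 2 < complex.Re z -> Euler_integral z != 0.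
Proof.
set a := complex.Re z; set y := complex.Im z => ya.
have y2 : 0 <= y ^+ 2 by exact: sqr_ge0.
have a1 : 0 < a - 1 by lra.
have a0 : 0 < a by lra.
have aS : 0 < a + 1 by lra.
apply/eqP => Gz0; have /(congr1 (fun w => expi (- (y * ln a)) * w)) := Cintegral_gamma_density a0.
rewrite Gz0 mulr0.
have ig : cintble mu D (fun t => (gamma_density a t)%:C * expi (y * ln t)).
  apply: cintble_expi; first exact: measurable_itv.
    by split => /=; [exact: integrable_gamma_density|exact: integrable0].
  by apply: measurable_funTS; exact: measurable_funM.
rewrite -CintegralZl; [|exact: measurable_itv|exact: ig].
move=> /(congr1 (@complex.Re R)) /esym.
rewrite -[X in X = _]/(\int[mu]_(t in D) complex.Re (expi (- (y * ln a)) *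
  ((gamma_density a t)%:C * expi (y * ln t)))) -[RHS]/(0:R).
have ig' := (cintbleZl (expi (- (y * ln a))) (measurable_itv _) ig).1.
have ReE t : complex.Re (expi (- (y * ln a)) * ((gamma_density a t)%:C * expi (y * ln t))) =
    gamma_density a t * cos (y * (ln t - ln a)).
  rewrite mulrCA -expiD cRe_realM /expi Re_expC /= expR0 mul1r.
  by congr (_ * cos _); ring.
(* Factors [t] and [1 / t] shift the parameter of the density by one, so this minorant is
   [gamma_density a t] times [1 - 2 y^2 (t / a - 2 + a / t)]. Its integral is
   [Gamma(a - 1) (a - 1 - 2 y^2)], whence the threshold in the hypothesis. *)
pose h t := (1 + 4 * y ^+ 2) * gamma_density a t + (- (2 * y ^+ 2 / a)) * gamma_density (a + 1) t +
  (- (2 * y ^+ 2 * a)) * gamma_density (a - 1) t.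
have iZ c x : 0 < x -> mu.-integrable D (EFin \o (fun t => c * gamma_density x t)).
  by move=> x0; have /(_ c) := integrableZl (mu := mu) (measurable_itv _) _ (integrable_gamma_density x0).
have ih2 : mu.-integrable D (EFin \o (fun t => (1 + 4 * y ^+ 2) * gamma_density a t +
    (- (2 * y ^+ 2 / a)) * gamma_density (a + 1) t)).
  by apply: (integrableD (mu := mu) (measurable_itv _) (iZ _ _ a0) (iZ _ _ aS)).
have ih : mu.-integrable D (EFin \o h).
  by apply: (integrableD (mu := mu) (measurable_itv _) ih2 (iZ _ _ a1)).
have hE : \int[mu]_(t in D) h t = rGamma (a - 1) * (a - 1 - 2 * y ^+ 2).
  rewrite /h (RintegralD (mu := mu) (measurable_itv _) ih2 (iZ _ _ a1)).
  rewrite (RintegralD (mu := mu) (measurable_itv _) (iZ _ _ a0) (iZ _ _ aS)).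
  rewrite !RintegralZl; try exact: measurable_itv; try exact: integrable_gamma_density.
  rewrite -![\int[mu]_(t in D) gamma_density _ t]/(rGamma _) rGammaS//.
  have := rGammaS a1; rewrite subrK => ->.
  by field; exact: lt0r_neq0.
have h_gt0 : 0 < \int[mu]_(t in D) h t.
  by rewrite hE mulr_gt0 ?rGamma_gt0// subr_gt0; lra.
move=> /eqP; apply/negP; rewrite gt_eqF//; apply: lt_le_trans h_gt0 _.
apply: le_Rintegral => //; first exact: measurable_itv.
move=> t /D_gt0 t0; rewrite ReE /h gamma_densityM//.
have -> : gamma_density (a - 1) t = t^-1 * gamma_density a t.
  by rewrite -{2}(subrK 1 a) gamma_densityM// mulKf ?gt_eqF.
rewrite [leLHS](_ : _ = gamma_density a t * (1 - 2 * y ^+ 2 * (t / a - 2 + (t / a)^-1))); last first.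
  by field; rewrite !gt_eqF.
apply: ler_wpM2l; first exact: gamma_density_ge0.
apply: le_trans (ler_cos_sqr _).
have ta : 0 < t / a by rewrite divr_gt0.
have := sqr_ln_le ta; rewrite ln_div ?posrE// exprMn.
move: (_ ^+ 2) (t / a - 2 + _) => u v; nra.
Qed.

(** By the functional equation a zero would propagate to every [z + k], with the same imaginary
    part, and so reach the region of [Euler_integral_neq0_large]. *)
Lemma Euler_integral_neq0 z : 0 < complex.Re z -> Euler_integral z != 0.
Proof.
move=> z0; have [n nz] := ge1_expR_natS (2 + 2 * complex.Im z ^+ 2).
apply/eqP => Gz0.
have H k : 0 < complex.Re (z + k%:R) /\ complex.Im (z + k%:R) = complex.Im z /\
    complex.Re (z + k%:R) = complex.Re z + k%:R /\ Euler_integral (z + k%:R) = 0.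
  elim: k => [|k [h1 [h2 [h3 h4]]]]; first by rewrite !addr0.
  rewrite -[k.+1%:R]natr1 addrA cReD cImD h2 /= addr0 h3 -[k.+1%:R]natr1 addrA.
  rewrite Euler_integralS// h4 mulr0; do !split => //.
  by move: h1; rewrite h3; lra.
have [_ [h2 [h3 /eqP]]] := H n.+1; apply/negP/Euler_integral_neq0_large.
by rewrite h2 h3; lra.
Qed.

End GammaNonvanishing.

(** * Mellin inversion of the G-functions *)

Section MellinInversion.
Context {R : realType}.
Notation mu := (@lebesgue_measure R).
Variables (A c psi : R).
Hypotheses (A0 : 0 < A) (psi0 : 0 < psi) (psic : psi < c).

(** Each linear factor is at least a multiple of [sqrt(1 + t^2)] on its line, so the inverses of two
    of them give the integrable weight [1 / (1 + t^2)]. *)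
Lemma ler_normc_line (p t : R) : 0 < p ->
  Num.min 1 p * Num.sqrt (1 + t ^+ 2) <= normc (p +i* t).
Proof.
move=> p0; have m0 : 0 <= Num.min 1 p by rewrite le_min ler01 ltW.
rewrite /= -[X in X * _]ger0_norm// -sqrtr_sqr -sqrtrM ?sqr_ge0// ler_wsqrtr//.
rewrite mulrDr mulr1 lerD//.
  by rewrite ler_sqr ?nnegrE ?(ltW p0)// ge_min lexx orbT.
rewrite ler_piMl ?sqr_ge0//.
by rewrite -[leRHS](expr1n _ 2) ler_sqr ?nnegrE// ge_min lexx.
Qed.

Lemma cmeas_line (p : R) : cmeas setT (fun t => (p +i* t)).
Proof. by split => /=; [exact: measurable_cst|exact: measurable_id]. Qed.

Lemma cmeas_lineN (p : R) : cmeas setT (fun t : R => (p +i* - t)).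
Proof. by split => /=; [exact: measurable_cst|exact: measurable_funN]. Qed.

Definition Mellin_kernel n t : R[i] := (psi +i* t)^-1 * ((c - psi) +i* - t)^-1 ^+ n.+1.

Let cpsi : 0 < c - psi. Proof. by rewrite subr_gt0. Qed.

Lemma cintble_Mellin_kernel n : cintble mu setT (Mellin_kernel n).
Proof.
have m1 : 0 < Num.min 1 psi by rewrite lt_min ltr01.
have m2 : 0 < Num.min 1 (c - psi) by rewrite lt_min ltr01.
(* The factor [1 / s] and one factor [1 / (c - s)] are compared with [(1 + t^2)^(-1/2)], the other
   [n] are bounded by [1 / (c - psi)], and the division by 2 compensates the weight
   [2 / (1 + t^2)]. *)
pose C := (Num.min 1 psi)^-1 * (Num.min 1 (c - psi))^-1 * (c - psi)^-1 ^+ n / 2.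
have [i _] := @integral_oneDsqrT R.
have := integrableZl (mu := mu) measurableT C i => iC.
apply: (cintble_le (m := mu) (g := fun t => C * (2 / (1 + t ^+ 2)))) => //.
  apply: cmeasM; first by apply: cmeasV; exact: cmeas_line.
  by apply: cmeasX; apply: cmeasV; exact: cmeas_lineN.
move=> t _.
have q0 : 0 < 1 + t ^+ 2 by rewrite ltr_pwDl// sqr_ge0.
have sq0 : 0 < Num.sqrt (1 + t ^+ 2) by rewrite sqrtr_gt0.
have b1 : (normc (psi +i* t))^-1 <= (Num.min 1 psi)^-1 * (Num.sqrt (1 + t ^+ 2))^-1.
  have h := @ler_normc_line psi t psi0.
  have p1 : 0 < Num.min 1 psi * Num.sqrt (1 + t ^+ 2) by rewrite mulr_gt0.
  by rewrite -invfM lef_pV2 ?posrE//; exact: lt_le_trans h.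
have b2 : (normc ((c - psi) +i* - t))^-1 <=
    (Num.min 1 (c - psi))^-1 * (Num.sqrt (1 + t ^+ 2))^-1.
  have h := @ler_normc_line (c - psi) (- t) cpsi; rewrite sqrrN in h.
  have p1 : 0 < Num.min 1 (c - psi) * Num.sqrt (1 + t ^+ 2) by rewrite mulr_gt0.
  by rewrite -invfM lef_pV2 ?posrE//; exact: lt_le_trans h.
have b3 : (normc ((c - psi) +i* - t))^-1 <= (c - psi)^-1.
  have h : c - psi <= normc ((c - psi) +i* - t).
    exact: le_trans (ler_norm _) (ler_Re_normc ((c - psi) +i* - t)).
  by rewrite lef_pV2 ?posrE//; exact: lt_le_trans h.
rewrite /Mellin_kernel exprS !normcM !normcV.
have normcX (z : R[i]) k : normc (z ^+ k) = normc z ^+ k.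
  by elim: k => [|k ih]; rewrite ?expr0 ?normc1// !exprS normcM ih.
rewrite normcX normcV.
have n0 (z : R[i]) : 0 <= (normc z)^-1 by rewrite invr_ge0 normc_ge0.
apply: (@le_trans _ _ ((Num.min 1 psi)^-1 * (Num.sqrt (1 + t ^+ 2))^-1 *
  ((Num.min 1 (c - psi))^-1 * (Num.sqrt (1 + t ^+ 2))^-1 * (c - psi)^-1 ^+ n))).
  apply: ler_pM => //; first by rewrite mulr_ge0// exprn_ge0.
  apply: ler_pM => //; first by rewrite exprn_ge0.
  by rewrite lerXn2r ?nnegrE// invr_ge0 ltW.
have E : (Num.sqrt (1 + t ^+ 2))^-1 * (Num.sqrt (1 + t ^+ 2))^-1 = (1 + t ^+ 2)^-1.
  by rewrite -invfM -expr2 sqr_sqrtr// ltW.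
rewrite /C -E; set S := (Num.sqrt _)^-1; set M1 := (Num.min 1 psi)^-1.
set M2 := (Num.min 1 (c - psi))^-1; set K := _ ^+ n.
by rewrite le_eqVlt; apply/orP; left; apply/eqP; field.
Qed.

Definition log_power_cdf n y : R :=
  \int[mu]_(u in `]0, A]) (if ln (u / A) < y then log_power A n c u else 0).

(** Perron's formula for the exponent [c - psi]: the weight [e^(-psi (y - X u))] that it produces
    restores the exponent [c] and leaves [e^(-psi y)] outside the integral. *)
Lemma Mellin_log_power_cdf n y :
  (2 * pi * expR (- (psi * y)) * log_power_cdf n y)%:C =
  Cintegral setT (fun t => Mellin_kernel n t * expi (t * y)).
Proof.
pose D : set (measurableTypeR R) := `]0, A]%classic.
have mD : measurable D by exact: measurable_itv.
pose X u := ln (u / A).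
have mX : measurable_fun D X.
  apply: measurable_funTS; apply: (measurableT_comp (f := @ln R)) => //.
  exact: measurable_funM.
(* The logarithm is injective, so the exceptional set lies in the single point [A e^y]. *)
have Xy : {ae mu, forall u, D u -> X u != y}.
  exists [set A * expR y]; split; first exact: measurable_set1.
    exact: lebesgue_measure_set1.
  move=> u /= /not_implyP[Du /negP]; rewrite negbK => /eqP <-.
  have u0 : 0 < u by move: Du; rewrite /D /= in_itv /= => /andP[].
  by rewrite /X lnK ?posrE ?divr_gt0// mulrC divfK// gt_eqF.
have gi : mu.-integrable D (EFin \o log_power A n (c - psi)) by exact: integrable_log_power.
have kE t : (psi +i* t)^-1 * Cintegral D (fun u => (log_power A n (c - psi) u)%:C *
    expi (- (t * X u))) = Mellin_kernel n t.
  by rewrite /Mellin_kernel Cintegral_log_power.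
have ki : cintble mu setT (fun t => (psi +i* t)^-1 * Cintegral D (fun u =>
    (log_power A n (c - psi) u)%:C * expi (- (t * X u)))).
  by under eq_fun do rewrite kE; exact: cintble_Mellin_kernel.
have := Perron_formula mD gi mX psi0 Xy ki.
rewrite [RHS](_ : _ = Cintegral setT (fun t => Mellin_kernel n t * expi (t * y))); last first.
  by apply: eq_Cintegral => t _; rewrite kE.
move=> <-; congr (_%:C); rewrite /log_power_cdf -mulrA; congr (_ * _).
rewrite -RintegralZl//; last first.
  have ic : mu.-integrable D (EFin \o log_power A n c).
    by apply: integrable_log_power => //; exact: lt_trans psi0 psic.
  apply: le_integrable ic => //.
    apply/measurable_EFinP; apply: measurable_fun_if => //.
    - exact: measurable_fun_ltr.
    - apply: measurable_funS (@subIsetl _ _ _) _ => //; exact: measurable_log_power.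
  move=> u Du /=; rewrite lee_fin; case: ifP => // _.
  by rewrite normr0.
apply: eq_Rintegral => u _; rewrite -/(X u); case: ifP => _; last by rewrite mulr0.
rewrite /log_power -/(X u) mulrCA -!mulrA; congr (_ * (_ * (_ * _))).
by rewrite -!expRD; congr expR; ring.
Qed.

End MellinInversion.

(** * Multiplication of the kernel by a Gamma factor *)

Section GammaConvolution.
Context {R : realType}.
Notation mu := (@lebesgue_measure R).

(* Multiplicative convolution with the Gamma density, in the variable [y = ln z]. *)
Definition gamma_smooth (a : R) (h : R -> R) (y : R) : R :=
  \int[mu]_(b in `]0, +oo[) (gamma_density a b * h (y - ln b)).

Let D : set (measurableTypeR R) := `]0, +oo[%classic.

Variables (psi a : R) (k : R -> R[i]) (h : R -> R).
Hypothesis psia : psi < a.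
Hypothesis ki : cintble mu setT k.
Hypothesis kh : forall y, (2 * pi * expR (- (psi * y)) * h y)%:C =
  Cintegral setT (fun t => k t * expi (t * y)).

Let a_psi : 0 < a - psi. Proof. by rewrite subr_gt0. Qed.

Let mD : measurable D. Proof. exact: measurable_itv. Qed.

Let mln : measurable_fun D (@ln R).
Proof. exact: measurable_funTS. Qed.

Let kE t : k t * Euler_integral (a%:C - (psi +i* t)) =
  k t * Cintegral D (fun b => (gamma_density (a - psi) b)%:C * expi (- (t * ln b))).
Proof.
rewrite Cintegral_gamma_density; last by rewrite cReD cReN /=.
congr (_ * _); apply: eq_Cintegral => b _.
by rewrite cReD cReN cImD cImN /= add0r mulNr.
Qed.

Lemma cintble_gamma_smooth :
  cintble mu setT (fun t => k t * Euler_integral (a%:C - (psi +i* t))).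
Proof.
under eq_fun do rewrite kE.
by apply: cintble_convolution_in => //; exact: integrable_gamma_density.
Qed.

Let gamma_smoothE y b : D b ->
  (gamma_density (a - psi) b)%:C * Cintegral setT (fun t => k t * expi (t * (y - ln b))) =
  (2 * pi * expR (- (psi * y)) * (gamma_density a b * h (y - ln b)))%:C.
Proof.
rewrite /D /= in_itv /= andbT => b0; rewrite -kh -rmorphM; congr (_%:C).
rewrite !gamma_densityE//.
have -> : expR ((a - psi - 1) * ln b - b) =
    expR ((a - 1) * ln b - b) * expR (- (psi * ln b)).
  by rewrite -expRD; congr expR; ring.
have -> : expR (- (psi * (y - ln b))) = expR (- (psi * y)) * expR (psi * ln b).
  by rewrite -expRD; congr expR; ring.
rewrite [expR (- (psi * ln b))]expRN; field.
by rewrite gt_eqF// expR_gt0.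
Qed.

(** Integrability is read off the Fourier side through [cintble_convolved_in], as [h] is known only
    by its inversion formula. *)
Let i0 y : mu.-integrable D (EFin \o (fun b =>
  2 * pi * expR (- (psi * y)) * (gamma_density a b * h (y - ln b)))).
Proof.
have H := (cintble_convolved_in mD ki (integrable_gamma_density a_psi) mln y).1.
apply: eq_integrable H => // b; rewrite inE => Db.
by rewrite /comp gamma_smoothE.
Qed.

Lemma integrable_gamma_smooth y :
  mu.-integrable D (EFin \o (fun b => gamma_density a b * h (y - ln b))).
Proof.
have C0 : 2 * pi * expR (- (psi * y)) != 0.
  by rewrite mulf_neq0 ?mulf_neq0 ?gt_eqF ?expR_gt0 ?pi_gt0.
have := integrableZl (mu := mu) mD (2 * pi * expR (- (psi * y)))^-1 (i0 y).
by apply: eq_integrable => // b _ /=; rewrite -EFinM mulKf.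
Qed.

(** The conclusion has the shape of the hypothesis [kh], with [k] multiplied by [Gamma(a - s)] and
    [h] replaced by [gamma_smooth a h]; with [cintble_gamma_smooth] it can therefore be applied
    again. The real part of [s] changes the parameter of the density to [a - psi], which
    [gamma_smoothE] turns back into [a]. *)
Lemma Mellin_gamma_smooth y :
  (2 * pi * expR (- (psi * y)) * gamma_smooth a h y)%:C =
  Cintegral setT (fun t => k t * Euler_integral (a%:C - (psi +i* t)) * expi (t * y)).
Proof.
rewrite [RHS](_ : _ = Cintegral setT (fun t => k t * Cintegral D (fun b =>
  (gamma_density (a - psi) b)%:C * expi (- (t * ln b))) * expi (t * y))); last first.
  by apply: eq_Cintegral => t _; rewrite kE.
rewrite -(Cintegral_convolution_in mD ki (integrable_gamma_density a_psi) mln y).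
rewrite /gamma_smooth -RintegralZl//; last exact: integrable_gamma_smooth.
rewrite -Cintegral_real; apply: eq_Cintegral => b Db.
by rewrite gamma_smoothE.
Qed.

End GammaConvolution.

(** * The G-functions as iterated Gamma smoothings *)

Section MeijerG.
Context {R : realType}.
Notation mu := (@lebesgue_measure R).
Variables (A alpha beta c : R).
Hypotheses (A0 : 0 < A) (alpha0 : 0 < alpha) (beta0 : 0 < beta) (c0 : 0 < c).
Variable k : nat.

Let a_s : seq R[i] := 1 :: nseq (2 * k + 1) (c + 1)%:C.
Let b_s : seq R[i] := [:: alpha%:C; beta%:C] ++ nseq (2 * k + 1) c%:C ++ [:: 0].

Let b_sE j : (2 <= j < 2 * k + 3)%N -> b_s`_j = c%:C.
Proof.
case: j => [|[|j]] // /andP[_]; rewrite addn3 !ltnS => jk.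
by rewrite /= nth_cat size_nseq addn1 ltnS jk nth_nseq ltnS jk.
Qed.

Let b_s_last : b_s`_(2 * k + 3) = 0.
Proof. by rewrite addn3 /= nth_cat size_nseq addn1 ltnn subnn. Qed.

Let a_sE j : (1 <= j < 2 * k + 2)%N -> a_s`_j = (c + 1)%:C.
Proof.
by case: j => [|j] //; rewrite /= addn2 ltnS => jk; rewrite nth_nseq addn1 jk.
Qed.

Let psi := get [set psi | separating_line (2 * k + 3) 1 a_s b_s psi].

(** [get] returns a separating line because one exists, at half the minimum of [alpha], [beta], [c].
    Only the conditions on the extreme poles [alpha], [beta], [c] and 0 are retained. *)
Let psiP : [/\ 0 < psi, psi < alpha, psi < beta & psi < c].
Proof.
have /getPex : exists p : R, separating_line (2 * k + 3) 1 a_s b_s p.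
  have m0 : 0 < Num.min (Num.min alpha beta) c by rewrite !lt_min alpha0 beta0.
  exists (Num.min (Num.min alpha beta) c / 2).
  have m2 : Num.min (Num.min alpha beta) c / 2 < Num.min (Num.min alpha beta) c by lra.
  have ReD (z : R[i]) l : complex.Re (z + l%:R) = complex.Re z + l%:R.
    by rewrite cReD; congr (_ + _); elim: l => // l ih; rewrite -[l.+1%:R]natr1 cReD ih natr1.
  split=> j l jm.
    rewrite ReD (lt_le_trans m2)//.
    have -> : forall x y : R, 0 <= y - x -> x <= y by move=> x y; rewrite subr_ge0.
      by [].
    have l0 : 0 <= l%:R :> R by [].
    suff : Num.min (Num.min alpha beta) c <= complex.Re b_s`_j by lra.
    have [j2|j2] := leqP 2 j; first by rewrite b_sE ?j2//= ge_min lexx orbT.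
    by case: j j2 {jm} => [|[|//]] _ /=; rewrite !ge_min lexx ?orbT.
  have -> : j = 0%N by move: jm; rewrite ltnS leqn0 => /eqP.
  have ReNl : complex.Re (a_s`_0 - 1 - l%:R) = - l%:R.
    rewrite /= subrr sub0r cReN -[in LHS](add0r l%:R) ReD /= add0r//.
  rewrite ReNl (le_lt_trans (y := 0)) ?oppr_le0// divr_gt0//.
rewrite -/psi => -[h1 h2].
have h10 := h1 0%N 0%N (ltn_addl _ (isT : 0 < 3)%N).
have h11 := h1 1%N 0%N (ltn_addl _ (isT : 1 < 3)%N).
have h12 := h1 2%N 0%N (ltn_addl _ (isT : 2 < 3)%N).
have h20 := h2 0%N 0%N isT.
rewrite b_sE ?addn3// in h12.
by split; move: h10 h11 h12 h20; rewrite /= ?addr0 ?subrr ?oppr0.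
Qed.

Let integrandE (x t : R) : 0 < x ->
  meijerG_integrand (2 * k + 3) 1 (2 * k + 2) (2 * k + 4) a_s b_s x (psi +i* t) =
  (expR (psi * ln x))%:C * (Mellin_kernel c psi (2 * k) t *
    Euler_integral (beta%:C - (psi +i* t)) * Euler_integral (alpha%:C - (psi +i* t)) *
    expi (t * ln x)).
Proof.
move=> x0; have [psi0 psia psib psic] := psiP.
set s := psi +i* t.
have Re_s (r : R) : complex.Re (r%:C - s) = r - psi by rewrite cReD cReN.
have cs0 : c%:C - s != 0.
  apply/eqP => /(congr1 (@complex.Re R)); rewrite Re_s -[RHS]/(0:R) => /eqP.
  by rewrite gt_eqF// subr_gt0.
have s0 : s != 0 by rewrite eq_complex /= negb_and gt_eqF.
(* The quotients [Gamma(c - s) / Gamma(c + 1 - s)] and [Gamma(s) / Gamma(1 + s)] simplify because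
   these values are nonzero. *)
have Gc : cGamma (c%:C - s) != 0.
  by rewrite cGamma_Re_gt0 ?Re_s ?subr_gt0// Euler_integral_neq0// Re_s subr_gt0.
have Gs : cGamma s != 0 by rewrite cGamma_Re_gt0// Euler_integral_neq0.
rewrite /meijerG_integrand.
have -> : \prod_(0 <= j < 2 * k + 3) cGamma (b_s`_j - s) =
    cGamma (alpha%:C - s) * (cGamma (beta%:C - s) * cGamma (c%:C - s) ^+ (2 * k + 1)).
  rewrite big_ltn ?addn3// big_ltn//; congr (_ * (_ * _)).
  rewrite (eq_big_nat _ _ (F2 := fun=> cGamma (c%:C - s))); last first.
    by move=> j jk; rewrite b_sE// addn3.
  by rewrite prodr_const_nat; congr (_ ^+ _); rewrite !subSS subn0 addn1.
have -> : \prod_(0 <= j < 1) cGamma (1 - a_s`_j + s) = cGamma s.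
  by rewrite big_nat1 /= subrr add0r.
have -> : \prod_(2 * k + 3 <= j < 2 * k + 4) cGamma (1 - b_s`_j + s) = s * cGamma s.
  have -> : (2 * k + 4 = (2 * k + 3).+1)%N by rewrite addnS.
  by rewrite big_nat1 b_s_last subr0 addrC cGammaS.
have -> : \prod_(1 <= j < 2 * k + 2) cGamma (a_s`_j - s) =
    ((c%:C - s) * cGamma (c%:C - s)) ^+ (2 * k + 1).
  rewrite (eq_big_nat _ _ (F2 := fun=> (c%:C - s) * cGamma (c%:C - s))); last first.
    move=> j jk; rewrite a_sE// -cGammaS ?Re_s ?subr_gt0//; congr cGamma.
    by rewrite rmorphD addrAC.
  by rewrite prodr_const_nat addn2 subSS subn0 addn1.
have -> : cpow x s = (expR (psi * ln x))%:C * expi (t * ln x).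
  by rewrite /cpow /s -expC_cstr.
rewrite -!cGamma_Re_gt0 ?Re_s ?subr_gt0// /Mellin_kernel -/s.
have -> : (c - psi) +i* - t = c%:C - s by apply: complex_eq; rewrite /= ?add0r.
rewrite addn1; set n := (2 * k).+1.
move: (cGamma (c%:C - s)) (cGamma (alpha%:C - s)) (cGamma (beta%:C - s)) (cGamma s) Gc Gs.
move: (c%:C - s) cs0 (expR _)%:C (expi _) => C C0 E I Gc Ga Gb Gs Gc0 Gs0.
rewrite exprMn exprVn.
have Gcn : Gc ^+ n != 0 by rewrite expf_neq0.
have csn : C ^+ n != 0 by rewrite expf_neq0.
move: (Gc ^+ n) (C ^+ n) Gcn csn => G1 G2 G10 G20.
by field; rewrite G10 G20 s0 Gs0.
Qed.

Lemma meijerG_gamma_smooth x : 0 < x ->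
  meijerG (2 * k + 3) 1 (2 * k + 2) (2 * k + 4) a_s b_s x =
  (gamma_smooth alpha (gamma_smooth beta (log_power_cdf A c (2 * k))) (ln x))%:C.
Proof.
move=> x0; have [psi0 psia psib psic] := psiP.
have K0 := cintble_Mellin_kernel psi0 psic (2 * k).
have E0 := Mellin_log_power_cdf A0 psi0 psic (2 * k).
have K1 := cintble_gamma_smooth psib K0.
have E1 := Mellin_gamma_smooth psib K0 E0.
have K2 := cintble_gamma_smooth psia K1.
have E2 := Mellin_gamma_smooth psia K1 E1.
rewrite /meijerG -/psi /vline_integral.
pose f t := (Mellin_kernel c psi (2 * k) t *
    Euler_integral (beta%:C - (psi +i* t)) * Euler_integral (alpha%:C - (psi +i* t)) *
    expi (t * ln x)).
have fi : cintble mu setT f by apply: cintble_expi => //; exact: measurable_funM.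
(* The factor ['i%C] is [ds / dt] and cancels against [1 / (2 pi i)], as [e^(psi ln x)] does against
   the [e^(-psi y)] of the inversion formula. *)
rewrite (@eq_Cintegral R setT _ (fun t => ((expR (psi * ln x))%:C * 'i%C) * f t)); last first.
  by move=> t _; rewrite integrandE// /f; ring.
rewrite CintegralZl// -E2.
set Q := gamma_smooth _ _ _.
have -> : (2 * pi * expR (- (psi * ln x)) * Q)%:C =
    (2 * pi)%:C * (expR (psi * ln x))%:C^-1 * Q%:C :> R[i].
  by rewrite expRN -fmorphV -!rmorphM.
have e0 : (expR (psi * ln x))%:C != 0 :> R[i].
  by rewrite eq_complex /= negb_and gt_eqF// expR_gt0.
have p0 : (2 * pi)%:C != 0 :> R[i].
  by rewrite eq_complex /= negb_and gt_eqF// mulr_gt0// pi_gt0.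
have i0 : 'i%C != 0 :> R[i] by rewrite eq_complex /= negb_and oner_eq0 orbT.
move: (2 * pi)%:C (expR _)%:C 'i%C Q%:C p0 e0 i0 => P E I q P0 E00 I0.
by field; rewrite P0 E00 I0.
Qed.

End MeijerG.

(** * The Gamma-Gamma law *)

Section GammaMixture.
Context {R : realType}.
Notation mu := (@lebesgue_measure R).
Implicit Types D : set (measurableTypeR R).

Lemma le_integrable_bounded D (M : R) (g h : R -> R) : measurable D ->
  mu.-integrable D (EFin \o g) -> measurable_fun D h -> (forall x, 0 <= h x <= M) ->
  mu.-integrable D (EFin \o (fun x => g x * h x)).
Proof.
move=> mD gi mh hM; have := integrableZl (mu := mu) mD M gi.
apply: le_integrable => //.
  apply/measurable_EFinP/measurable_funM => //.
  by apply/measurable_EFinP; exact: measurable_int gi.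
move=> x _ /=; have /andP[h0 h1] := hM x; rewrite lee_fin !normrM mulrC.
by rewrite ler_wpM2r// (ger0_norm h0) (ger0_norm (le_trans h0 h1)).
Qed.

Variables (a M : R) (h : R -> R).
Hypothesis a0 : 0 < a.
Hypothesis ndh : {homo h : x y / x <= y}.
Hypothesis hM : forall x, 0 <= h x <= M.

Let D0 : set (measurableTypeR R) := `]0, +oo[%classic.

Let mD0 : measurable D0. Proof. exact: measurable_itv. Qed.

Let mh : measurable_fun setT h. Proof. exact: nondecreasing_measurable. Qed.

Let mln : measurable_fun D0 (@ln R). Proof. exact: measurable_funTS. Qed.

Let measurable_smoothand y : measurable_fun D0 (fun b => h (y - ln b)).
Proof. by apply: (measurableT_comp (f := h)) => //; exact: measurable_funB. Qed.

Lemma integrable_gamma_smooth_bounded y :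
  mu.-integrable D0 (EFin \o (fun b => gamma_density a b * h (y - ln b))).
Proof. by apply: (@le_integrable_bounded _ M) => //; exact: integrable_gamma_density. Qed.

Let integrable_smoothand := integrable_gamma_smooth_bounded.

Lemma gamma_smooth_nondecreasing : {homo gamma_smooth a h : x y / x <= y}.
Proof.
move=> x y xy; apply: le_Rintegral => // b _.
by rewrite ler_wpM2l ?gamma_density_ge0// ndh// lerB.
Qed.

Lemma gamma_smooth_bounded y : 0 <= gamma_smooth a h y <= rGamma a * M.
Proof.

apply/andP; split.
  by apply: Rintegral_ge0 => b _; have /andP[h0 _] := hM (y - ln b);
    rewrite mulr_ge0 ?gamma_density_ge0.
rewrite -RintegralZr//; last exact: integrable_gamma_density.
apply: le_Rintegral => //.
  exact: (@integrableZr _ _ _ mu D0 mD0 M _ (integrable_gamma_density a0)).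
by move=> b _; have /andP[_ h1] := hM (y - ln b); rewrite ler_wpM2l ?gamma_density_ge0.
Qed.

(** Fubini, dominated by [M |g| |L|]: smoothing averages over translations of the argument of [h],
    so it passes under an integral over translates. *)
Lemma gamma_smooth_mixture D (L X : R -> R) y : measurable D ->
  mu.-integrable D (EFin \o L) -> measurable_fun D X ->
  gamma_smooth a (fun w => \int[mu]_(u in D) (L u * h (w - X u))) y =
  \int[mu]_(u in D) (L u * gamma_smooth a h (y - X u)).
Proof.
move=> mD iL mX.
pose g := gamma_density a \_ D0; pose LD := L \_ D; pose XD := X \_ D.
have gi : mu.-integrable setT (EFin \o g).
  rewrite /g -restrict_EFin; apply: (integrable_mkcond (mu := mu) _ mD0).1.
  exact: integrable_gamma_density.
have LDi : mu.-integrable setT (EFin \o LD).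
  by rewrite /LD -restrict_EFin; exact: (integrable_mkcond (mu := mu) _ mD).1.
have mXD : measurable_fun setT XD by exact: (measurable_restrictT X mD).1.
have mlnT : measurable_fun setT (@ln R : measurableTypeR R -> measurableTypeR R).
  exact: measurable_ln.
pose f (p : R * R) := (g p.1 * LD p.2) * h (y - ln p.1 - XD p.2).
have fi : (mu \x mu)%E.-integrable setT (EFin \o f).
  have iP := integrable_prod gi LDi.
  have := integrableZl (mu := (mu \x mu)%E) measurableT M iP.
  apply: le_integrable => //.
    apply/measurable_EFinP/measurable_funM.
      by apply/measurable_EFinP; exact: measurable_int iP.
    apply: (measurableT_comp (f := h)) => //; apply: measurable_funB; last first.
      exact: (measurableT_comp (f := XD)).
    by apply: measurable_funB => //; exact: (measurableT_comp (f := @ln R)).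
  move=> p _ /=; have /andP[h0 h1] := hM (y - ln p.1 - XD p.2).
  rewrite lee_fin /f normrM [leRHS]normrM mulrC.
  by rewrite ler_wpM2r// (ger0_norm h0) (ger0_norm (le_trans h0 h1)).
transitivity (\int[mu]_b \int[mu]_u f (b, u)).
  rewrite /gamma_smooth Rintegral_mkcond; apply: eq_Rintegral => b _.
  rewrite patchE; case: ifPn => bD; last first.
    rewrite (_ : (fun u => f (b, u)) = cst 0) ?Rintegral_cst// ?mul0r//.
    by apply/funext => u; rewrite /f /= /g patchE (negbTE bD) !mul0r.
  rewrite -RintegralZl//; last first.
    apply: (@le_integrable_bounded _ M) => //.
    by apply: (measurableT_comp (f := h)) => //; exact: measurable_funB.
  rewrite Rintegral_mkcond; apply: eq_Rintegral => u _.
  rewrite /f /g /LD /XD /= !patchE bD; case: ifPn => uD; last by rewrite mulr0 mul0r.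
  by rewrite mulrA.
rewrite (RFubini fi) [RHS]Rintegral_mkcond; apply: eq_Rintegral => u _.
rewrite patchE; case: ifPn => uD; last first.
  rewrite (_ : (fun b => f (b, u)) = cst 0) ?Rintegral_cst// ?mul0r//.
  by apply/funext => b; rewrite /f /= /LD patchE (negbTE uD) mulr0 mul0r.
rewrite -RintegralZl//.
rewrite [RHS]Rintegral_mkcond; apply: eq_Rintegral => b _.
rewrite /f /g /LD /XD /= !patchE uD; case: ifPn => bD; last by rewrite !mul0r.
by rewrite mulrCA mulrA addrAC.
Qed.

End GammaMixture.

(** * Substitution on an exhaustion by compact intervals *)

Section IncreasingSubstitution.
Context {R : realType}.
Notation mu := (@lebesgue_measure R).
Variables (D E : set (measurableTypeR R)) (F F' G : R -> R) (a b : nat -> R).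
Hypothesis ab : forall n, a n <= b n.
Hypothesis nda : {homo a : n m / (n <= m)%N >-> m <= n}.
Hypothesis ndb : {homo b : n m / (n <= m)%N >-> n <= m}.
Hypothesis DE : \bigcup_n `[a n, b n]%classic = D.
Hypothesis EE : \bigcup_n `[F (a n), F (b n)]%classic = E.
Hypothesis ltF : {homo F : x y / x < y}.
Hypothesis F'0 : forall x, 0 <= F' x.
Hypothesis dF : forall x : R, is_derive x 1 F (F' x).
Hypothesis cF' : continuous F'.
Hypothesis cG : forall x, E x -> {for x, continuous G}.
Hypothesis G0 : forall x, E x -> 0 <= G x.

(** Substitution on each compact interval, then monotone convergence on both sides. The identity is
    between extended integrals, so that finiteness of one side can be deduced from the other. *)
Lemma ge0_integration_by_substitution_exhaustion :
  (\int[mu]_(x in E) (G x)%:E = \int[mu]_(x in D) (G (F x) * F' x)%:E)%E.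
Proof.
have leF : {homo F : x y / x <= y} by apply: ltW_homo.
have cF x : {for x, continuous F}.
  by apply/differentiable_continuous/derivable1_diffP; exact: ex_derive.
have F'E : (F : R -> R^o)^`()%classic = F'.
  by apply/funext => x; rewrite derive1E; exact: derive_val.
pose A n : set (measurableTypeR R) := `[a n, b n]%classic.
pose B n : set (measurableTypeR R) := `[F (a n), F (b n)]%classic.
have mA n : measurable (A n) by exact: measurable_itv.
have mB n : measurable (B n) by exact: measurable_itv.
have AD n : A n `<=` D by move=> x Anx; rewrite -DE; exists n.
have BE n : B n `<=` E by move=> x Bnx; rewrite -EE; exists n.
have AB n x : A n x -> B n (F x).
  by rewrite /A /B /= !in_itv /= => /andP[ax xb]; rewrite !leF.
have nd (c d : nat -> R) : {homo c : n m / (n <= m)%N >-> m <= n} ->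
    {homo d : n m / (n <= m)%N >-> n <= m} ->
    {homo (fun n => `[c n, d n]%classic : set (measurableTypeR R)) :
      n m / (n <= m)%N >-> (n <= m)%O}.
  move=> ndc ndd n m nm; apply/subsetPset => x; rewrite /= !in_itv /= => /andP[cx xd].
  by rewrite (le_trans (ndc _ _ nm) cx) (le_trans xd (ndd _ _ nm)).
have cGF x : D x -> {for x, continuous (fun x => G (F x) * F' x)}.
  move=> Dx; apply: cvgM; last exact: cF'.
  apply: (cvg_comp F G); first exact: cF.
  by apply: cG; move: Dx; rewrite -DE -EE => -[n _ Anx]; exists n => //; exact: AB.
have meas (K : set (measurableTypeR R)) (f : R -> R) : measurable K ->
    (forall x, K x -> {for x, continuous f}) -> measurable_fun K (EFin \o f).
  move=> mK cf; apply/measurable_EFinP; apply: subspace_continuous_measurable_fun => //.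
  by apply: continuous_in_subspaceT => x; rewrite inE => /cf; exact.
have e n : (\int[mu]_(x in B n) (G x)%:E = \int[mu]_(x in A n) (G (F x) * F' x)%:E)%E.
  rewrite integration_by_substitution_increasing ?F'E//.
  - by move=> x y _ _; exact: ltF.
  - by apply/cvg_ex; exists (F' (a n)); apply: cvg_at_right_filter; exact: cF'.
  - by apply/cvg_ex; exists (F' (b n)); apply: cvg_at_left_filter; exact: cF'.
  - split; first by move=> x _; exact: ex_derive.
      by apply: cvg_at_right_filter; exact: cF.
    by apply: cvg_at_left_filter; exact: cF.
  - by apply: continuous_in_subspaceT => x; rewrite inE => /BE /cG; exact.
have H1 := @ge0_nondecreasing_set_cvg_integral _ _ _ A
  (fun x => (G (F x) * F' x)%:E) mu (nd _ _ nda ndb) mA.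
have nFa : {homo F \o a : n m / (n <= m)%N >-> m <= n} by move=> n m nm; exact/leF/nda.
have nFb : {homo F \o b : n m / (n <= m)%N >-> n <= m} by move=> n m nm; exact/leF/ndb.
have H2 := @ge0_nondecreasing_set_cvg_integral _ _ _ B (EFin \o G) mu (nd _ _ nFa nFb) mB.
rewrite -[in LHS]EE -[in RHS]DE.
apply: (@cvg_unique _ _ _ _ _ _ (H2 _ _)) => //.
- by move=> n; apply: meas => // x /BE /cG; exact.
- by move=> n x /BE /G0; rewrite lee_fin.
rewrite (_ : (fun n => _) = (fun n => \int[mu]_(x in A n) (G (F x) * F' x)%:E)%E); last first.
  by apply/funext => n; exact: e.
apply: H1.
- by move=> n; apply: meas => // x /AD /cGF; exact.
- move=> n x Anx; rewrite lee_fin mulr_ge0//; apply: G0; apply: (BE n); exact: AB.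
Qed.

End IncreasingSubstitution.

(** * The Gamma-Gamma density as a mixture of Gamma densities *)

Section GammaGamma.
Context {R : realType}.
Notation mu := (@lebesgue_measure R).

Lemma ge0_integralT_fold (g : R -> R) : continuous g -> (forall x, 0 <= g x) ->
  (\int[mu]_x (g x)%:E = \int[mu]_(x in `]0%R, +oo[) (g x + g (- x))%:E)%E.
Proof.
move=> cg g0.
have mg : measurable_fun setT (EFin \o g).
  by apply/measurable_EFinP; exact: continuous_measurable_fun.
have cgN : continuous (g \o -%R).
  by move=> x; apply: (cvg_comp -%R g); [exact: opp_continuous|exact: cg].
have mgN : measurable_fun setT (EFin \o (g \o -%R)).
  by apply/measurable_EFinP; exact: continuous_measurable_fun.
have mI (i : interval R) : measurable ([set` i] : set (measurableTypeR R)).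
  exact: measurable_itv.
have -> : [set: R] = (`]-oo, 0%R] `|` `]0%R, +oo[)%classic.
  by apply/seteqP; split => x //= _; rewrite !in_itv /= andbT;
    case: (ltP 0 x) => x0; [right|left].
rewrite ge0_integral_setU//; last 3 first.
- exact: measurable_funTS mg.
- by move=> x _; rewrite lee_fin.
- apply/disj_setPLR => x /=; rewrite !in_itv /= andbT => x0; apply/negP.
  by rewrite -leNgt.
have := @ge0_integration_by_substitutionNy R g 0.
rewrite oppr0 => ->; last 2 first.
- by apply: continuous_in_subspaceT => x _; exact: cg.
- by move=> x _; exact: g0.
rewrite -integral_itv_obnd_cbnd; last exact: measurable_funTS mgN.
rewrite -ge0_integralD//.
- by apply: eq_integral => x _; rewrite addeC.
- by move=> x _ /=; rewrite lee_fin.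
- exact: measurable_funTS mgN.
- by move=> x _ /=; rewrite lee_fin.
- exact: measurable_funTS mg.
Qed.

Lemma continuous_gamma_density (a x : R) : 0 < x -> {for x, continuous (gamma_density a)}.
Proof.
move=> x0; apply: cvgM.
  have /derivable1_diffP/differentiable_continuous : derivable (fun t => t `^ (a - 1)) x 1.
    by apply: derivable_powR; rewrite in_itv /= andbT.
  exact.
apply: (cvg_comp (@GRing.opp R) expR); first exact: opp_continuous.
exact: continuous_expR.
Qed.

(** The function [u^b e^(-u)] is maximal at [u = b], by [ln r <= r - 1] at [r = u / b]. *)
Lemma powR_mul_expRN_le (b u : R) : 0 < b -> 0 < u ->
  expR (b * ln u - u) <= expR (b * ln b - b).
Proof.
move=> b0 u0; rewrite ler_expR.
have : ln (u / b) <= u / b - 1.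
  have -> : u / b = 1 + (u / b - 1) by rewrite addrCA subrr addr0.
  rewrite (le_trans (le_ln1Dx _))//; last by rewrite addrAC subrr add0r.
  by rewrite ltrBrDr addrC subrr divr_gt0.
rewrite ln_div ?posrE// -(ler_pM2l b0) mulrBr mulrBr mulrCA divff ?gt_eqF// !mulr1.
lra.
Qed.

Variables (al be : R).
Hypotheses (al0 : 0 < al) (be0 : 0 < be).

Let D : set (measurableTypeR R) := `]0, +oo[%classic.

(** The unnormalised joint density of [a] and [x = a b / (al be)] for independent Gamma variables
    [a] and [b]; the factor [al * be / a] is the derivative of [b] with respect to [x]. *)
Definition gamma_gamma_kernel (a x : R) : R :=
  gamma_density al a * (gamma_density be (al * be * x / a) * (al * be / a)).

Let mD : measurable D. Proof. exact: measurable_itv. Qed.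

Let D_gt0 a : D a -> 0 < a.
Proof. by rewrite /D /= in_itv /= andbT. Qed.

Lemma gamma_gamma_kernel_ge0 a x : 0 < a -> 0 <= gamma_gamma_kernel a x.
Proof.
move=> a0; rewrite mulr_ge0 ?gamma_density_ge0// mulr_ge0 ?gamma_density_ge0//.
by rewrite divr_ge0 ?(ltW a0)// mulr_ge0 ?(ltW al0) ?(ltW be0).
Qed.

Lemma continuous_gamma_gamma_kernel x a : 0 < x -> 0 < a ->
  {for a, continuous (gamma_gamma_kernel ^~ x)}.
Proof.
move=> x0 a0.
have Y0 : 0 < al * be * x by rewrite !mulr_gt0.
have ci (y : R) : {for a, continuous (fun a : R => y / a)}.
  by apply: cvgM; [exact: cvg_cst|apply: cvgV => //; rewrite gt_eqF].
apply: cvgM; first exact: continuous_gamma_density.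
apply: cvgM; last exact: ci.
apply: (cvg_comp (fun a => al * be * x / a) (gamma_density be)); first exact: ci.
by apply: continuous_gamma_density; rewrite divr_gt0.
Qed.

Lemma integrable_gamma_gamma_kernel x : 0 < x ->
  mu.-integrable D (EFin \o gamma_gamma_kernel ^~ x).
Proof.
(* With [u = al be x / a] the factor beside [gamma_density al a] is [u^be e^(-u) / x], and [C] is
   its maximum. *)
move=> x0; pose C := expR (be * ln be - be) / x.
have := integrableZl (mu := mu) mD C (integrable_gamma_density al0).
apply: le_integrable => //.
  apply/measurable_EFinP; apply: subspace_continuous_measurable_fun => //.
  apply: continuous_in_subspaceT => a; rewrite inE => /D_gt0.
  exact: continuous_gamma_gamma_kernel.
move=> a /D_gt0 a0 /=; rewrite lee_fin ger0_norm ?gamma_gamma_kernel_ge0//.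
have C0 : 0 <= C by rewrite divr_ge0 ?expR_ge0 ?ltW.
rewrite ger0_norm; last by rewrite mulr_ge0 ?gamma_density_ge0.
rewrite [C * _]mulrC; apply: ler_wpM2l; first exact: gamma_density_ge0.
set u := al * be * x / a.
have u0 : 0 < u by rewrite /u divr_gt0// !mulr_gt0.
have -> : al * be / a = expR (ln u) / x by rewrite lnK ?posrE// /u; field; rewrite !gt_eqF.
rewrite gamma_densityE// mulrA -expRD /C ler_pM2r ?invr_gt0//.
have -> : (be - 1) * ln u - u + ln u = be * ln u - u by ring.
exact: powR_mul_expRN_le.
Qed.

(** With [a = s e^r] and [s = sqrt(al be x)] the sum [a + al be x / a] becomes [2 s cosh r], which
    is even in [r]; folding the line at 0 then turns [e^((al - be) r)] into a hyperbolic cosine. *)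
Lemma gamma_gamma_kernel_besselK x : 0 < x ->
  (\int[mu]_(a in D) (gamma_gamma_kernel a x)%:E =
   (2 * (al * be) `^ ((al + be) / 2) * x `^ ((al + be) / 2 - 1) *
     besselK (al - be) (2 * Num.sqrt (al * be * x)))%:E)%E.
Proof.
move=> x0; set Y := al * be * x.
have Y0 : 0 < Y by rewrite !mulr_gt0.
set s := Num.sqrt Y; have s0 : 0 < s by rewrite sqrtr_gt0.
pose C := (al * be) `^ ((al + be) / 2) * x `^ ((al + be) / 2 - 1).
pose g r := expR (- (2 * s * ((expR r + expR (- r)) / 2))) * expR ((al - be) * r).
have KE r : gamma_gamma_kernel (s * expR r) x * (s * expR r) = C * g r.
  have e0 : 0 < s * expR r by rewrite mulr_gt0 ?expR_gt0.
  rewrite /gamma_gamma_kernel -/Y.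
  have sY : Y = s * s by rewrite -expr2 sqr_sqrtr// ltW.
  have ab0 : 0 < al * be by rewrite mulr_gt0.
  have -> : Y / (s * expR r) = s * expR (- r).
    by rewrite expRN sY; field; rewrite !gt_eqF// expR_gt0.
  have lns : ln s = (ln (al * be) + ln x) / 2.
    have : ln Y = ln s + ln s by rewrite sY lnM.
    by rewrite /Y lnM ?posrE// => ->; field.
  rewrite !gamma_densityE// ?mulr_gt0 ?expR_gt0//.
  rewrite !lnM ?posrE ?expR_gt0// !expRK.
  have e1 (u v w : R) : w != 0 -> u * (v * (al * be / w)) * w = al * be * (u * v).
    by move=> w0; field.
  rewrite e1 ?gt_eqF//.
  rewrite -[X in X * _ = _]lnK ?posrE// /C /g /powR !gt_eqF//= -!expRD.
  by congr expR; rewrite lns; field.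
have cse : continuous (fun r => s * expR r).
  by move=> r; apply: cvgM; [exact: cvg_cst|exact: continuous_expR].
have cexp (K : R) : continuous (fun r : R => expR (K * r)).
  move=> r; apply: (cvg_comp (fun r => K * r) expR); last exact: continuous_expR.
  by apply: cvgM; [exact: cvg_cst|exact: cvg_id].
have cg : continuous g.
  move=> r; apply: cvgM; last exact: cexp.
  apply: (cvg_comp _ expR); last exact: continuous_expR.
  apply: cvgN; apply: cvgM; first exact: cvg_cst.
  apply: cvgM; last exact: cvg_cst.
  apply: cvgD; first exact: continuous_expR.
  by apply: (cvg_comp -%R expR); [exact: opp_continuous|exact: continuous_expR].
have g0 r : 0 <= g r by rewrite mulr_ge0 ?expR_ge0.
have C0 : 0 < C by rewrite mulr_gt0 ?powR_gt0// mulr_gt0.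
pose ch (y : R) := (expR y + expR (- y)) / 2.
pose f t := expR (- (2 * s * ch t)) * ch ((al - be) * t).
have f0 t : 0 <= f t by rewrite mulr_ge0 ?expR_ge0// divr_ge0// addr_ge0 ?expR_ge0.
have fE t : g t + g (- t) = 2 * f t.
  rewrite /g /f /ch opprK mulrN [expR (- t) + _]addrC; set e := expR (- (2 * s * _)).
  by field.
have mf : measurable_fun setT (EFin \o f).
  rewrite (_ : f = fun t => 2^-1 * (g t + g (- t))); last by apply/funext => t; rewrite fE mulKf.
  have mg : measurable_fun setT g by exact: continuous_measurable_fun.
  apply/measurable_EFinP/measurable_funM => //; apply: measurable_funD => //.
  by apply: (measurableT_comp (f := g)) => //; exact: measurable_funN.
have I : (\int[mu]_(a in D) (gamma_gamma_kernel a x)%:E =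
    (2 * C)%:E * \int[mu]_(t in `]0%R, +oo[) (f t)%:E)%E.
  transitivity (\int[mu]_r (C%:E * (g r)%:E))%E; last first.
    rewrite ge0_integralZl//; last 3 first.
    + by apply/measurable_EFinP; exact: continuous_measurable_fun.
    + by move=> r _; rewrite lee_fin.
    + by rewrite lee_fin ltW.
    rewrite (ge0_integralT_fold cg g0); under eq_integral do rewrite fE EFinM.
    rewrite ge0_integralZl//; last 2 first.
    + exact: measurable_funTS.
    + by move=> r _; rewrite lee_fin.
    by rewrite muleA -EFinM [C * 2]mulrC.
  under [RHS]eq_integral do rewrite -EFinM -KE.
  apply: (@ge0_integration_by_substitution_exhaustion _ setT D (fun r => s * expR r)
  (fun r => s * expR r) (gamma_gamma_kernel ^~ x) (fun n => - n.+1%:R) (fun n => n.+1%:R)).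
  + by move=> n; rewrite ge0_cp.
  + by move=> n m nm; rewrite lerN2 ler_nat ltnS.
  + by move=> n m nm; rewrite ler_nat ltnS.
  + apply/seteqP; split => // r _; have [n rn] := ge1_expR_natS `|r|.
    by exists n => //=; rewrite in_itv /= -ler_norml.
  + apply/seteqP; split => a.
      move=> [n _ /=]; rewrite in_itv /= => /andP[+ _].
      by rewrite /D /= in_itv /= andbT; apply: lt_le_trans; rewrite mulr_gt0 ?expR_gt0.
    move=> /D_gt0 a0; have := @exhaust_oy R; move=> /seteqP[_] /(_ (a / s)).
    rewrite /= in_itv /= andbT divr_gt0// => /(_ isT)[n _ /=].
    rewrite in_itv /= ler_pdivlMr// ler_pdivrMr// => an; exists n => //=.
    by rewrite in_itv /= ![s * _]mulrC.
  + by move=> u v uv; rewrite ltr_pM2l// ltr_expR.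
  + by move=> r; rewrite mulr_ge0 ?expR_ge0// ltW.
  + exact: cse.
  + by move=> a /D_gt0; exact: continuous_gamma_gamma_kernel.
  + by move=> a /D_gt0; exact: gamma_gamma_kernel_ge0.
have Ifin := integrable_fin_num mD (integrable_gamma_gamma_kernel x0).
(* [besselK] is the [fine] of an integral, so finiteness must be known; it is inherited from the
   integrable kernel through [I]. *)
have ffin : (\int[mu]_(t in `]0%R, +oo[) (f t)%:E)%E \is a fin_num.
  have : (0 <= \int[mu]_(t in `]0%R, +oo[) (f t)%:E)%E.
    by apply: integral_ge0 => t _; rewrite lee_fin.
  move: Ifin; rewrite I; case: (\int[mu]_(t in _) _)%E => // + _.
  by rewrite gt0_muley// lte_fin mulr_gt0.
rewrite I -(fineK ffin) -EFinM; congr (_%:E).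
by rewrite /C -!mulrA.
Qed.

Let gd := @gamma_density R.

(** The inequality is strict to match [ln (u / A) < y] in [log_power_cdf]. *)
Definition heaviside (r : R) : R := (0 < r)%R%:R.

Lemma heaviside_bounded r : 0 <= heaviside r <= 1.
Proof. by rewrite /heaviside ler0n lern1 leq_b1. Qed.

Lemma heaviside_nondecreasing : {homo heaviside : x y / x <= y}.
Proof.
move=> x y xy; rewrite /heaviside ler_nat; case: (ltP 0 x) => // x0.
by rewrite (lt_le_trans x0 xy).
Qed.

(** Smoothing the step function gives the lower incomplete Gamma function at [e^r], that is, the
    Gamma distribution function up to the factor [Gamma(be)]. *)
Lemma gamma_smooth_heaviside r :
  (gamma_smooth be heaviside r)%:E = (\int[mu]_(b in `]0%R, expR r]) (gd be b)%:E)%E.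
Proof.
have bi := integrable_gamma_smooth_bounded be0 heaviside_nondecreasing heaviside_bounded r.
rewrite /gamma_smooth /Rintegral fineK; last exact: (integrable_fin_num mD bi).
rewrite -integral_itv_bndo_bndc; last first.
  by apply/measurable_EFinP/measurable_funTS; exact: measurable_gamma_density.
rewrite integral_mkcond [RHS]integral_mkcond; apply: eq_integral => b _.
rewrite !patchE !mem_setE !in_itv /= andbT; case: (ltP 0 b) => //= b0.
rewrite /heaviside subr_gt0 -ltr_expR lnK ?posrE//.
by case: ltP => _; rewrite ?mulr1 ?mulr0.
Qed.

Lemma integral_gamma_gamma_kernel_r a t : 0 < a -> 0 < t ->
  (\int[mu]_(x in `]0%R, t]) (gamma_gamma_kernel a x)%:E =
   (gd al a * gamma_smooth be heaviside (ln (al * be * t) - ln a))%:E)%E.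
Proof.
move=> a0 t0; have l0 : 0 < al * be / a by rewrite divr_gt0// mulr_gt0.
have lt0 : 0 < al * be * t / a by rewrite divr_gt0// !mulr_gt0.
rewrite EFinM gamma_smooth_heaviside -ln_div ?posrE ?mulr_gt0// lnK ?posrE//.
have mgd (E : set (measurableTypeR R)) : measurable_fun E (EFin \o gd be).
  by apply/measurable_EFinP/measurable_funTS; exact: measurable_gamma_density.
have dl : forall x : R, is_derive x 1 (fun x : R => al * be / a * x) (al * be / a).
  move=> x; rewrite -[X in is_derive _ _ _ X](mulr1 (al * be / a)).
  exact: (@is_deriveZ R R^o R^o id (al * be / a) x 1 1).
rewrite (@ge0_integration_by_substitution_exhaustion _ `]0, t]%classic
  `]0, al * be * t / a]%classic (fun x => al * be / a * x) (fun=> al * be / a) (gd be)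
  (fun n => t * expR (- n.+1%:R)) (fun=> t)).
- rewrite -ge0_integralZl.
  + apply: eq_integral => x _; rewrite /gamma_gamma_kernel -EFinM.
    by congr ((_ * (gd be _ * _))%:E); rewrite mulrAC.
  + exact: measurable_itv.
  + apply/measurable_EFinP/measurable_funM; last exact: measurable_cst.
    apply: (measurableT_comp (f := gd be)); first exact: measurable_gamma_density.
    exact: measurable_funM.
  + by move=> x _; rewrite lee_fin mulr_ge0 ?gamma_density_ge0// ltW.
  + by rewrite lee_fin gamma_density_ge0.
- move=> n; rewrite ler_piMr ?(ltW t0)// -expR0 ler_expR oppr_le0 ler0n//.
- by move=> n m nm; rewrite ler_pM2l// ler_expR lerN2 ler_nat ltnS.
- by [].
- exact: exhaust_oc.
- rewrite -[al * be * t / a]mulrAC -(exhaust_oc (mulr_gt0 l0 t0)).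
  by apply: eq_bigcup => // n _; rewrite mulrA.
- by move=> x y xy; rewrite (ltr_pM2l l0).
- by move=> x; exact: ltW.
- by move=> x; exact: cvg_cst.
- move=> x; rewrite /= in_itv /= => /andP[x0 _]; exact: continuous_gamma_density.
- by move=> x _; exact: gamma_density_ge0.
Qed.

(** Tonelli on the kernel over [0 < x <= t] and [a > 0]. Integrating over [a] first gives the Bessel
    density; integrating over [x] first gives an incomplete Gamma function, whose integral against
    the density of [a] is the second smoothing. *)
Lemma gamma_gamma_cdf t : 0 < t ->
  (\int[mu]_(x in `]-oo, t]) (gamma_gamma_density al be x)%:E =
   (gamma_smooth al (gamma_smooth be heaviside) (ln (al * be * t)) /
     (rGamma al * rGamma be))%:E)%E.
Proof.
move=> t0; pose c := (rGamma al * rGamma be)^-1.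
have c0 : 0 < c by rewrite invr_gt0 mulr_gt0// rGamma_gt0.
pose B : set (measurableTypeR R) := `]0, t]%classic.
have mB : measurable B by exact: measurable_itv.
pose f (p : measurableTypeR R * measurableTypeR R) : R := \1_B p.1 * \1_D p.2 * gamma_gamma_kernel p.2 p.1.
have f0 p : 0 <= f p.
  rewrite /f !indicE; case: (boolP (p.2 \in D)) => [|_]; last by rewrite mulr0 mul0r.
  by rewrite inE => /D_gt0 a0; rewrite mulr_ge0// gamma_gamma_kernel_ge0.
have mK : measurable_fun setT
    (fun p : measurableTypeR R * measurableTypeR R => gamma_gamma_kernel p.2 p.1).
  apply: measurable_funM.
    by apply: (measurableT_comp (f := gd al)) => //; exact: measurable_gamma_density.
  have mi : measurable_fun setT (fun p : measurableTypeR R * measurableTypeR R => p.2^-1).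
    by apply: (measurableT_comp (f := @GRing.inv R)) => //; exact: measurable_invr.
  apply: measurable_funM; last by apply: measurable_funM.
  apply: (measurableT_comp (f := gd be)); first exact: measurable_gamma_density.
  by apply: measurable_funM => //; apply: measurable_funM.
have mf : measurable_fun setT (EFin \o f).
  apply/measurable_EFinP/measurable_funM => //.
  apply: measurable_funM.
    by apply: (measurableT_comp (f := \1_B : R -> R)).
  by apply: (measurableT_comp (f := \1_D : R -> R)).
transitivity (c%:E * \int[mu]_x \int[mu]_a (f (x, a))%:E)%E.
  rewrite -ge0_integralZl//; last 3 first.
  - exact: (measurable_fun_fubini_tonelli_F (EFin \o f)).
  - by move=> x _; apply: integral_ge0 => a _; rewrite lee_fin.
  - by rewrite lee_fin ltW.
  rewrite [LHS]integral_mkcond; apply: eq_integral => x _.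
  have -> : (\int[mu]_a (f (x, a))%:E = (\1_B x)%:E * \int[mu]_(a in D) (gamma_gamma_kernel a x)%:E)%E.
    rewrite -ge0_integralZl.
    + rewrite [RHS]integral_mkcond; apply: eq_integral => a _.
      rewrite patchE /f /= [\1_D _]indicE; case: (a \in D); last by rewrite mulr0 mul0r.
      by rewrite mulr1 EFinM.
    + exact: mD.
    + apply/measurable_EFinP/measurable_funTS.
      exact: (measurableT_comp mK (measurable_pair1 x)).
    + by move=> a /D_gt0 a0; rewrite lee_fin gamma_gamma_kernel_ge0.
    + by rewrite lee_fin.
  rewrite patchE mem_setE in_itv /= indicE mem_setE in_itv /= /gamma_gamma_density.
  case: (ltP 0 x) => x0; last by rewrite mul0e mule0; case: ifP.
  case: (leP x t) => xt; last by rewrite mul0e mule0.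
  rewrite mul1e gamma_gamma_kernel_besselK// -EFinM; congr (_%:E).
  by rewrite /c; set K := besselK _ _; ring.
rewrite (fubini_tonelli (EFin \o f))//.
have nW := gamma_smooth_nondecreasing be0 heaviside_nondecreasing heaviside_bounded.
have bW := gamma_smooth_bounded be0 heaviside_nondecreasing heaviside_bounded.
have iW := integrable_gamma_smooth_bounded al0 nW bW (ln (al * be * t)).
rewrite [in RHS]mulrC [in RHS]EFinM; congr (_ * _)%E.
rewrite /gamma_smooth /Rintegral fineK; last exact: (integrable_fin_num mD iW).
rewrite [RHS]integral_mkcond; apply: eq_integral => a _.
rewrite patchE; case: ifPn => aD; last first.
  rewrite integral0_eq// => x _.
  by rewrite /= /f [\1_D _]indicE (negbTE aD) mulr0 mul0r.
move: (aD); rewrite inE => /D_gt0 a0.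
rewrite -integral_gamma_gamma_kernel_r// [RHS]integral_mkcond; apply: eq_integral => x _.
rewrite patchE /= /f /= indicE [\1_D _]indicE aD mulr1.
by case: ifP => _; rewrite ?mul1r ?mul0r.
Qed.

End GammaGamma.

(** * Products of independent variables *)

Section ProductOfIndependent.
Context {d : measure_display} {T : measurableType d} {R : realType}.
Variable P : probability T R.
Notation mu := (@lebesgue_measure R).

(** The given density agrees almost everywhere with the Radon-Nikodym derivative of the law, since
    both have the same integrals over measurable sets. *)
Lemma distribution_integral (X : {mfun T >-> measurableTypeR R}) (f : R -> R)
    (g : measurableTypeR R -> \bar R) :
  (forall A : set (measurableTypeR R), measurable A ->
     P (X @^-1` A) = (\int[mu]_(x in A) (f x)%:E)%E) ->
  measurable_fun setT f ->
  measurable_fun setT g -> (forall x, 0 <= g x)%E ->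
  (\int[distribution P X]_x g x = \int[mu]_x (g x * (f x)%:E))%E.
Proof.
move=> Xf mf mg g0; pose nu := distribution P X.
have numu : nu `<< mu.
  apply/null_content_dominatesP => A mA A0.
  by rewrite [LHS]Xf//; apply: null_set_integral => //; apply/measurable_EFinP/measurable_funTS.
have mEf : measurable_fun setT (EFin \o f) by exact/measurable_EFinP.
have mrn := measurable_int _ (Radon_Nikodym_SigmaFinite.f_integrable numu).
rewrite -(Radon_Nikodym_SigmaFinite.change_of_variables numu g0 measurableT mg).
apply: ae_eq_integral => //; [exact: emeasurable_funM|exact: emeasurable_funM|].
apply: ae_eqe_mul2l; apply: integral_ae_eq => //.
- exact: Radon_Nikodym_SigmaFinite.f_integrable.
- by move=> A _ mA; rewrite -Radon_Nikodym_SigmaFinite.f_integral// [LHS]Xf.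
Qed.

Variables X Y : {mfun T >-> measurableTypeR R}.
Hypothesis XY : forall A B : set (measurableTypeR R), measurable A -> measurable B ->
  P (X @^-1` A `&` Y @^-1` B) = (P (X @^-1` A) * P (Y @^-1` B))%E.

(** Independence identifies the joint law with the product measure on rectangles, hence everywhere
    by uniqueness. [Y] comes first in the pair so that sections are taken at a fixed value of
    [Y]. *)
Lemma independent_distribution_prod (S : set (measurableTypeR R * measurableTypeR R)) :
  measurable S ->
  P [set t | S (Y t, X t)] =
  (\int[distribution P Y]_y distribution P X (xsection S y))%E.
Proof.
move=> mS; pose j t := (Y t, X t).
have mj : measurable_fun setT j by exact: measurable_fun_pair.
pose jf : {mfun T >-> (measurableTypeR R * measurableTypeR R)%type} :=
  HB.pack j (isMeasurableFun.Build _ _ _ _ j mj).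
apply/esym; apply: (@product_measure_unique _ _ _ _ R (distribution P Y)
  (distribution P X) (distribution P jf) _ S mS) => A B mA mB.
rewrite -[LHS]/(P (j @^-1` (A `*` B))) -[RHS]/(P (Y @^-1` A) * P (X @^-1` B))%E.
by rewrite muleC -XY//; congr (P _); apply/seteqP; split => t [].
Qed.

End ProductOfIndependent.

Section CdfProduct.
Context {d : measure_display} {T : measurableType d} {R : realType}.
Variable P : probability T R.
Notation mu := (@lebesgue_measure R).
Variables X Y : {mfun T >-> measurableTypeR R}.
Hypothesis XY : forall A B : set (measurableTypeR R), measurable A -> measurable B ->
  P (X @^-1` A `&` Y @^-1` B) = (P (X @^-1` A) * P (Y @^-1` B))%E.
Variables (fX fY F : R -> R) (A0 hl : R).
Hypothesis hl0 : 0 < hl.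
Hypothesis X_density : forall A : set (measurableTypeR R), measurable A ->
  P (X @^-1` A) = (\int[mu]_(x in A) (fX x)%:E)%E.
Hypothesis Y_density : forall A : set (measurableTypeR R), measurable A ->
  P (Y @^-1` A) = (\int[mu]_(x in A) (fY x)%:E)%E.
Hypothesis mfY : measurable_fun setT fY.
Hypothesis fY_supp : forall u, ~~ (0 < u <= A0) -> fY u = 0.
Hypothesis XF : forall t, 0 < t -> P [set w | X w <= t] = (F t)%:E.

Let S (B : set (measurableTypeR R)) : set (measurableTypeR R * measurableTypeR R) :=
  [set p | B (hl * p.2 * p.1)].

Let mS B : measurable B -> measurable (S B).
Proof.
have mh : measurable_fun setT
    (fun p : measurableTypeR R * measurableTypeR R => hl * p.2 * p.1).
  by apply: measurable_funM => //; exact: measurable_funM.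
by move=> mB; have := mh measurableT _ mB; rewrite setTI.
Qed.

Lemma cdf_mul_independent x : 0 < x ->
  P [set t | hl * X t * Y t <= x] =
  (\int[mu]_(u in `]0%R, A0]) (fY u * F (x / (hl * u)))%:E)%E.
Proof.
move=> x0; have mB : measurable (`]-oo, x]%classic : set (measurableTypeR R)).
  exact: measurable_itv.
rewrite (_ : [set t | _] = [set t | S `]-oo, x]%classic (Y t, X t)]); last first.
  by apply/seteqP; split => t; rewrite /S /= in_itv.
rewrite (independent_distribution_prod XY (mS mB)).
rewrite (distribution_integral Y_density mfY)//; last first.
  by apply: measurable_fun_xsection; exact: mS.
rewrite [RHS]integral_mkcond; apply: eq_integral => u _.
rewrite patchE mem_setE in_itv /=; case: ifPn => [/andP[u0 uA]|/fY_supp ->]; last by rewrite mule0.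
rewrite muleC EFinM -XF ?divr_gt0 ?mulr_gt0//; congr (_ * _)%E.
rewrite /distribution /pushforward; congr (P _); apply/seteqP; split => t.
  rewrite /= /xsection /= inE /S /= in_itv /= => h.
  by rewrite ler_pdivlMr ?mulr_gt0// mulrCA mulrA.
by rewrite /= /xsection /= inE /S /= in_itv /= ler_pdivlMr ?mulr_gt0// mulrCA mulrA.
Qed.

(** Given [Y = u] with [u != 0], exactly one value of [X] makes the product equal to [x], and a law
    with a density charges no point; given [u = 0] there is none, because [x != 0]. *)
Lemma mul_independent_atom x : x != 0 -> P [set t | hl * X t * Y t = x] = 0%E.
Proof.
move=> x0; have mB : measurable ([set x] : set (measurableTypeR R)).
  exact: measurable_set1.
rewrite (_ : [set t | _] = [set t | S [set x] (Y t, X t)])//.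
rewrite (independent_distribution_prod XY (mS mB)).
apply: integral0_eq => u _; rewrite /distribution /pushforward.
have [->|u0] := eqVneq u 0.
  rewrite (_ : _ @^-1` _ = set0) ?measure0//; apply/seteqP; split => t //=.
  by rewrite /xsection /= inE /S /= mulr0 => e; rewrite -e eqxx in x0.
rewrite (_ : _ @^-1` _ = X @^-1` [set x / (hl * u)]).
  by rewrite X_density; [rewrite integral_set1|exact: measurable_set1].
apply/seteqP; split => t; rewrite /= /xsection /= inE /S /=.
  by move=> <-; field; rewrite u0 gt_eqF.
by move=> ->; field; rewrite u0 gt_eqF.
Qed.

End CdfProduct.

(** * The pointing-error density as a series *)

Section PointingErrors.
Context {R : realType}.
Notation mu := (@lebesgue_measure R).

(** Since [k! >= 1], the exponential series of [(x / 2)^2] dominates. *)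
Lemma cvg_besselI0 (x : R) :
  series (fun k : nat => (x / 2) ^+ (2 * k) / (k`!)%:R ^+ 2) @ \oo --> besselI0 x.
Proof.
apply: (@series_le_cvg _ _ (exp_coeff ((x / 2) ^+ 2))).
- move=> k; apply: divr_ge0; last exact: exprn_ge0.
  by rewrite exprM exprn_ge0// sqr_ge0.
- by move=> k; rewrite /exp_coeff; apply: divr_ge0 => //; exact/exprn_ge0/sqr_ge0.
- move=> k; rewrite /exp_coeff /= exprM; apply: ler_wpM2l; first exact/exprn_ge0/sqr_ge0.
  have f0 : 0 < k`!%:R :> R by rewrite ltr0n fact_gt0.
  have f2 : 0 < (k`!%:R : R) ^+ 2 by rewrite expr2 mulr_gt0.
  rewrite lef_pV2 ?posrE//.
  by rewrite expr2 ler_peMl ?ler0n// ler1n fact_gt0.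
- exact: is_cvg_series_exp_coeff.
Qed.

Variables (A0 omega q : R).
Hypotheses (A00 : 0 < A0) (omega0 : 0 < omega) (q0 : 0 < q).

Let c := (1 + q ^+ 2) * omega / (2 * q).
Let v := (1 - q ^+ 2) * omega / (2 * q).

Definition pointing_error_term (k : nat) (u : R) : R :=
  'C(2 * k, k)%:R * (v / 2) ^+ (2 * k) * log_power A0 (2 * k) c u.

Lemma pointing_error_term_ge0 k u : 0 < u <= A0 -> 0 <= pointing_error_term k u.
Proof.
move=> uA; apply: mulr_ge0; last by apply: log_power_ge0 => //; rewrite /= in_itv.
by rewrite mulr_ge0 ?ler0n// exprM exprn_ge0// sqr_ge0.
Qed.

Lemma cvg_pointing_error_density u : 0 < u <= A0 ->
  (fun n => omega * \sum_(0 <= k < n) pointing_error_term k u) @ \oo -->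
  pointing_error_density A0 omega q u.
Proof.
move=> uA; have /andP[u0 _] := uA; rewrite /pointing_error_density uA -/c -/v.
set y := - (v * ln (u / A0)).
have -> : omega / A0 * (u / A0) `^ (c - 1) * besselI0 y =
    omega * (u^-1 * expR (c * ln (u / A0))) * besselI0 y.
  congr (_ * _); have uA0 : 0 < u / A0 by rewrite divr_gt0.
  rewrite /powR gt_eqF// mulrBl mul1r expRD expRN lnK ?posrE//.
  by field; rewrite !gt_eqF.
rewrite (_ : (fun n => _) = (fun n => omega * (u^-1 * expR (c * ln (u / A0))) *
    series (fun k : nat => (y / 2) ^+ (2 * k) / (k`!)%:R ^+ 2) n)).
  by apply: cvgM; [exact: cvg_cst|exact: cvg_besselI0].
apply/funext => n; rewrite -mulrA; congr (_ * _).
rewrite /series /= mulr_sumr; apply: eq_bigr => k _.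
rewrite /pointing_error_term /log_power /y.
have F : 'C(2 * k, k)%:R / (2 * k)`!%:R = (k`!%:R ^+ 2)^-1 :> R.
  have := @bin_fact (2 * k) k; rewrite leq_pmull// => /(_ isT).
  rewrite mul2n -addnn addnK => <-.
  by rewrite !natrM; field; rewrite !pnatr_eq0 -!lt0n ?fact_gt0 ?bin_gt0 ?leq_addr.
rewrite -F; have -> : (- (v * ln (u / A0)) / 2) ^+ (2 * k) =
    (v / 2) ^+ (2 * k) * (- ln (u / A0)) ^+ (2 * k).
  by rewrite -exprMn; congr (_ ^+ _); field.
by field; rewrite !gt_eqF// ltr0n fact_gt0.
Qed.

(** [besselI0] is given as a limit, so measurability is inherited from the partial sums, extended by
    0 off []0, A0]]. *)
Lemma measurable_pointing_error_density :
  measurable_fun setT (pointing_error_density A0 omega q).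
Proof.
pose D : set (measurableTypeR R) := `]0, A0]%classic.
have mD : measurable D by exact: measurable_itv.
apply: (measurable_fun_cvg (h := fun n =>
  (fun u => omega * \sum_(0 <= k < n) pointing_error_term k u) \_ D)).
  move=> n; have : measurable_fun D (fun u => omega * \sum_(0 <= k < n) pointing_error_term k u).
    apply: measurable_funM => //; apply: measurable_sum => k; apply: measurable_funM => //.
    exact: measurable_log_power.
  by move/(measurable_restrictT _ mD).
move=> u _; case: (boolP (u \in D)) => uD.
  rewrite (_ : (fun n => _) = fun n => omega * \sum_(0 <= k < n) pointing_error_term k u).
    by apply: cvg_pointing_error_density; move: uD; rewrite mem_setE in_itv.
  by apply/funext => n; rewrite patchE uD.
rewrite (_ : (fun n => _) = fun=> 0).
  rewrite /pointing_error_density; move: uD; rewrite mem_setE in_itv /= => /negbTE ->.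
  exact: cvg_cst.
by apply/funext => n; rewrite patchE (negbTE uD).
Qed.

End PointingErrors.

(** * Summation of the series of G-functions *)

Section Series.
Context {R : realType}.
Notation mu := (@lebesgue_measure R).

Lemma cvg_real_complex (u : nat -> R) (l : R) : u @ \oo --> l ->
  (fun n => (u n)%:C : R[i]^o) @ \oo --> (l%:C : R[i]^o).
Proof.
move=> ul; apply/cvgrPdist_lt => e e0.
(* Positivity in the order of [R[i]] forces [e] to be real. *)
have eE : e = (complex.Re e)%:C.
  by move: e0; case: e => a b; rewrite ltcE /= => /andP[/eqP -> _].
have e1 : 0 < complex.Re e by move: e0; rewrite eE ltcR.
move/cvgrPdist_lt : ul => /(_ _ e1); apply: filterS => n H.
by rewrite -rmorphB eE normc_def /= expr0n /= addr0 sqrtr_sqr ltcR.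
Qed.

Variables (al be hl A0 omega q : R).
Hypotheses (al0 : 0 < al) (be0 : 0 < be) (hl0 : 0 < hl).
Hypotheses (A00 : 0 < A0) (omega0 : 0 < omega) (q0 : 0 < q).

Let c := (1 + q ^+ 2) * omega / (2 * q).
Let v := (1 - q ^+ 2) * omega / (2 * q).
Let c0 : 0 < c.
Proof.
by rewrite /c divr_gt0 ?mulr_gt0// ltr_pwDl// sqr_ge0.
Qed.

Let W := gamma_smooth al (gamma_smooth be (@heaviside R)).

Let gb_nd := gamma_smooth_nondecreasing be0 (@heaviside_nondecreasing R) (@heaviside_bounded R).
Let gb_bd := gamma_smooth_bounded be0 (@heaviside_nondecreasing R) (@heaviside_bounded R).
Let W_nd : {homo W : x y / x <= y} := gamma_smooth_nondecreasing al0 gb_nd gb_bd.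
Let W_bd := gamma_smooth_bounded al0 gb_nd gb_bd.

Let D : set (measurableTypeR R) := `]0, A0]%classic.
Let mD : measurable D. Proof. exact: measurable_itv. Qed.

Let mX : measurable_fun D (fun u => ln (u / A0)).
Proof.
apply: measurable_funTS; apply: (measurableT_comp (f := @ln R)) => //.
exact: measurable_funM.
Qed.

(** [log_power_cdf] is a mixture of translated step functions, and both smoothings commute with
    mixtures. As [W] does not depend on [n], the series over [k] acts on the weights alone. *)
Lemma gamma_smooth2_log_power_cdf n y :
  gamma_smooth al (gamma_smooth be (log_power_cdf A0 c n)) y =
  \int[mu]_(u in D) (log_power A0 n c u * W (y - ln (u / A0))).
Proof.
have iL := integrable_log_power A00 n c0.
have -> : log_power_cdf A0 c n =
    fun w => \int[mu]_(u in D) (log_power A0 n c u * heaviside (w - ln (u / A0))).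
  apply/funext => w; apply: eq_Rintegral => u _; rewrite /heaviside subr_gt0.
  by case: ifP; rewrite ?mulr1 ?mulr0.
have -> : gamma_smooth be (fun w => \int[mu]_(u in D)
      (log_power A0 n c u * heaviside (w - ln (u / A0)))) =
    fun w => \int[mu]_(u in D) (log_power A0 n c u *
      gamma_smooth be (@heaviside R) (w - ln (u / A0))).
  apply/funext => w.
  exact: (gamma_smooth_mixture be0 (@heaviside_nondecreasing R) (@heaviside_bounded R)).
exact: (gamma_smooth_mixture al0 gb_nd gb_bd).
Qed.

Let z x := al * be * x / (A0 * hl).
Let F t := W (ln (al * be * t)) / (rGamma al * rGamma be).

Let zE x u : 0 < x -> 0 < u -> ln (z x) - ln (u / A0) = ln (al * be * (x / (hl * u))).
Proof.
move=> x0 u0; rewrite -ln_div ?posrE ?divr_gt0 ?mulr_gt0//; congr ln.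
by rewrite /z; field; rewrite !gt_eqF.
Qed.

Let f n u : R := omega * \sum_(0 <= k < n) pointing_error_term A0 omega q k u.

Let D_in u : D u -> 0 < u <= A0.
Proof. by rewrite /D /= in_itv. Qed.

Let mWX y : measurable_fun D (fun u => W (y - ln (u / A0))).
Proof.
apply: (measurableT_comp (f := W)); first exact: nondecreasing_measurable.
exact: measurable_funB.
Qed.

Let integrable_log_powerW n y :
  mu.-integrable D (EFin \o (fun u => log_power A0 n c u * W (y - ln (u / A0)))).
Proof.
have iL := integrable_log_power A00 n c0.
exact: (le_integrable_bounded mD iL (mWX y) (fun u => W_bd (y - ln (u / A0)))).
Qed.

Lemma cdf_h2_partial_sumE x n : 0 < x ->
  cdf_h2_partial_sum al be hl A0 omega q x n =
  (\int[mu]_(u in D) (f n u * F (x / (hl * u))))%:C.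
Proof.
move=> x0; have z0 : 0 < z x by rewrite /z divr_gt0 ?mulr_gt0.
rewrite /cdf_h2_partial_sum -/c -/v -/(z x) /series /=.
pose I k := \int[mu]_(u in D) (pointing_error_term A0 omega q k u * W (ln (z x) - ln (u / A0))).
have IE k : cdf_h2_term al be c v (z x) k = (I k)%:C.
  rewrite /cdf_h2_term (meijerG_gamma_smooth A00)// gamma_smooth2_log_power_cdf -rmorphM.
  congr (_%:C); rewrite /I -RintegralZl//.
  by apply: eq_Rintegral => u _; rewrite /pointing_error_term -/c -/v !mulrA.
pose t k u := pointing_error_term A0 omega q k u * W (ln (z x) - ln (u / A0)).
have it k : mu.-integrable D (EFin \o t k).
  have := integrableZl (mu := mu) mD ('C(2 * k, k)%:R * (v / 2) ^+ (2 * k))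
    (integrable_log_powerW (2 * k) (ln (z x))).
  by apply: eq_integrable => // u _; rewrite /t /pointing_error_term /= -/c -/v -EFinM !mulrA.
have [iS IS] : mu.-integrable D (EFin \o (fun u => \sum_(0 <= k < n) t k u)) /\
    \int[mu]_(u in D) (\sum_(0 <= k < n) t k u) = \sum_(0 <= k < n) I k.
  elim: n => [|n [i e]].
    under eq_fun do rewrite big_geq//.
    rewrite big_geq//; split; first exact: integrable0.
    by rewrite /Rintegral integral0.
  under eq_fun do rewrite big_nat_recr//=.
  rewrite big_nat_recr//= -e; split.
    exact: (integrableD (mu := mu) mD i (it n)).
  by rewrite -[I n]/(\int[mu]_(u in D) t n u) -RintegralD.
under eq_bigr do rewrite IE.
rewrite -rmorph_sum -rmorphM -IS; congr (_%:C); rewrite -RintegralZl//.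
apply: eq_Rintegral => u; rewrite inE => /D_in /andP[u0 _].
rewrite /f /F -zE// /t -mulr_suml; set S := \sum_(_ <= _ < _) _.
by field; rewrite !gt_eqF// rGamma_gt0.
Qed.

(** Only even powers of [v] occur, so all terms are nonnegative and monotone convergence applies;
    the real value [r] of the limit integral lets the limit descend from extended to real
    numbers. *)
Lemma cvg_cdf_h2_partial_sum x r : 0 < x ->
  (\int[mu]_(u in `]0%R, A0]) (pointing_error_density A0 omega q u *
     F (x / (hl * u)))%:E = r%:E)%E ->
  cdf_h2_partial_sum al be hl A0 omega q x @ \oo --> (r%:C : R[i]^o).
Proof.
move=> x0 Ir.
rewrite (_ : cdf_h2_partial_sum _ _ _ _ _ _ _ = fun n =>
  (\int[mu]_(u in D) (f n u * F (x / (hl * u))))%:C : R[i]^o); last first.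
  by apply/funext => n; exact: cdf_h2_partial_sumE.
apply: cvg_real_complex.
pose g n u : \bar R := (f n u * F (x / (hl * u)))%:E.
have F0 t : 0 <= F t.
  have /andP[w0 _] := W_bd (ln (al * be * t)).
  by rewrite /F divr_ge0// mulr_ge0// ltW// rGamma_gt0.
have mg n : measurable_fun D (g n).
  apply/measurable_EFinP/measurable_funM.
    apply: measurable_funM => //; apply: measurable_sum => k.
    by apply: measurable_funM => //; exact: measurable_log_power.
  have : measurable_fun D (fun u => W (ln (z x) - ln (u / A0)) / (rGamma al * rGamma be)).
    exact: measurable_funM.
  by apply: eq_measurable_fun => u; rewrite inE => /D_in /andP[u0 _]; rewrite /F -zE.
have f0 n u : D u -> 0 <= f n u.
  move=> /D_in uA; rewrite /f mulr_ge0 ?(ltW omega0)// sumr_ge0// => k _.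
  exact: pointing_error_term_ge0.
have g0 n u : D u -> (0 <= g n u)%E.
  by move=> Du; rewrite lee_fin mulr_ge0// f0.
have ndg u : D u -> nondecreasing_seq (g ^~ u).
  move=> Du n m nm; rewrite lee_fin ler_wpM2r// /f ler_wpM2l ?(ltW omega0)//.
  rewrite (big_cat_nat (leq0n n) nm)//= lerDl sumr_ge0// => k _.
  by apply: pointing_error_term_ge0 => //; exact: D_in.
have : (\int[mu]_(u in D) g n u @[n --> \oo] --> \int[mu]_(u in D) limn (g ^~ u))%E.
  exact: cvg_monotone_convergence.
rewrite (_ : integral _ _ _ = r%:E); last first.
  rewrite -Ir; apply: eq_integral => u; rewrite inE => Du; apply/cvg_lim => //.
  apply: cvg_EFin; first exact: nearW.
  by apply: cvgM; [apply: cvg_pointing_error_density => //; exact: D_in|exact: cvg_cst].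
by move/fine_cvgP => [_]; exact.
Qed.

End Series.

(** * The outage event *)

Section Outage.
Context {R : realType}.

(** For [g1 < a1 / a2] the coefficient [a1 - a2 * g1] is positive, so both conditions are lower
    bounds on [h^2], and [h >= 0] allows taking square roots. *)
Lemma outage_event (a1 a2 B2 gbar g1 g2 h : R) : 0 < a1 -> 0 < a2 -> 0 < B2 -> 0 < gbar ->
  0 < g1 -> 0 < g2 -> 0 <= h -> g1 < a1 / a2 ->
  (g1 <= gamma21 a1 a2 B2 gbar h) && (g2 <= gamma22 a2 B2 gbar h) =
  (Num.sqrt (Num.max (g1 / (a1 * B2 * gbar - a2 * B2 * gbar * g1)) (g2 / (a2 * B2 * gbar)))
     <= h).
Proof.
move=> a10 a20 B0 G0 g10 g20 h0 ga.
have ga' : 0 < a1 - a2 * g1 by rewrite subr_gt0 mulrC -ltr_pdivlMr.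
have BG : 0 < B2 * gbar by rewrite mulr_gt0.
rewrite -[in RHS](ger0_norm h0) -sqrtr_sqr ler_sqrt ?sqr_ge0// ge_max /gamma21 /gamma22.
set y := h ^+ 2; have y0 : 0 <= y by exact: sqr_ge0.
have d0 : 0 < a2 * B2 * gbar * y + 1 by rewrite ltr_wpDl// !mulr_ge0// ltW.
congr (_ && _); last by rewrite ler_pdivrMr ?mulr_gt0// mulrC.
rewrite ler_pdivlMr// ler_pdivrMr; last first.
  have -> : a1 * B2 * gbar - a2 * B2 * gbar * g1 = (a1 - a2 * g1) * (B2 * gbar) by ring.
  by rewrite mulr_gt0.
by rewrite -subr_ge0 -[RHS]subr_ge0; congr (0 <= _); ring.
Qed.

(** Interference from the second message grows with the signal: [a1 / a2] is an unattained supremum,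
    so a threshold equal to it already forces outage. *)
Lemma gamma21_lt (a1 a2 B2 gbar h : R) : 0 < a1 -> 0 < a2 -> 0 < B2 -> 0 < gbar ->
  gamma21 a1 a2 B2 gbar h < a1 / a2.
Proof.
move=> a10 a20 B0 G0; rewrite /gamma21.
have y0 : 0 <= h ^+ 2 by exact: sqr_ge0.
have d0 : 0 < a2 * B2 * gbar * h ^+ 2 + 1.
  by rewrite ltr_wpDl// mulr_ge0// !mulr_ge0// ltW.
rewrite ltr_pdivrMr// mulrDr mulr1.
have -> : a1 / a2 * (a2 * B2 * gbar * h ^+ 2) = a1 * B2 * gbar * h ^+ 2.
  by field; rewrite gt_eqF.
by rewrite ltrDl divr_gt0.
Qed.

Lemma turbulence_alpha_gt0 (s : R) : 0 < s -> 0 < turbulence_alpha s.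
Proof.
move=> s0; rewrite invr_gt0 subr_gt0 -expR0 ltr_expR divr_gt0 ?powR_gt0//.
  by rewrite mulr_gt0 ?exprn_gt0//; lra.
by rewrite ltr_pwDl// mulr_ge0 ?powR_ge0//; lra.
Qed.

Lemma turbulence_beta_gt0 (s : R) : 0 < s -> 0 < turbulence_beta s.
Proof.
move=> s0; rewrite invr_gt0 subr_gt0 -expR0 ltr_expR divr_gt0 ?powR_gt0//.
  by rewrite mulr_gt0 ?exprn_gt0//; lra.
by rewrite ltr_pwDl// mulr_ge0 ?powR_ge0//; lra.
Qed.

End Outage.

Unset Implicit Arguments.

Theorem proposition2 (R : realType) (d : measure_display)
    (T : measurableType d) (P : probability T R)
    (a1 a2 B2 gbar R1 R2 : R)
    (sigma hl A0 omega q : R)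
    (hs hg h2 : {RV P >-> R})
    (a2_gt0 : 0 < a2) (a2_lt_a1 : a2 < a1) (a_sum : a1 + a2 = 1)
    (B2_gt0 : 0 < B2) (gbar_gt0 : 0 < gbar) (R1_gt0 : 0 < R1) (R2_gt0 : 0 < R2)
    (sigma_gt0 : 0 < sigma) (hl_gt0 : 0 < hl)
    (A0_gt0 : 0 < A0) (omega_gt0 : 0 < omega) (q_gt0 : 0 < q)
    (hs_gt0 : forall t : T, 0 < hs t)
    (hs_density : has_density P hs
       (gamma_gamma_density (turbulence_alpha sigma) (turbulence_beta sigma)))
    (hg_range : forall t : T, 0 <= hg t <= A0)
    (hg_density : has_density P hg (pointing_error_density A0 omega q))
    (hs_hg_indep : independent_RV2 P hs hg)
    (h2E : forall t : T, h2 t = hl * hs t * hg t) :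
  let g1th := 2 `^ R1 - 1 in
  let g2th := 2 `^ R2 - 1 in
  let alpha := turbulence_alpha sigma in
  let beta := turbulence_beta sigma in
  (1 - P [set t | (g1th <= gamma21 a1 a2 B2 gbar (h2 t))%R /\
                  (g2th <= gamma22 a2 B2 gbar (h2 t))%R])%E =
    (if g1th < a1 / a2 then
       cdf h2 (Num.sqrt (Num.max
         (g1th / (a1 * B2 * gbar - a2 * B2 * gbar * g1th))
         (g2th / (a2 * B2 * gbar))))
     else 1%E)
  /\
  (forall x : R, 0 < x ->
     cdf_h2_partial_sum alpha beta hl A0 omega q x @ \oo -->
       ((fine (cdf h2 x))%:C : R[i]^o)).
Proof.
move=> g1th g2th alpha beta.
have al0 : 0 < alpha by exact: turbulence_alpha_gt0.
have be0 : 0 < beta by exact: turbulence_beta_gt0.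
have powR2_gt1 (r : R) : 0 < r -> 0 < 2 `^ r - 1.
  move=> r0; rewrite subr_gt0 /powR gt_eqF// -[X in X < _]expR0 ltr_expR.
  by rewrite mulr_gt0// ln_gt0// ltr1n.
have g10 : 0 < g1th by exact: powR2_gt1.
have g20 : 0 < g2th by exact: powR2_gt1.
have a10 : 0 < a1 := lt_trans a2_gt0 a2_lt_a1.
(* The same functions are repackaged with codomain [measurableTypeR R], on which the Lebesgue
   measure lives. *)
have mhs : measurable_fun setT (hs : T -> measurableTypeR R) by exact: (measurable_funPT hs).
have mhg : measurable_fun setT (hg : T -> measurableTypeR R) by exact: (measurable_funPT hg).
pose X : {mfun T >-> measurableTypeR R} :=
  HB.pack (hs : T -> measurableTypeR R) (isMeasurableFun.Build _ _ _ _ _ mhs).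
pose Y : {mfun T >-> measurableTypeR R} :=
  HB.pack (hg : T -> measurableTypeR R) (isMeasurableFun.Build _ _ _ _ _ mhg).
have XY (A B : set (measurableTypeR R)) : measurable A -> measurable B ->
  P (X @^-1` A `&` Y @^-1` B) = (P (X @^-1` A) * P (Y @^-1` B))%E.
  exact: hs_hg_indep.
pose F t := gamma_smooth alpha (gamma_smooth beta (@heaviside R)) (ln (alpha * beta * t)) /
  (rGamma alpha * rGamma beta).
have XF t : 0 < t -> P [set w | X w <= t] = (F t)%:E.
  move=> t0; rewrite /F -gamma_gamma_cdf// -hs_density; last exact: measurable_itv.
  by congr (P _); apply/seteqP; split => w; rewrite /= in_itv.
have mfY : measurable_fun setT (pointing_error_density A0 omega q).
  exact: measurable_pointing_error_density.
have fY_supp u : ~~ (0 < u <= A0) -> pointing_error_density A0 omega q u = 0.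
  by rewrite /pointing_error_density => /negbTE ->.
have cdfE x : 0 < x -> cdf h2 x =
  (\int[lebesgue_measure]_(u in `]0%R, A0])
     (pointing_error_density A0 omega q u * F (x / (hl * u)))%:E)%E.
  move=> x0; rewrite -(cdf_mul_independent XY hl_gt0 hg_density mfY fY_supp XF x0).
  by congr (P _); apply/seteqP; split => t; rewrite /= in_itv /= h2E.
have atom x : 0 < x -> P (h2 @^-1` [set x]) = 0%E.
  move=> x0; rewrite -(mul_independent_atom XY hl_gt0 hs_density (lt0r_neq0 x0)).
  by congr (P _); apply/seteqP; split => t; rewrite /= h2E.
split; last first.
  move=> x x0; apply: cvg_cdf_h2_partial_sum => //.
  rewrite fineK; last exact: fin_num_measure.
  by rewrite cdfE.
have h20 t : 0 <= h2 t.
  by rewrite h2E mulr_ge0 ?mulr_ge0 ?(ltW hl_gt0) ?(ltW (hs_gt0 t))//; have /andP[] := hg_range t.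
case: ifPn => [ga|]; last first.
  rewrite -leNgt => ga; rewrite (_ : [set t | _] = set0) ?measure0 ?sube0//.
  apply/seteqP; split => t //= -[+ _]; apply/negP; rewrite -ltNge.
  by rewrite (lt_le_trans _ ga)// gamma21_lt.
set th := Num.sqrt _.
(* Positivity is needed because [cdfE] and [atom] concern positive points. *)
have th0 : 0 < th.
  rewrite sqrtr_gt0 lt_max; apply/orP; right.
  by rewrite divr_gt0// !mulr_gt0.
rewrite (_ : [set t | _] = h2 @^-1` `[th, +oo[%classic); last first.
  apply/seteqP; split => t /=; rewrite in_itv /= andbT.
    by move=> [u1 u2]; rewrite -(@outage_event _ a1 a2)// u1 u2.
  by rewrite -(@outage_event _ a1 a2)// => /andP[].
have mh2 (i : interval R) : measurable (h2 @^-1` [set` i]).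
  by rewrite -[_ @^-1` _]setTI; apply: (measurable_funPT h2) => //; exact: measurable_itv.
rewrite -probability_setC//.
(* The complement of the no-outage event is [h2 < th], whereas [cdf] uses a closed half-line; the
   difference is the null event [h2 = th]. *)
have -> : cdf h2 th = P (h2 @^-1` `]-oo, th[%classic `|` h2 @^-1` [set th]).
  congr (P _); apply/seteqP; split => t; rewrite /= !in_itv /= le_eqVlt.
    by move=> /orP[/eqP|]; [right|left].
  by move=> [->|->]; rewrite ?orbT ?eqxx.
have mth : measurable (h2 @^-1` [set th]).
  by rewrite -[_ @^-1` _]setTI; apply: (measurable_funPT h2) => //; exact: measurable_set1.
rewrite measureU//; last first.
  by apply/seteqP; split => t //= -[]; rewrite in_itv /= => + e; rewrite e ltxx.
rewrite [X in (_ + X)%E]atom// adde0; congr (P _); apply/seteqP; split => t; rewrite /= !in_itv /= andbT.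
  by move/negP; rewrite -ltNge.
by move=> lt; apply/negP; rewrite -ltNge.
Qed.
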